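(* For any integer $p\ge2$ and $1\le k\le p$, let $X^{(k)},X^{(k)}_1,\dots,X^{(k)}_N$ be i.i.d. with law $\mu^{(k)}$, a sequence of random variables on the probability space $(\Omega^{(k)},\mu^{(k)})$, and let $\mathcal{F}^{(k)}$ be a class of functions defined on $(\Omega^{(k)},\mu^{(k)})$. Assume $0\in\mathcal{F}^{(k)}$ or $\mathcal{F}^{(k)}$ is symmetric (i.e. $f^{(k)}\in\mathcal{F}^{(k)}$ implies $-f^{(k)}\in\mathcal{F}^{(k)}$). Then, for any $q\ge1$, $$\left(\mathbb{E}\sup_{f^{(k)}\in\mathcal{F}^{(k)},\,1\le k\le p}\bigg|\frac1N\sum_{i=1}^N\prod_{k=1}^pf^{(k)}(X^{(k)}_i)-\mathbb{E}\prod_{k=1}^pf^{(k)}(X^{(k)})\bigg|^q\right)^{1/q}\lesssim_{p,q}\bigg(\prod_{k=1}^pd_{\psi_2}(\mathcal{F}^{(k)})\bigg)\mathscr{E}_N\big((\mathcal{F}^{(k)})_{k=1}^p\big),$$ where $$\mathscr{E}_N\big((\mathcal{F}^{(k)})_{k=1}^p\big):=\frac{\sum_{k=1}^p\bar\gamma(\mathcal{F}^{(k)},\psi_2)}{\sqrt N}+\frac{\prod_{k=1}^p\big(\bar\gamma(\mathcal{F}^{(k)},\psi_2)+(\log N)^{1/2}\big)}{N},\qquad\bar\gamma(\mathcal{F}^{(k)},\psi_2):=\frac{\gamma(\mathcal{F}^{(k)},\psi_2)}{d_{\psi_2}(\mathcal{F}^{(k)})}.$$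
   Context: $a\lesssim_{p,q}b$ means $a\le c\,b$ for some constant $c>0$ depending only on $p,q$. For a function $f$ on a probability space $(\Omega,\mu)$, $\|f\|_{\psi_2}=\inf\{c>0:\mathbb{E}_{X\sim\mu}\exp(|f(X)|^2/c^2)\le2\}$ (with $\inf\emptyset=\infty$), and $d_{\psi_2}(\mathcal{F})=\sup_{f\in\mathcal{F}}\|f\|_{\psi_2}$. For each $k$ these quantities, and $\gamma(\mathcal{F}^{(k)},\psi_2)$ below, are taken with respect to $\mu^{(k)}$. Talagrand's functional: for a metric space $(\mathcal{F},d)$, an admissible sequence is an increasing sequence of subsets $\mathcal{F}_0\subset\mathcal{F}_1\subset\cdots\subset\mathcal{F}$ with $|\mathcal{F}_0|=1$, $|\mathcal{F}_s|\le2^{2^s}$ for $s\ge1$, and $\bigcup_{s}\mathcal{F}_s$ dense in $\mathcal{F}$; and $\gamma(\mathcal{F},d)=\inf\sup_{f\in\mathcal{F}}\sum_{s\ge0}2^{s/2}d(f,\mathcal{F}_s)$, the infimum being over all admissible sequences. $\gamma(\mathcal{F},\psi_2)$ denotes this functional when the distance is induced by the $\psi_2$-norm. The sequences $(X^{(k)}_i)_{i=1}^N$ and $(X^{(k')}_i)_{i=1}^N$ are not necessarily independent for $k\ne k'$.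
   Formalization: The p-tuples (X^(k))_k, (X_i^(k))_k are assumed i.i.d. jointly (any dependence across k), and E sup over a class means the supremum of E max over finite subfamilies; with only marginal i.i.d. or the pointwise sup over uncountable classes the claim fails. *)

(* Defs.v *)
From HB Require Import structures.
From mathcomp Require Import all_boot all_order all_algebra.
From mathcomp Require Import all_classical all_reals all_analysis.
From mathcomp Require Import measurable_realfun.

Set Implicit Arguments.
Unset Strict Implicit.
Unset Printing Implicit Defensive.

Import Order.TTheory GRing.Theory Num.Theory.
Import numFieldNormedType.Exports.

Local Open Scope classical_set_scope.
Local Open Scope ring_scope.
Local Open Scope ereal_scope.

Section psi2.
Context {R : realType} {d : measure_display} {T : measurableType d}.
Variable mu : probability T R.

Definition psi2_norm (f : T -> R) : \bar R :=
  ereal_inf [set c%:E | c in [set c : R | (0 < c)%R /\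
    \int[mu]_x (expR (`|f x| ^+ 2 / c ^+ 2))%:E <= 2%:E]].

Definition psi2_dist (f g : T -> R) : \bar R := psi2_norm (fun x => f x - g x)%R.

Definition psi2_diam (F : set (T -> R)) : \bar R :=
  ereal_sup [set psi2_norm f | f in F].

End psi2.

(* The distance may take the value +oo and need not separate points: the
   psi_2-distance only sees functions up to almost everywhere equality. *)
Section talagrand.
Context {R : realType} {E : Type}.
Variable dist : E -> E -> \bar R.

Definition set_dist (f : E) (A : set E) : \bar R := ereal_inf [set dist f g | g in A].

Definition admissible (F : set E) (A : nat -> set E) : Prop :=
  [/\ (forall s, A s `<=` F),
      (forall s, A s `<=` A s.+1),
      (exists f, A 0%N = [set f]),
      (forall s, (0 < s)%N -> (A s #<= `I_(2 ^ (2 ^ s)))%card) &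
      (forall f, F f -> forall e : R, (0 < e)%R ->
         exists s g, A s g /\ dist f g < e%:E)].

Definition talagrand_gamma (F : set E) : \bar R :=
  ereal_inf [set ereal_sup [set \sum_(0 <= s <oo)
                              (2 `^ (s%:R / 2))%:E * set_dist f (A s) | f in F]
            | A in admissible F].

End talagrand.

Section rate.
Context {R : realType}.

Definition gamma_psi2 {d} {T : measurableType d} (mu : probability T R)
  (F : set (T -> R)) : \bar R := talagrand_gamma (psi2_dist mu) F.

(* The degenerate quotients: 0 / 0 = 0 holds in \bar R, whereas +oo / +oo is set
   to +oo explicitly (the library value +oo * +oo^-1 is 0, which would make
   an upper bound in terms of gamma_bar false rather than void). *)
Definition gamma_bar {d} {T : measurableType d} (mu : probability T R)
    (F : set (T -> R)) : \bar R :=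
  if psi2_diam mu F == +oo then +oo else gamma_psi2 mu F / psi2_diam mu F.

Definition rateE (N p : nat) (d : 'I_p -> measure_display)
    (T : forall k, measurableType (d k)) (mu : forall k, probability (T k) R)
    (F : forall k, set (T k -> R)) : \bar R :=
  (\sum_(k < p) gamma_bar (mu k) (F k)) / (Num.sqrt N%:R)%:E
  + (\prod_(k < p) (gamma_bar (mu k) (F k) + (Num.sqrt (ln N%:R))%:E)) / N%:R%:E.

End rate.

(* The product sigma-algebra, generated by the coordinate maps. *)
Definition prod_measurable {K : Type} {d : K -> measure_display}
    {T : forall k, measurableType (d k)} : set (set (forall k, T k)) :=
  <<s [set B | exists k (A : set (T k)), measurable A /\
               B = (fun x : forall k, T k => x k) @^-1` A] >>.

(* The random elements Y i := (Y i k)_k of the product space are independent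
   over i and share one law; for a fixed i, the coordinates Y i k may depend on
   each other in an arbitrary way.  Letting some of the B i be the whole space
   gives the product rule for all subfamilies. *)
Definition iid_tuples {R : realType} {d0 : measure_display}
    {Omega : measurableType d0} (P : probability Omega R)
    {K : Type} {d : K -> measure_display} {T : forall k, measurableType (d k)}
    {I : finType} (Y : I -> forall k, {RV P >-> T k}) : Prop :=
  (forall i j B, prod_measurable B ->
     P [set w | B (fun k => Y i k w)] = P [set w | B (fun k => Y j k w)]) /\
  (forall B : I -> set (forall k, T k), (forall i, prod_measurable (B i)) ->
     P [set w | forall i, B i (fun k => Y i k w)] =
     \prod_(i : I) P [set w | B i (fun k => Y i k w)]).

(* The expectation of the supremum of a family of nonnegative random variables
   that may be uncountable, understood as usual as the supremum of
   E max_{t in S} Z_t over the finite S included in D.  (The pointwise supremum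
   may fail to be measurable, and depends on the choice of versions of the Z_t.)
   It is the integral of the pointwise supremum when D is countable, see
   Esup_countable. *)
Definition Esup {R : realType} {d0 : measure_display} {Omega : measurableType d0}
    (P : probability Omega R) {I : Type} (D : set I) (Z : I -> Omega -> \bar R)
    : \bar R :=
  ereal_sup [set r | exists n (t : 'I_n -> I), (forall j, D (t j)) /\
    r = \int[P]_w \big[maxe/0]_(j < n) Z (t j) w].

Lemma Esup_countable {R : realType} {d0 : measure_display}
    {Omega : measurableType d0} (P : probability Omega R) {I : Type} (D : set I)
    (Z : I -> Omega -> \bar R) :
  countable D -> D !=set0 ->
  (forall t, D t -> measurable_fun setT (Z t)) ->
  (forall t, D t -> forall w, 0 <= Z t w) ->
  Esup P D Z = \int[P]_w ereal_sup [set Z t w | t in D].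
Proof.
move=> cD [t0 Dt0] mZ Z0.
have [g Dg gD] : exists2 g : nat -> I, (forall n, D (g n)) &
    (forall t, D t -> exists n, g n = t).
  have /pfcard_geP[D0|[g]] := cD; first by rewrite D0 in Dt0.
  exists g => [n|t Dt]; last first.
    by have [n _ <-] := (@surj _ _ _ _ g) t Dt; exists n.
  exact: (@funS _ _ _ _ g).
pose G n w := \big[maxe/0]_(j < n) Z (g j) w.
have G0 n w : 0 <= G n w by exact: bigmax_ge_id.
have ndG w : nondecreasing_seq (G^~ w).
  by move=> m n mn; exact: (le_bigmax_ord xpredT (fun j => Z (g j) w)).
have mmax n (t : 'I_n -> I) : (forall j, D (t j)) ->
    measurable_fun setT (fun w => \big[maxe/0]_(j < n) Z (t j) w).
  move=> Dt; elim: n t Dt => [|n ih] t Dt.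
    by under eq_fun do rewrite big_ord0; exact: measurable_cst.
  under eq_fun do rewrite big_ord_recl.
  apply: measurable_maxe; first exact: mZ.
  exact: (ih (fun j => t (lift ord0 j))).
have mG n : measurable_fun setT (G n) by apply: mmax => j; exact: Dg.
have supE w : ereal_sup [set Z t w | t in D] = limn (G^~ w).
  have /cvg_lim -> // := ereal_nondecreasing_cvgn (ndG w).
  apply/eqP; rewrite eq_le; apply/andP; split.
    apply: ge_ereal_sup => _ [t /gD[n <-] <-].
    apply: le_trans (ereal_sup_ubound (x := G n.+1 w) _); last by exists n.+1.
    exact: (le_bigmax 0 (fun j : 'I_n.+1 => Z (g j) w) ord_max).
  apply: ge_ereal_sup => _ [n _ <-]; apply: bigmax_le => [|j _].
    by apply: le_trans (Z0 _ Dt0 w) _; apply: ereal_sup_ubound; exists t0.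
  by apply: ereal_sup_ubound; exists (g j).
have intE : \int[P]_w ereal_sup [set Z t w | t in D] =
    limn (fun n => \int[P]_w G n w).
  under eq_integral do rewrite supE.
  by apply: monotone_convergence => // w _; exact: ndG.
have msup : measurable_fun setT (fun w => ereal_sup [set Z t w | t in D]).
  apply: (emeasurable_fun_cvg G) => // w _; rewrite supE.
  by apply: ereal_nondecreasing_is_cvgn; exact: ndG.
apply/eqP; rewrite eq_le; apply/andP; split.
  apply: ge_ereal_sup => _ [n [t [Dt ->]]]; apply: ge0_le_integral => //.
  - by move=> w _; exact: bigmax_ge_id.
  - exact: mmax.
  - move=> w _; apply: bigmax_le => [|j _].
      by apply: le_trans (Z0 _ Dt0 w) _; apply: ereal_sup_ubound; exists t0.
    by apply: ereal_sup_ubound; exists (t j).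
rewrite intE; apply: lime_le.
  apply: ereal_nondecreasing_is_cvgn => m n mn; apply: ge0_le_integral => // w _.
  exact: ndG.
apply: nearW => n; apply: ereal_sup_ubound.
by exists n, (fun j => g j); split=> // j; exact: Dg.
Qed.

Definition product_deviation {R : realType} {d0 : measure_display}
    {Omega : measurableType d0} (P : probability Omega R) (N p : nat)
    {d : 'I_p -> measure_display} {T : forall k, measurableType (d k)}
    (X : forall k, {RV P >-> T k}) (Xs : 'I_N -> forall k, {RV P >-> T k})
    (f : forall k, T k -> R) (w : Omega) : \bar R :=
  `| ((\sum_(i < N) \prod_(k < p) f k (Xs i k w)) / N%:R)%:E
     - 'E_P[fun w => (\prod_(k < p) f k (X k w))%R] |.

(* Main.v *)
Require Import Defs.
From HB Require Import structures.
From mathcomp Require Import all_boot all_order all_algebra.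
From mathcomp Require Import all_classical all_reals all_analysis.
From mathcomp Require Import measurable_realfun.
From mathcomp Require Import ring lra.

(** The proof is a generic chaining in which every random quantity is controlled
through one exponential moment, so that the rest of the argument is
deterministic.

Rescale each class to psi_2-diameter at most 1, and let G_k be its rescaled
gamma functional.  Fix finitely many tuples (f_k).  Each f_k is reached from 0
by a finite chain taken from an almost optimal admissible sequence: there are at
most exp(C 2^s) links at level s, and the psi_2-lengths delta_s of the links
satisfy sum_s 2^(s/2) delta_s <= C G_k ([exists_chain]).  As the family is
finite, its members serve as the last points of the chains.  Telescoping over
the levels and over the p factors turns the product of the f_k into a sum of
terms delta_s prod_j g_j, where one factor g_k is a normalised link and the
other factors are points of the chains.

Put lambda_s = max(0, ln(N / 2^s)).  Up to a random factor l, the following hold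
for all levels s and all normalised links and points g of level s at once:
- sum_i (g(X_i)^2 - lambda_s)_+ <= 2^s l;
- sum_i min(g(X_i)^2, lambda_s)^p <= C N l;
- if 2^s <= N, the centred sum over i of g_k times the other factors truncated
  at height about sqrt(lambda_s) is at most C sqrt(N) 2^(s/2) l.
For each single g this is a Chernoff bound, with an exponential moment of at
most exp(2 2^s).  Since level s carries at most exp(C 2^s) objects, the sum of
all these exponentials, discounted by exp(- K 2^s), has expectation at most 1;
one plus this sum is e^L, and l = K + L ([exponential_union_bound] and
[exists_level_control]).  All moments of l are therefore bounded by constants.

Soft thresholding at sqrt(lambda_s), summed along the chain from the level where
2^(s/2) is about G_k, splits the sample vector of a point into z + y, where
|z|_2 <= C G_k sqrt(l), the empirical moment of y of order 2p is bounded, and y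
is at most C sqrt(ln N) in absolute value ([chain_decomposition]).  This gives
  sum_i prod_(j <> k) g_j(X_i)^2
    <= C l^p (N + prod_(j <> k) (G_j + sqrt(ln N))^2)
([cross_product_le]).  Now consider the term of a link of level s.  If
2^s <= N, truncate the factors other than the link.  The truncated sum is
controlled by the third estimate.  The error lives on the set I of the indices
where some factor exceeds the truncation height; the first estimate bounds
|I| (lambda_s + 1) by C 2^s l, hence the l_2-norm of the link on I by
C 2^(s/2) sqrt(l), and the Cauchy-Schwarz inequality applies.  If 2^s > N, then
lambda_s = 0 and Cauchy-Schwarz applies to all indices ([level_bound]).  Each
link thus contributes at most
  C l^(p+1) delta_s 2^(s/2) (sqrt(N) + prod_(j <> k) (G_j + sqrt(ln N))),
and the sum over the chain, divided by N, is the stated rate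
([chaining_bound], [deviation_bound]).

When a class has diameter 0, the deviations vanish almost everywhere
([product_deviation_ae0]); otherwise, an infinite diameter or an infinite gamma
functional makes the right-hand side infinite ([rateE_pinfty]). *)

Import Order.TTheory GRing.Theory Num.Theory.
Import numFieldNormedType.Exports.

Local Open Scope classical_set_scope.
Local Open Scope ring_scope.

(** * Exponential inequalities *)

Section real_inequalities.
Context {R : realType}.
Implicit Types x y : R.

Lemma exprn_le_fact_expR y n : 0 <= y -> y ^+ n <= n`!%:R * expR y.
Proof.
move=> y0; case: n => [|n]; first by rewrite expr0 mul1r -expR0 ler_expR.
have := expR_ge1Dxn n y0.
have f0 : 0 < (n.+1)`!%:R :> R by rewrite ltr0n fact_gt0.
rewrite -ler_pdivrMl// => h; apply: le_trans h; rewrite mulrC lerDr//.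
Qed.

Lemma expR_sub1 x : expR x - 1 <= x * expR x.
Proof.
have := expR_ge1Dx (- x); rewrite expRN => h.
have e0 := expR_gt0 x.
have : (1 - x) * expR x <= 1.
  by rewrite -ler_pdivlMr// div1r.
lra.
Qed.

Lemma norm_expR_sub1 x : `|expR x - 1| <= `|x| * expR `|x|.
Proof.
have [x0|x0] := leP 0 x.
  rewrite ger0_norm ?(ger0_norm x0); last by rewrite subr_ge0 -expR0 ler_expR.
  exact: expR_sub1.
have e1 : expR x <= 1 by rewrite expR_le1 ltW.
rewrite ler0_norm ?subr_le0// (ltr0_norm x0).
have := expR_ge1Dx x; have := expR_ge1Dx (- x) => h1 h2.
nra.
Qed.

(** The remainder e^x - 1 - x is at most x (e^x - 1), and |e^x - 1| <= |x| e^|x|.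
    This form of the second-order bound keeps the tilt e^|x| explicit, to be
    absorbed by a subgaussian factor. *)
Lemma expR_quad x : expR x <= 1 + x + x ^+ 2 * expR `|x|.
Proof.
suff : expR x - 1 - x <= x ^+ 2 * expR `|x| by lra.
have h1 : expR x - 1 - x <= x * (expR x - 1) by have := expR_sub1 x; lra.
apply: le_trans h1 _; apply: le_trans (ler_norm _) _; rewrite normrM.
apply: le_trans (ler_wpM2l (normr_ge0 _) (norm_expR_sub1 x)) _.
by rewrite mulrA -normrM -expr2 (ger0_norm (sqr_ge0 _)).
Qed.

Lemma expR_le1D2x x : 0 <= x -> x <= 2^-1 -> expR x <= 1 + 2 * x.
Proof.
move=> x0 x1.
have := expR_sub1 x; have := expR_gt0 x => e0 h.
have : (1 - x) * expR x <= 1 by lra.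
nra.
Qed.

Lemma expR_max0 x : expR (Num.max 0 x) <= 1 + expR x.
Proof.
have := expR_ge0 x; rewrite maxEle; case: ifP => _; first lra.
by rewrite expR0; lra.
Qed.

End real_inequalities.

(** * Truncated products of numbers *)

Section clip.
Context {R : realType}.
Implicit Types b x : R.

Definition clip b x := Num.min b (Num.max (- b) x).

Lemma clip_norm b x : 0 <= b -> `|clip b x| <= b.
Proof.
move=> b0; rewrite /clip ler_norml; apply/andP; split.
  by rewrite le_min le_max lexx /= andbT; lra.
by rewrite ge_min lexx.
Qed.

Lemma clip_id b x : `|x| <= b -> clip b x = x.
Proof.
by rewrite ler_norml /clip => /andP[h1 h2]; rewrite (max_idPr h1) (min_idPr h2).
Qed.

Lemma norm_clip_le b x : 0 <= b -> `|clip b x| <= `|x|.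
Proof.
move=> b0; have [xb|bx] := leP `|x| b; first by rewrite clip_id.
by rewrite (le_trans (clip_norm b x b0))// ltW.
Qed.

End clip.

Section product_moment.
Context {R : realType} {p : nat}.
Implicit Types u : 'I_p -> R.

(** A combination with weights of total at most 1 is at most the largest value,
    whose exponential is one of the terms: this replaces Hoelder's inequality for products of subgaussian
    variables. *)
Lemma expR_avg_le_sum u (a : 'I_p -> R) : (0 < p)%N -> (forall j, 0 <= a j) ->
  (forall j, 0 <= u j) ->
  \sum_(j < p) a j <= 1 ->
  expR (\sum_(j < p) a j * u j) <= \sum_(j < p) expR (u j).
Proof.
move=> p0 a0 u0 a1.
pose j0 : 'I_p := [arg max_(j > Ordinal p0) u j]%O.
have umax j : u j <= u j0.
  by rewrite /j0; case: arg_maxP => // i _ h; exact: h.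
apply: (@le_trans _ _ (expR (u j0))).
  rewrite ler_expR; apply: (@le_trans _ _ (\sum_(j < p) a j * u j0)).
    by apply: ler_sum => j _; rewrite ler_wpM2l.
  by rewrite -mulr_suml ler_piMl.
by rewrite (bigD1 j0)//= lerDl sumr_ge0// => j _; exact: expR_ge0.
Qed.

Definition prod_moment_cst : R := (2 * p%:R) ^+ p * expR p%:R.

Lemma prod_moment_cst_ge0 : 0 <= prod_moment_cst.
Proof. by rewrite mulr_ge0 ?expR_ge0 ?exprn_ge0. Qed.

Lemma sqr_le_expR (x : R) : (0 < p)%N -> x ^+ 2 <= (2 * p%:R) * expR (x ^+ 2 / (2 * p%:R)).
Proof.
move=> p0; have c0 : 0 < 2 * p%:R :> R by rewrite mulr_gt0// ltr0n.
rewrite -ler_pdivrMl// [leLHS]mulrC.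
by have := expR_ge1Dx (x ^+ 2 / (2 * p%:R)); lra.
Qed.

Lemma norm_le_expR (x : R) : (0 < p)%N -> `|x| <= (2 * p%:R) * expR (x ^+ 2 / (2 * p%:R)).
Proof.
move=> p0; have c1 : 2 <= 2 * p%:R :> R by rewrite ler_peMr// ler1n.
have e1 : 1 <= expR (x ^+ 2 / (2 * p%:R)).
  by rewrite -expR0 ler_expR divr_ge0 ?sqr_ge0//; lra.
have := sqr_le_expR x p0; rewrite -[leLHS]real_normK ?num_real//.
move: (expR _) e1 => E e1 h; have cE : 1 <= 2 * p%:R * E by nra.
have [a1|a1] := leP `|x| 1; first exact: le_trans a1 cE.
by apply: le_trans h; rewrite expr2 ler_peMr// ltW.
Qed.

(** Each factor u_j^2 and the tilt e^|u_k| costs a fraction 1/(2p) of the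
    exponent u_j^2, so that the whole product is paid for by a convex
    combination of these exponents. *)
Lemma prod_sqr_expR_le u k : (2 <= p)%N ->
  \prod_(j < p) u j ^+ 2 * expR `|u k| <=
  prod_moment_cst * \sum_(j < p) expR (u j ^+ 2).
Proof.
move=> p2; have p0 : (0 < p)%N by apply: leq_trans p2.
have pp : 2 <= p%:R :> R by rewrite ler_nat.
pose c : R := (2 * p%:R)^-1.
have c0 : 0 <= c by rewrite invr_ge0; lra.
have cp : c * p%:R = 2^-1 by rewrite /c; field; lra.
apply: (@le_trans _ _ (\prod_(j < p) ((2 * p%:R) * expR (u j ^+ 2 * c)) *
   expR (p%:R + u k ^+ 2 * c))).
  apply: ler_pM; rewrite ?expR_ge0 ?prodr_ge0//.
  - by move=> j _; exact: sqr_ge0.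
  - by apply: ler_prod => j _; rewrite sqr_ge0 sqr_le_expR.
  - rewrite ler_expR -[u k ^+ 2]real_normK ?num_real//.
    have : 0 <= c * (`|u k| - p%:R) ^+ 2 by rewrite mulr_ge0 ?sqr_ge0.
    rewrite (_ : c * _ = c * `|u k| ^+ 2 - (c * p%:R) * 2 * `|u k| + (c * p%:R) * p%:R); last by ring.
    rewrite cp; lra.
rewrite big_split/= big_const_ord iter_mulr_1 -expR_sum expRD /prod_moment_cst.
rewrite -!mulrA ler_wpM2l ?exprn_ge0 ?mulr_ge0//.
rewrite mulrCA ler_wpM2l ?expR_ge0// -expRD.
pose a (j : 'I_p) := c + (j == k)%:R * c.
rewrite (_ : \sum_i _ + _ = \sum_(j < p) a j * u j ^+ 2).
  apply: expR_avg_le_sum => //.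
  - by move=> j; rewrite addr_ge0// mulr_ge0.
  - by move=> j; exact: sqr_ge0.
  - rewrite big_split/= sumr_const card_ord -[c *+ p]mulr_natr cp -mulr_suml.
    rewrite (bigD1 k)//= eqxx big1 ?addr0 ?mul1r; last by move=> j /negbTE ->.
    by nra.
under [RHS]eq_bigr do rewrite mulrDl.
rewrite big_split/=; congr (_ + _); first by apply: eq_bigr => j _; rewrite mulrC.
rewrite (bigD1 k)//= eqxx big1 ?addr0 ?mul1r; first by ring.
by move=> j /negbTE ->; rewrite !mul0r.
Qed.

(** The factors |u_j| cost one half of the available exponent altogether, which
    leaves the other half for the weight exp(u_k^2 / 2). *)
Lemma prod_norm_expR_le u k : (2 <= p)%N ->
  \prod_(j < p) `|u j| * expR (u k ^+ 2 / 2) <=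
  prod_moment_cst * \sum_(j < p) expR (u j ^+ 2).
Proof.
move=> p2; have p0 : (0 < p)%N by apply: leq_trans p2.
have pp : 2 <= p%:R :> R by rewrite ler_nat.
pose c : R := (2 * p%:R)^-1.
have c0 : 0 <= c by rewrite invr_ge0; lra.
have cp : c * p%:R = 2^-1 by rewrite /c; field; lra.
apply: (@le_trans _ _ (\prod_(j < p) ((2 * p%:R) * expR (u j ^+ 2 * c)) *
   expR (u k ^+ 2 / 2))).
  apply: ler_wpM2r; rewrite ?expR_ge0//.
  by apply: ler_prod => j _; rewrite normr_ge0 norm_le_expR.
rewrite big_split/= big_const_ord iter_mulr_1 -expR_sum /prod_moment_cst.
rewrite -!mulrA ler_wpM2l ?exprn_ge0 ?mulr_ge0//.
rewrite -expRD -[leLHS]mul1r ler_pM ?expR_ge0//; first by rewrite -expR0 ler_expR.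
pose a (j : 'I_p) := c + (j == k)%:R * 2^-1.
rewrite (_ : \sum_i _ + _ = \sum_(j < p) a j * u j ^+ 2).
  apply: expR_avg_le_sum => //.
  - by move=> j; rewrite addr_ge0// mulr_ge0.
  - by move=> j; exact: sqr_ge0.
  - rewrite big_split/= sumr_const card_ord -[c *+ p]mulr_natr cp -mulr_suml.
    rewrite (bigD1 k)//= eqxx big1 ?addr0 ?mul1r; last by move=> j /negbTE ->.
    by lra.
under [RHS]eq_bigr do rewrite mulrDl.
rewrite big_split/=; congr (_ + _); first by apply: eq_bigr => j _; rewrite mulrC.
rewrite (bigD1 k)//= eqxx big1 ?addr0 ?mul1r; first by ring.
by move=> j /negbTE ->; rewrite !mul0r.
Qed.

(** The factor [k] is left untouched: in the chaining it is a normalised link,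
    already small, and only the points that multiply it need a truncation. *)
Definition tprod (b : R) (k : 'I_p) (u : 'I_p -> R) : R :=
  u k * \prod_(j < p | j != k) clip b (u j).

Lemma norm_tprod_le b k u : 0 <= b -> `|tprod b k u| <= \prod_(j < p) `|u j|.
Proof.
move=> b0; rewrite normrM [leRHS](bigD1 k)//= ler_wpM2l// normr_prod.
by apply: ler_prod => j _; rewrite normr_ge0 norm_clip_le.
Qed.

Lemma norm_tprod_le_exp b k u : 0 <= b -> `|tprod b k u| <= `|u k| * b ^+ p.-1.
Proof.
move=> b0; rewrite normrM ler_wpM2l// normr_prod.
apply: (@le_trans _ _ (\prod_(j < p | j != k) b)).
  by apply: ler_prod => j _; rewrite normr_ge0 clip_norm.
rewrite prodr_const (_ : #|_| = p.-1)//.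
by have := cardC1 k; rewrite card_ord.
Qed.

Lemma tprod_id b k u : (forall j, j != k -> `|u j| <= b) ->
  tprod b k u = \prod_(j < p) u j.
Proof.
by move=> h; rewrite [RHS](bigD1 k)//=; congr (_ * _); apply: eq_bigr => j jk; rewrite clip_id ?h.
Qed.

(** The two products differ only where some |u_j| exceeds b, and there the factor
    exp((u_j^2 - b^2) / 2) is at least 1. *)
Lemma tprod_diff_le b k u : (2 <= p)%N -> 0 <= b ->
  `|\prod_(j < p) u j - tprod b k u| <=
  2 * p%:R * prod_moment_cst * expR (- (b ^+ 2 / 2)) * \sum_(j < p) expR (u j ^+ 2).
Proof.
move=> p2 b0.
have C0 := prod_moment_cst_ge0.
have S0 : 0 <= \sum_(j < p) expR (u j ^+ 2) by rewrite sumr_ge0// => j _; exact: expR_ge0.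
have pp : 2 <= p%:R :> R by rewrite ler_nat.
have [/forallP h|/forallPn[j0]] := boolP [forall j, (j != k) ==> (`|u j| <= b)].
  rewrite tprod_id ?subrr ?normr0; last by move=> j; exact/implyP.
  by rewrite !mulr_ge0 ?expR_ge0.
rewrite negb_imply -ltNge => /andP[_ bu].
apply: (@le_trans _ _ (2 * \prod_(j < p) `|u j|)).
  apply: le_trans (ler_normB _ _) _.
  by rewrite normr_prod mulr2n mulrDl mul1r lerD2l norm_tprod_le.
have e1 : 1 <= expR (u j0 ^+ 2 / 2) * expR (- (b ^+ 2 / 2)).
  have : b ^+ 2 <= `|u j0| ^+ 2 by rewrite lerXn2r ?nnegrE// ltW.
  move=> hb; rewrite -expRD -[leLHS]expR0 ler_expR; move: hb; rewrite real_normK ?num_real//; lra.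
rewrite -!mulrA ler_wpM2l//.
apply: (@le_trans _ _ (\prod_(j < p) `|u j| * (expR (u j0 ^+ 2 / 2) * expR (- (b ^+ 2 / 2))))).
  by rewrite ler_peMr// prodr_ge0.
rewrite mulrA (mulrC (expR (- _))) !mulrA ler_wpM2r ?expR_ge0//.
apply: le_trans (prod_norm_expR_le u j0 p2) _.
rewrite [leRHS](_ : _ = p%:R * (prod_moment_cst * \sum_(j < p) expR (u j ^+ 2)))
  ?ler_peMl ?mulr_ge0//; last by rewrite /prod_moment_cst; ring.
by lra.
Qed.

End product_moment.

(** * Truncation heights *)

Section levels.
Context {R : realType}.

(** At height lambda the expected number of sample points with g^2 > lambda is of
    order N exp(- lambda); [lam N s] is the height at which this becomes the
    entropy 2^s of level [s]. *)
Definition lam (N s : nat) : R := Num.max 0%R (ln (N%:R / 2 ^+ s)%R).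

Lemma lam_ge0 N s : (0 <= lam N s)%R.
Proof. by rewrite /lam le_max lexx. Qed.

Lemma lam_high N s : (0 < N)%N -> (N%:R <= 2 ^+ s :> R)%R -> lam N s = 0%R.
Proof.
move=> N0 h; rewrite /lam; apply/max_idPl; rewrite ln_le0//.
by rewrite ler_pdivrMr ?exprn_gt0// mul1r.
Qed.

Lemma expR_lam_low N s : (0 < N)%N -> (2 ^+ s <= N%:R :> R)%R ->
  expR (- lam N s) = (2 ^+ s / N%:R)%R.
Proof.
move=> N0 h; have N0' : (0 < N%:R :> R)%R by rewrite ltr0n.
have s0 : (0 < 2 ^+ s :> R)%R by rewrite exprn_gt0.
rewrite /lam (max_idPr _); last by rewrite ln_ge0// ler_pdivlMr// mul1r.
by rewrite expRN lnK ?posrE ?divr_gt0// invf_div.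
Qed.

Lemma expR_lam_le N s : (0 < N)%N -> (expR (- lam N s) <= 2 ^+ s / N%:R)%R.
Proof.
move=> N0; have N0' : (0 < N%:R :> R)%R by rewrite ltr0n.
have [h|h] := leP (2 ^+ s)%R (N%:R : R); first by rewrite expR_lam_low.
rewrite lam_high ?(ltW h)// oppr0 expR0 ler_pdivlMr// mul1r.
exact: ltW.
Qed.

Lemma lam_le_ln N s : (0 < N)%N -> (lam N s <= ln N%:R)%R.
Proof.
move=> N0; have N0' : (0 < N%:R :> R)%R by rewrite ltr0n.
have s0 : (1 <= 2 ^+ s :> R)%R by rewrite exprn_ege1// ler1n.
have s0' : (0 < 2 ^+ s :> R)%R by rewrite exprn_gt0.
rewrite /lam ge_max ln_ge0 ?ler1n//= ler_ln ?posrE ?divr_gt0//.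
by rewrite ler_pdivrMr// ler_peMr// ltW.
Qed.

(** Exceeding [thr] costs lambda + 1 in the first estimate of [level_good], and
    has probability at most 2 exp(- 2 lambda - 1). *)
Definition thr (N s : nat) : R := Num.sqrt (2 * lam N s + 1)%R.

Lemma thr_ge0 N s : (0 <= thr N s)%R. Proof. exact: sqrtr_ge0. Qed.

Lemma sqr_thr N s : (thr N s ^+ 2 = 2 * lam N s + 1)%R.
Proof. by rewrite sqr_sqrtr//; have := lam_ge0 N s; lra. Qed.

End levels.

(** * Power sums of vectors *)

Section power_sums.
Context {R : realType}.

Lemma tangent_pow (t a : R) n : 0 <= t -> 0 <= a ->
  a ^+ n.+1 + n.+1%:R * a ^+ n * (t - a) <= t ^+ n.+1.
Proof.
move=> t0 a0; elim: n => [|n ih]; first by rewrite !expr1 expr0; lra.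
rewrite [leRHS]exprS; apply: le_trans (ler_wpM2l t0 ih).
rewrite -subr_ge0 [X in 0 <= X](_ : _ = n.+1%:R * a ^+ n * (t - a) ^+ 2).
  by rewrite mulr_ge0 ?sqr_ge0// mulr_ge0// exprn_ge0.
by rewrite -[n.+2%:R]natr1 !exprS; ring.
Qed.

(** Jensen's inequality for t^(n+1), obtained by summing the tangent line
    inequality at the weighted mean. *)
Lemma weighted_jensen_pow (I : Type) (r : seq I) (al x : I -> R) n :
  (forall i, 0 <= al i) -> (forall i, 0 <= x i) ->
  (\sum_(i <- r) al i * x i) ^+ n.+1 <=
  (\sum_(i <- r) al i) ^+ n * \sum_(i <- r) al i * x i ^+ n.+1.
Proof.
move=> al0 x0; set A := \sum_(i <- r) al i; set B := \sum_(i <- r) al i * x i.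
have A0 : 0 <= A by rewrite sumr_ge0.
have B0 : 0 <= B by rewrite sumr_ge0// => i _; rewrite mulr_ge0.
have [Az|Anz] := eqVneq A 0.
  have B0' : B = 0.
    rewrite /B /A in Az *; elim: (r) Az => [|i s ih]; first by rewrite !big_nil.
    rewrite !big_cons => /eqP; rewrite paddr_eq0 ?sumr_ge0// => /andP[/eqP -> /eqP h].
    by rewrite mul0r add0r ih.
  rewrite B0' expr0n/= mulr_ge0 ?exprn_ge0// sumr_ge0// => i _.
  by rewrite mulr_ge0 ?exprn_ge0.
have Ap : 0 < A by rewrite lt_neqAle eq_sym Anz.
pose a := B / A.
have a0 : 0 <= a by rewrite divr_ge0.
have h : A * a ^+ n.+1 <= \sum_(i <- r) al i * x i ^+ n.+1.
  have -> : A * a ^+ n.+1 = \sum_(i <- r) al i * (a ^+ n.+1 + n.+1%:R * a ^+ n * (x i - a)).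
    under eq_bigr do rewrite mulrDr mulrCA mulrBr.
    rewrite big_split/= -mulr_sumr sumrB -!mulr_suml -/A -/B.
    by rewrite (_ : B - A * a = 0) ?mulr0 ?addr0// /a mulrC divfK// subrr.
  by apply: ler_sum => i _; rewrite ler_wpM2l// tangent_pow.
rewrite (_ : B ^+ n.+1 = A ^+ n * (A * a ^+ n.+1)).
  by rewrite ler_wpM2l// exprn_ge0.
by rewrite mulrA -exprSr -exprMn /a mulrC divfK.
Qed.

(** Minkowski's inequality in the space l_(n+1), in the form in which the links of a
    chain are summed. *)
Lemma weighted_sum_pow_le (I : eqType) (r : seq I) (N n : nat) (al : I -> R)
    (x : I -> 'I_N -> R) (W B : R) :
  (forall s, 0 <= al s) -> \sum_(s <- r) al s <= W -> 0 <= B ->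
  (forall s, s \in r -> \sum_(i < N) `|x s i| ^+ n.+1 <= B) ->
  \sum_(i < N) `|\sum_(s <- r) al s * x s i| ^+ n.+1 <= W ^+ n.+1 * B.
Proof.
move=> al0 alW B0 xB; set A := \sum_(s <- r) al s in alW *.
have A0 : 0 <= A by rewrite sumr_ge0.
apply: (@le_trans _ _ (\sum_(i < N) A ^+ n * \sum_(s <- r) al s * `|x s i| ^+ n.+1)).
  apply: ler_sum => i _; apply: le_trans (weighted_jensen_pow _ r al (fun s => `|x s i|) n al0 _) => //.
  rewrite lerXn2r ?nnegrE ?sumr_ge0// => [s _|]; first by rewrite mulr_ge0.
  apply: le_trans (ler_norm_sum _ _ _) _; apply: ler_sum => s _.
  by rewrite normrM (ger0_norm (al0 s)).
rewrite -mulr_sumr exchange_big/=; under eq_bigr do rewrite -mulr_sumr.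
apply: (@le_trans _ _ (A ^+ n * \sum_(s <- r) al s * B)).
  rewrite ler_wpM2l ?exprn_ge0// big_seq [leRHS]big_seq; apply: ler_sum => s sr.
  by rewrite ler_wpM2l// xB.
rewrite -mulr_suml -/A mulrA -exprSr ler_wpM2r//.
by rewrite lerXn2r ?nnegrE//; exact: le_trans alW.
Qed.

Lemma sum_mul_le (N : nat) (a b : 'I_N -> R) (A B : R) : 0 <= A -> 0 <= B ->
  \sum_(i < N) a i ^+ 2 <= A ^+ 2 -> \sum_(i < N) b i ^+ 2 <= B ^+ 2 ->
  \sum_(i < N) a i * b i <= A * B.
Proof.
move=> A0 B0 hA hB.
have zero (c : 'I_N -> R) : \sum_(i < N) c i ^+ 2 <= 0 -> forall i, c i = 0.
  move=> h i; apply/eqP; rewrite -sqrf_eq0 eq_le sqr_ge0 andbT.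
  apply: le_trans h; rewrite (bigD1 i)//= lerDl sumr_ge0// => j _; exact: sqr_ge0.
have [Az|Anz] := eqVneq A 0.
  rewrite Az expr0n/= in hA; rewrite Az mul0r big1// => i _.
  by rewrite (zero a)// mul0r.
have [Bz|Bnz] := eqVneq B 0.
  rewrite Bz expr0n/= in hB; rewrite Bz mulr0 big1// => i _.
  by rewrite (zero b)// mulr0.
have AB : 0 < A * B by rewrite mulr_gt0// lt_neqAle eq_sym ?Anz ?Bnz.
rewrite -(ler_pM2l AB) mulr_sumr.
apply: (@le_trans _ _ (\sum_(i < N) (B ^+ 2 * a i ^+ 2 + A ^+ 2 * b i ^+ 2) / 2)).
  apply: ler_sum => i _; have := sqr_ge0 (B * a i - A * b i); rewrite sqrrB; lra.
rewrite -mulr_suml big_split/= -!mulr_sumr.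
have := ler_wpM2l (sqr_ge0 B) hA; have := ler_wpM2l (sqr_ge0 A) hB; rewrite !expr2; lra.
Qed.

Lemma prod_le_sum_pow (p : nat) (c : 'I_p -> R) : (0 < p)%N -> (forall j, 0 <= c j) ->
  \prod_(j < p) c j <= \sum_(j < p) c j ^+ p.
Proof.
move=> p0 c0.
pose j0 : 'I_p := [arg max_(j > Ordinal p0) c j]%O.
have cmax j : c j <= c j0.
  by rewrite /j0; case: arg_maxP => // i _ h; exact: h.
apply: (@le_trans _ _ (c j0 ^+ p)).
  rewrite -[X in _ ^+ X]card_ord -prodr_const.
  by apply: ler_prod => j _; rewrite c0 cmax.
by rewrite (bigD1 j0)//= lerDl sumr_ge0// => j _; exact: exprn_ge0.
Qed.

Lemma sqr_clip_sqrt (l x : R) : 0 <= l -> clip (Num.sqrt l) x ^+ 2 = Num.min (x ^+ 2) l.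
Proof.
move=> l0; have [h|h] := leP `|x| (Num.sqrt l).
  rewrite clip_id//; apply/esym/min_idPl.
  rewrite -[x ^+ 2]real_normK ?num_real// -[leRHS]sqr_sqrtr//.
  by rewrite lerXn2r ?nnegrE ?sqrtr_ge0.
have : l <= x ^+ 2.
  rewrite -[x ^+ 2]real_normK ?num_real// -[leLHS]sqr_sqrtr//.
  by rewrite lerXn2r ?nnegrE ?sqrtr_ge0// ltW.
move=> /min_idPr ->; have s0 := sqrtr_ge0 l.
rewrite -[RHS](sqr_sqrtr l0) /clip; have [x0|x0] := leP 0 x.
  rewrite ger0_norm// in h; rewrite (max_idPr _); last lra.
  by rewrite (min_idPl _)// ltW.
rewrite ltr0_norm// in h; rewrite (max_idPl _); last lra.
by rewrite (min_idPr _) ?sqrrN//; lra.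
Qed.

Lemma sqr_sub_clip_le (l x : R) : 0 <= l ->
  (x - clip (Num.sqrt l) x) ^+ 2 <= Num.max 0 (x ^+ 2 - l).
Proof.
move=> l0; have s0 := sqrtr_ge0 l; have ss := sqr_sqrtr l0.
rewrite le_max; apply/orP.
have [h|h] := leP `|x| (Num.sqrt l); first by left; rewrite clip_id// subrr expr0n.
right; rewrite /clip; have [x0|x0] := leP 0 x.
  rewrite ger0_norm// in h; rewrite (max_idPr _); last lra.
  rewrite (min_idPl _); last exact: ltW.
  have : 0 <= Num.sqrt l * (x - Num.sqrt l) by rewrite mulr_ge0// subr_ge0 ltW.
  by move: ss; lra.
rewrite ltr0_norm// in h; rewrite (max_idPl _); last lra.
rewrite (min_idPr _); last lra.
have : 0 <= Num.sqrt l * (- x - Num.sqrt l) by rewrite mulr_ge0// subr_ge0 ltW.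
by move: ss; lra.
Qed.

End power_sums.

(** * Sample vectors of a chain *)

Section deterministic.
Context {R : realType} {N p : nat}.
Hypothesis N0 : (0 < N)%N.
Hypothesis p0 : (0 < p)%N.
Implicit Types (x y z : 'I_N -> R) (l : R).

(** The part of the sample vector above the square root of [lam N s] has l_2-norm of order
    2^(s/2), and the part below it has a bounded empirical moment of order 2p.
    The random factor [l] is the same for all levels. *)
Definition level_good (s : nat) l x : Prop :=
  \sum_(i < N) Num.max 0 (x i ^+ 2 - lam N s) <= 2 ^+ s * l /\
  \sum_(i < N) Num.min (x i ^+ 2) (lam N s) ^+ p <= 2 * p`!%:R * N%:R * l.

Definition wt (s : nat) : R := Num.sqrt (2 ^+ s).

Lemma wt_gt0 s : 0 < wt s. Proof. by rewrite sqrtr_gt0 exprn_gt0. Qed.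

Lemma sqr_wt s : wt s ^+ 2 = 2 ^+ s. Proof. by rewrite sqr_sqrtr// exprn_ge0. Qed.

Lemma wt_le m s : (m <= s)%N -> wt m <= wt s.
Proof. by move=> ms; rewrite ler_sqrt ?exprn_ge0// ler_weXn2l// ler1n. Qed.

Lemma wt_succ_le s : wt s.+1 <= 2 * wt s.
Proof.
rewrite -(@ler_pXn2r _ 2)// ?nnegrE ?mulr_ge0 ?(ltW (wt_gt0 _))//.
rewrite exprMn !sqr_wt exprS; have : 0 <= 2 ^+ s :> R by rewrite exprn_ge0.
lra.
Qed.

Definition main_part s x i := clip (Num.sqrt (lam N s)) (x i).
Definition tail_part s x i := x i - clip (Num.sqrt (lam N s)) (x i).

Lemma main_part_pow s l x : level_good s l x ->
  \sum_(i < N) `|main_part s x i| ^+ (2 * p) <= 2 * p`!%:R * N%:R * l.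
Proof.
move=> [_ h]; apply: le_trans h; apply: ler_sum => i _.
by rewrite exprM real_normK ?num_real// /main_part sqr_clip_sqrt// lam_ge0.
Qed.

Lemma tail_part_sqr s l x : level_good s l x ->
  \sum_(i < N) `|tail_part s x i| ^+ 2 <= 2 ^+ s * l.
Proof.
move=> [h _]; apply: le_trans h; apply: ler_sum => i _.
by rewrite real_normK ?num_real// /tail_part sqr_sub_clip_le// lam_ge0.
Qed.

Lemma main_part_norm s x i : `|main_part s x i| <= Num.sqrt (ln N%:R).
Proof.
apply: (le_trans (clip_norm _ _ (sqrtr_ge0 _))).
by rewrite ler_sqrt ?ln_ge0 ?ler1n// lam_le_ln.
Qed.

(** The tails of the links add up to sum_s delta_s 2^(s/2) <= ga in l_2.  The main
    parts are bounded only in terms of sum_s delta_s, which may be large; starting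
    the chain at the level [m0] where 2^(m0/2) is comparable to ga repairs this,
    since there sum_s delta_s <= 2^(-m0/2) sum_s delta_s 2^(s/2) <= 1, while the
    starting point itself has a tail of l_2-norm of order 2^(m0/2). *)
Lemma chain_decomposition (S m0 : nat) (a g : nat -> 'I_N -> R) (dl : nat -> R) (ga l : R) :
  1 <= l -> 0 < ga -> (forall s, 0 <= dl s) ->
  (forall s i, (s < S)%N -> a s.+1 i - a s i = dl s * g s i) ->
  (forall s, (s <= S)%N -> level_good s l (a s)) ->
  (forall s, (s < S)%N -> level_good s l (g s)) ->
  \sum_(0 <= s < S) dl s * wt s <= ga ->
  ga <= wt m0 -> wt m0 <= 4 * ga ->
  forall s, (s <= S)%N ->
  exists z y, [/\ forall i, a s i = z i + y i,
    \sum_(i < N) z i ^+ 2 <= 36 * ga ^+ 2 * l,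
    \sum_(i < N) `|y i| ^+ (2 * p) <= 4 ^+ p * (4 * p`!%:R * N%:R * l) &
    forall i, `|y i| <= 2 * Num.sqrt (ln N%:R)].
Proof.
move=> l1 ga0 dl0 inc agood ggood dlga gaw wga s sS.
have l0 : 0 <= l by lra.
(* The chain up to level [s] may stop before reaching [m0]; then the point itself is
   used, and no link is summed. *)
pose m := minn s m0.
have ms : (m <= s)%N by exact: geq_minl.
have mm0 : (m <= m0)%N by exact: geq_minr.
pose r := index_iota m s.
have rS j : j \in r -> (m <= j < s)%N by rewrite mem_index_iota.
have aE i : a s i = a m i + \sum_(j <- r) dl j * g j i.
  rewrite -[LHS](subrK (a m i)) addrC; congr (_ + _).
  rewrite -(telescope_sumr (fun j => a j i) ms) big_seq [RHS]big_seq.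
  by apply: eq_bigr => j /rS /andP[_ js]; rewrite inc// (leq_trans js).
have agm : level_good m l (a m) by apply: agood; exact: leq_trans sS.
have gg j : j \in r -> level_good j l (g j).
  by move=> /rS /andP[_ js]; apply: ggood; exact: leq_trans js sS.
have subsum (F : nat -> R) : (forall j, 0 <= F j) ->
    \sum_(j <- r) F j <= \sum_(0 <= j < S) F j.
  move=> F0; rewrite [leRHS](big_cat_nat (n := s))//=.
  rewrite [X in _ <= X + _](big_cat_nat (n := m))//=.
  by rewrite -addrA addrCA lerDl addr_ge0// sumr_ge0.
have wsum : \sum_(j <- r) dl j * wt j <= ga.
  by apply: le_trans (subsum _ _) dlga => j; rewrite mulr_ge0// ltW ?wt_gt0.
have dsum : \sum_(j <- r) dl j <= 1.
  have [sm|ms0] := leqP s m0.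
    by rewrite /r /m (minn_idPl sm) /index_iota subnn big_nil.
  have mE : m = m0 by exact/minn_idPr/ltnW.
  rewrite -(ler_pM2r (wt_gt0 m0)) mul1r mulr_suml; apply: le_trans gaw.
  apply: le_trans wsum; rewrite big_seq [leRHS]big_seq; apply: ler_sum => j /rS /andP[mj _].
  by rewrite ler_wpM2l// wt_le// -mE.
pose Y i := \sum_(j <- r) dl j * main_part j (g j) i.
pose Z i := \sum_(j <- r) dl j * tail_part j (g j) i.
exists (fun i => tail_part m (a m) i + Z i), (fun i => main_part m (a m) i + Y i).
split.
- move=> i; rewrite aE /tail_part /main_part addrACA subrK; congr (_ + _).
  by rewrite -big_split/=; apply: eq_bigr => j _; rewrite -mulrDr subrK.
- have Zsq : \sum_(i < N) `|Z i| ^+ 2 <= ga ^+ 2 * l.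
    under eq_bigr => i _ do (rewrite /Z; under eq_bigr => j _ do
      rewrite -[tail_part _ _ _](divfK (lt0r_neq0 (wt_gt0 j))) [_ * wt j]mulrC mulrA).
    apply: (weighted_sum_pow_le _ _ _ 1 (fun j => dl j * wt j)
      (fun j i => tail_part j (g j) i / wt j)) => //.
      by move=> j; rewrite mulr_ge0// ltW ?wt_gt0.
    move=> j /gg /tail_part_sqr h.
    under eq_bigr do rewrite normrM exprMn normfV exprVn.
    rewrite -mulr_suml real_normK ?num_real// sqr_wt ler_pdivrMr ?exprn_gt0//.
    by rewrite mulrC.
  have Zm := tail_part_sqr _ _ _ agm.
  have wm : 2 ^+ m <= 16 * ga ^+ 2.
    have : wt m <= 4 * ga by apply: le_trans (wt_le _ _ mm0) wga.
    rewrite -(sqr_wt m) (_ : 16 * ga ^+ 2 = (4 * ga) ^+ 2); last by ring.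
    by move=> h; rewrite lerXn2r ?nnegrE ?(ltW (wt_gt0 _))//; lra.
  apply: (@le_trans _ _ (\sum_(i < N) (2 * `|tail_part m (a m) i| ^+ 2 + 2 * `|Z i| ^+ 2))).
    apply: ler_sum => i _; rewrite !real_normK ?num_real//.
    move: (tail_part _ _ _) (Z i) => u v.
    have := sqr_ge0 (u - v); rewrite sqrrB sqrrD; lra.
  rewrite big_split/= -!mulr_sumr.
  have := ler_wpM2r l0 wm; have : 0 <= ga ^+ 2 * l by rewrite mulr_ge0// sqr_ge0.
  lra.
- have B0 : 0 <= 2 * p`!%:R * N%:R * l by rewrite !mulr_ge0.
  have pE : (2 * p)%N = (2 * p).-1.+1 by rewrite prednK// muln_gt0.
  have Ypow : \sum_(i < N) `|Y i| ^+ (2 * p) <= 2 * p`!%:R * N%:R * l.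
    have := @weighted_sum_pow_le _ _ r N (2 * p).-1 dl (fun j => main_part j (g j)) 1
      (2 * p`!%:R * N%:R * l) dl0 dsum B0.
    rewrite -pE expr1n mul1r; apply => j /gg; exact: main_part_pow.
  have Ym := main_part_pow _ _ _ agm.
  apply: (@le_trans _ _ (\sum_(i < N) 4 ^+ p * (`|main_part m (a m) i| ^+ (2 * p) + `|Y i| ^+ (2 * p)))).
    apply: ler_sum => i _; set u := main_part _ _ _; set v := Y i.
    rewrite (_ : 4 ^+ p = 2 ^+ (2 * p)); last first.
      by rewrite exprM; congr (_ ^+ p); ring.
    have [uv|uv] := leP `|u| `|v|.
      apply: (@le_trans _ _ ((2 * `|v|) ^+ (2 * p))).
        rewrite lerXn2r ?nnegrE ?mulr_ge0//; apply: le_trans (ler_normD _ _) _; lra.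
      by rewrite exprMn ler_wpM2l ?exprn_ge0// lerDr exprn_ge0.
    apply: (@le_trans _ _ ((2 * `|u|) ^+ (2 * p))).
      rewrite lerXn2r ?nnegrE ?mulr_ge0//; apply: le_trans (ler_normD _ _) _; lra.
    by rewrite exprMn ler_wpM2l ?exprn_ge0// lerDl exprn_ge0.
  rewrite -mulr_sumr big_split/= ler_wpM2l ?exprn_ge0//; lra.
- move=> i; apply: le_trans (ler_normD _ _) _.
  have h1 := main_part_norm m (a m) i.
  suff : `|Y i| <= Num.sqrt (ln N%:R) by lra.
  apply: le_trans (ler_norm_sum _ _ _) _.
  apply: (@le_trans _ _ (\sum_(j <- r) dl j * Num.sqrt (ln N%:R))).
    by apply: ler_sum => j _; rewrite normrM (ger0_norm (dl0 j)) ler_wpM2l// main_part_norm.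
  by rewrite -mulr_suml -[leRHS]mul1r ler_wpM2r ?sqrtr_ge0.
Qed.

End deterministic.

(** * Products of sample vectors *)

Section product_bounds.
Context {R : realType} {N p : nat}.
Hypothesis N0 : (0 < N)%N.
Hypothesis p0 : (0 < p)%N.

(** At a given index either all z_j are dominated by y_j, and the product is a
    product of main parts, or some z_j dominates, and it carries the l_2-norm
    while the other factors are bounded by their suprema. *)
Lemma prod_sqr_sum_le (b z y : 'I_p -> 'I_N -> R) (M : 'I_p -> R) (B : R) :
  (forall j i, b j i = z j i + y j i) -> (forall j i, `|b j i| <= M j) ->
  (forall j, \sum_(i < N) z j i ^+ 2 <= M j ^+ 2) ->
  (forall j, \sum_(i < N) `|y j i| ^+ (2 * p) <= B) -> 0 <= B ->
  \sum_(i < N) \prod_(j < p) b j i ^+ 2 <=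
    4 ^+ p * p%:R * (B + \prod_(j < p) M j ^+ 2).
Proof.
move=> bzy bM zM yB B0.
have M0 j : 0 <= M j.
  have i : 'I_N by exact: (Ordinal N0).
  by apply: le_trans (bM j i).
have pw i : \prod_(j < p) b j i ^+ 2 <=
    4 ^+ p * (\sum_(j < p) `|y j i| ^+ (2 * p)) +
    \sum_(j0 < p) 4 * z j0 i ^+ 2 * \prod_(j < p | j != j0) M j ^+ 2.
  have t1 : 0 <= 4 ^+ p * (\sum_(j < p) `|y j i| ^+ (2 * p)).
    by rewrite mulr_ge0 ?exprn_ge0// sumr_ge0// => j _; exact: exprn_ge0.
  have t2 j0 : 0 <= 4 * z j0 i ^+ 2 * \prod_(j < p | j != j0) M j ^+ 2.
    by apply: mulr_ge0; [rewrite mulr_ge0 ?sqr_ge0|apply: prodr_ge0 => j _; exact: sqr_ge0].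
  have [/forallP h|/forallPn[j0]] := boolP [forall j, `|z j i| <= `|y j i|].
    apply: (@le_trans _ _ (4 ^+ p * (\sum_(j < p) `|y j i| ^+ (2 * p)))); last first.
      by rewrite lerDl sumr_ge0.
    apply: (@le_trans _ _ (\prod_(j < p) (4 * `|y j i| ^+ 2))).
      apply: ler_prod => j _; rewrite sqr_ge0/= -[b j i ^+ 2]real_normK ?num_real//.
      rewrite (_ : 4 * _ = (2 * `|y j i|) ^+ 2); last by ring.
      rewrite lerXn2r ?nnegrE ?mulr_ge0// bzy; apply: le_trans (ler_normD _ _) _.
      by have := h j; lra.
    rewrite big_split/= big_const_ord iter_mulr_1 ler_wpM2l ?exprn_ge0//.
    under [leRHS]eq_bigr do rewrite exprM.
    by apply: prod_le_sum_pow => // j; exact: exprn_ge0.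
  rewrite -ltNge => zy.
  apply: (@le_trans _ _ (4 * z j0 i ^+ 2 * \prod_(j < p | j != j0) M j ^+ 2)); last first.
    rewrite [X in _ <= _ + X](bigD1 j0)//=.
    by rewrite addrCA lerDl addr_ge0// sumr_ge0.
  rewrite (bigD1 j0)//= ler_pM ?sqr_ge0//.
  - by rewrite prodr_ge0// => j _; exact: sqr_ge0.
  - rewrite -[b j0 i ^+ 2]real_normK ?num_real// -[z j0 i ^+ 2]real_normK ?num_real//.
    rewrite (_ : 4 * _ = (2 * `|z j0 i|) ^+ 2); last by ring.
    rewrite lerXn2r ?nnegrE ?mulr_ge0// bzy; apply: le_trans (ler_normD _ _) _.
    by move: zy; lra.
  - apply: ler_prod => j _; rewrite sqr_ge0/= -[b j i ^+ 2]real_normK ?num_real//.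
    by rewrite lerXn2r ?nnegrE.
apply: le_trans (ler_sum _ (fun i _ => pw i)) _.
rewrite big_split/= -mulr_sumr exchange_big/= [X in _ + X <= _]exchange_big/=.
rewrite mulrDr lerD//.
  rewrite -mulrA ler_wpM2l ?exprn_ge0//.
  apply: (@le_trans _ _ (\sum_(j < p) B)); first exact: ler_sum.
  by rewrite sumr_const card_ord -[B *+ p]mulr_natl.
apply: (@le_trans _ _ (\sum_(j < p) 4 * \prod_(j < p) M j ^+ 2)).
  apply: ler_sum => j0 _; rewrite -mulr_suml -mulr_sumr -mulrA ler_wpM2l//.
  rewrite [leRHS](bigD1 j0)//= ler_wpM2r// prodr_ge0// => j _; exact: sqr_ge0.
rewrite sumr_const card_ord -[_ *+ p]mulr_natl mulrA ler_wpM2r ?prodr_ge0// => [j _|]; first exact: sqr_ge0.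
by rewrite mulrC ler_wpM2r// -[leLHS]expr1 ler_weXn2l// ler1n.
Qed.

Definition cross_cst : R := 4 ^+ p * p%:R * (4 ^+ p.+1 * p`!%:R + 36 ^+ p).

(** The excluded factor [k] is replaced by the constant 1, split as 0 + 1, so that
    [prod_sqr_sum_le] applies to [p] factors. *)
Lemma cross_product_le (k : 'I_p) (b : 'I_p -> 'I_N -> R) (ga : 'I_p -> R) (l : R) :
  1 <= l -> (forall j, 0 < ga j) ->
  (forall j, j != k -> exists z y, [/\ forall i, b j i = z i + y i,
    \sum_(i < N) z i ^+ 2 <= 36 * ga j ^+ 2 * l,
    \sum_(i < N) `|y i| ^+ (2 * p) <= 4 ^+ p * (4 * p`!%:R * N%:R * l) &
    forall i, `|y i| <= 2 * Num.sqrt (ln N%:R)]) ->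
  \sum_(i < N) \prod_(j < p | j != k) b j i ^+ 2 <=
  cross_cst * l ^+ p * (N%:R + \prod_(j < p | j != k) (ga j + Num.sqrt (ln N%:R)) ^+ 2).
Proof.
move=> l1 ga0 dec.
have l0 : 0 <= l by lra.
pose B : R := 4 ^+ p * (4 * p`!%:R * N%:R * l).
have B0 : 0 <= B by rewrite !mulr_ge0 ?exprn_ge0.
have f1 : 1 <= p`!%:R :> R by rewrite ler1n fact_gt0.
have NB : N%:R <= B.
  have c1 : 1 <= 4 ^+ p :> R by rewrite exprn_ege1// ler1n.
  rewrite /B -[leLHS]mul1r ler_pM// -[leLHS]mul1r mulrAC -[4 * _ * _ * _]mulrA.
  rewrite [leRHS](_ : _ = (4 * p`!%:R * l) * N%:R); last by ring.
  by rewrite ler_wpM2r//; nra.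
(* The factor sqrt(l) in M accounts for the l_2-bound 36 ga^2 l of the tails. *)
pose M j : R := if j == k then 1 else 6 * Num.sqrt l * (ga j + Num.sqrt (ln N%:R)).
have : forall j, exists zy : ('I_N -> R) * ('I_N -> R),
    let c i := if j == k then 1 else b j i in
    [/\ forall i, c i = zy.1 i + zy.2 i, forall i, `|c i| <= M j,
      \sum_(i < N) zy.1 i ^+ 2 <= M j ^+ 2 & \sum_(i < N) `|zy.2 i| ^+ (2 * p) <= B].
  move=> j; rewrite /M; have [_|jk] := eqVneq j k.
    exists ((fun=> 0), (fun=> 1)); split => /=.
    - by move=> _; rewrite add0r.
    - by move=> _; rewrite normr1.
    - by rewrite big1 ?expr1n// => i _; rewrite expr0n.
    - under eq_bigr do rewrite normr1 expr1n.
      by rewrite sumr_const card_ord.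
  have [z [y [bzy zA yB ys]]] := dec j jk.
  have sl0 := sqrtr_ge0 l; have sN0 := sqrtr_ge0 (ln N%:R : R).
  have sl1 : 1 <= Num.sqrt l by rewrite -sqrtr1 ler_sqrt.
  have sqg : (6 * Num.sqrt l * ga j) ^+ 2 = 36 * ga j ^+ 2 * l.
    by rewrite !exprMn sqr_sqrtr//; ring.
  have gj := ga0 j.
  have g6 : 0 <= 6 * Num.sqrt l * ga j by rewrite !mulr_ge0// ltW.
  have zi i : `|z i| <= 6 * Num.sqrt l * ga j.
    rewrite -(@ler_pXn2r _ 2)// ?nnegrE// sqg real_normK ?num_real//.
    apply: le_trans zA; rewrite (bigD1 i)//= lerDl sumr_ge0// => ? _; exact: sqr_ge0.
  exists (z, y); split => //=.
  - move=> i; rewrite bzy; apply: le_trans (ler_normD _ _) _.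
    rewrite mulrDr lerD//; apply: le_trans (ys i) _.
    by rewrite ler_wpM2r//; lra.
  - apply: le_trans zA _; rewrite -sqg lerXn2r ?nnegrE// ?mulr_ge0 ?addr_ge0//.
    + exact: ltW.
    + by rewrite ler_wpM2l ?mulr_ge0// lerDl.
move=> /choice[zy H].
have := @prod_sqr_sum_le (fun j i => if j == k then 1 else b j i)
  (fun j => (zy j).1) (fun j => (zy j).2) M B.
have prodE (F : 'I_p -> R) :
    \prod_(j < p) (if j == k then 1 else F j) ^+ 2 = \prod_(j < p | j != k) F j ^+ 2.
  rewrite (bigD1 k)//= eqxx expr1n mul1r; apply: eq_bigr => j /negbTE ->//.
under eq_bigr do rewrite prodE.
rewrite /M prodE => /(_ _ _ _ _ B0) h; apply: le_trans (h _ _ _ _) _.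
- by move=> j i; have [-> _ _ _] := H j.
- by move=> j i; have [_ h2 _ _] := H j; exact: h2.
- by move=> j; have [_ _ h3 _] := H j.
- by move=> j; have [_ _ _ h4] := H j.
rewrite /cross_cst -!mulrA ler_wpM2l ?exprn_ge0// ler_wpM2l//.
set Pi := \prod_(j < p | j != k) (ga j + Num.sqrt (ln N%:R)) ^+ 2.
have Pi0 : 0 <= Pi by rewrite prodr_ge0// => j _; exact: sqr_ge0.
have lp : l <= l ^+ p by rewrite -[leLHS]expr1 ler_weXn2l.
have h1 : B <= 4 ^+ p.+1 * p`!%:R * l ^+ p * N%:R.
  rewrite /B exprS [leLHS](_ : _ = 4 * 4 ^+ p * p`!%:R * N%:R * l); last by ring.
  rewrite [leRHS](_ : _ = 4 * 4 ^+ p * p`!%:R * N%:R * l ^+ p); last by ring.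
  by rewrite ler_wpM2l// !mulr_ge0 ?exprn_ge0.
have h2 : \prod_(j < p | j != k) (6 * Num.sqrt l * (ga j + Num.sqrt (ln N%:R))) ^+ 2
    <= 36 ^+ p * l ^+ p * Pi.
  under eq_bigr do rewrite exprMn.
  rewrite big_split/= ler_wpM2r// prodr_const -exprMn.
  rewrite (_ : (6 * Num.sqrt l) ^+ 2 = 36 * l); last by rewrite exprMn sqr_sqrtr//; ring.
  apply: ler_weXn2l; first by lra.
  by apply: leq_trans (max_card _) _; rewrite card_ord.
apply: le_trans (lerD h1 h2) _.
have lN : 0 <= l ^+ p * N%:R by rewrite mulr_ge0 ?exprn_ge0.
have lP : 0 <= l ^+ p * Pi by rewrite mulr_ge0 ?exprn_ge0.
have a0 : 0 <= 4 ^+ p.+1 * p`!%:R :> R by rewrite mulr_ge0 ?exprn_ge0.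
have b0 : 0 <= 36 ^+ p :> R by rewrite exprn_ge0.
have := mulr_ge0 a0 lP; have := mulr_ge0 b0 lN.
rewrite !mulrA; lra.
Qed.

(** The contribution of one normalised link [x k] at level [s].  If
    2^s <= N, the truncated products are centred and the error is supported by the
    few indices where a factor is large; otherwise 2^s exceeds the sample size and
    the Cauchy-Schwarz inequality is used on the whole sample.  [Q] is a bound for the
    l_2-norm of the product of the other factors; [m] and [mf] stand for the
    expectations of the truncated and of the full product. *)
Lemma level_bound (s : nat) (k : 'I_p) (x : 'I_p -> 'I_N -> R) (l Q c3 c4 c5 m mf : R) :
  1 <= l -> 0 <= Q -> 0 <= c3 -> 0 <= c4 -> 0 <= c5 ->
  (forall j, \sum_(i < N) Num.max 0 (x j i ^+ 2 - lam N s) <= 2 ^+ s * l) ->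
  \sum_(i < N) \prod_(j < p | j != k) x j i ^+ 2 <= Q ^+ 2 ->
  (2 ^+ s <= N%:R :> R ->
    `|\sum_(i < N) tprod (thr N s) k (x^~ i) - N%:R * m| <= c3 * Num.sqrt N%:R * wt s * l) ->
  `|mf - m| <= c4 * expR (- (thr N s ^+ 2 / 2)) -> `|mf| <= c5 ->
  `|\sum_(i < N) \prod_(j < p) x j i - N%:R * mf| <=
  wt s * l * ((c3 + c4 + c5) * Num.sqrt N%:R + 4 * p%:R * Q).
Proof.
move=> l1 Q0 c30 c40 c50 xE QE E3 mfm mfc.
have l0 : 0 <= l by lra.
have w0 := @wt_gt0 R s; have w2 := @sqr_wt R s.
have N0' : 0 < N%:R :> R by rewrite ltr0n.
set n := Num.sqrt N%:R; have n0 : 0 < n by rewrite sqrtr_gt0.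
have nn : n ^+ 2 = N%:R by rewrite sqr_sqrtr.
have p1 : 1 <= p%:R :> R by rewrite ler1n.
have CS (I : pred 'I_N) (A : R) : 0 <= A ->
    \sum_(i < N | I i) x k i ^+ 2 <= A ^+ 2 ->
    \sum_(i < N | I i) \prod_(j < p) `|x j i| <= A * Q.
  move=> A0 hA; rewrite big_mkcond/=.
  under eq_bigr => i _ do rewrite (bigD1 k)//=.
  rewrite (eq_bigr (fun i => (if I i then `|x k i| else 0) *
      \prod_(j < p | j != k) `|x j i|)); last by move=> i _; case: ifP; rewrite ?mul0r.
  apply: sum_mul_le => //.
    apply: le_trans hA; rewrite [leRHS]big_mkcond/=; apply: ler_sum => i _.
    by case: ifP => _; rewrite ?real_normK ?num_real// expr0n.
  apply: le_trans QE; apply: ler_sum => i _; rewrite -prodrXl.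
  by apply: ler_prod => j _; rewrite exprn_ge0//= real_normK ?num_real.
have [sN|sN] := leP (2 ^+ s) (N%:R : R); last first.
  have lam0 : lam N s = 0 :> R by rewrite lam_high// ltW.
  have nw : n <= wt s by rewrite ler_sqrt ?exprn_ge0// ltW.
  have h1 : \sum_(i < N) \prod_(j < p) `|x j i| <= wt s * l * Q.
    apply: (CS xpredT); first by rewrite mulr_ge0// ltW.
    apply: (@le_trans _ _ (2 ^+ s * l)).
      apply: le_trans (xE k); apply: ler_sum => i _.
      by rewrite lam0 subr0 le_max lexx orbT.
    rewrite exprMn w2 ler_wpM2l ?exprn_ge0// expr2; nra.
  apply: le_trans (ler_normB _ _) _.
  have h2 : `|\sum_(i < N) \prod_(j < p) x j i| <= wt s * l * Q.
    apply: le_trans (ler_norm_sum _ _ _) _; apply: le_trans h1.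
    by apply: ler_sum => i _; rewrite normr_prod.
  have h3 : `|N%:R * mf| <= wt s * l * (c5 * n).
    rewrite normrM ger0_norm// -nn.
    apply: (@le_trans _ _ (n ^+ 2 * c5)); first by rewrite ler_wpM2l// sqr_ge0.
    have nwl : n <= wt s * l by nra.
    by rewrite expr2 [leRHS](_ : _ = wt s * l * (n * c5)); [rewrite -mulrA ler_wpM2r// mulr_ge0// ltW|ring].
  apply: le_trans (lerD h2 h3) _; rewrite -mulrDr ler_wpM2l ?mulr_ge0 ?(ltW w0)//.
  have : 0 <= (c3 + c4) * n by rewrite mulr_ge0 ?addr_ge0// ltW.
  have : Q <= 4 * p%:R * Q by nra.
  lra.
have wn : wt s <= n by rewrite ler_sqrt.
have b0 := @thr_ge0 R N s; have b2 := @sqr_thr R N s; have la0 := @lam_ge0 R N s.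
set b := thr N s in b0 b2 E3 mfm *.
pose I j : pred 'I_N := fun i => b < `|x j i|.
have cardI j : (\sum_(i < N | I j i) 1) * (lam N s + 1) <= 2 ^+ s * l.
  apply: le_trans (xE j); rewrite mulr_suml big_mkcond/=; apply: ler_sum => i _.
  case: ifP => [h|_]; last by rewrite le_max lexx.
  rewrite mul1r le_max; apply/orP; right.
  have : b ^+ 2 <= x j i ^+ 2.
    by rewrite -[leRHS]real_normK ?num_real// lerXn2r ?nnegrE// ltW.
  rewrite b2; lra.
have sumI j : \sum_(i < N | I j i) x k i ^+ 2 <= (wt s * (2 * l)) ^+ 2.
  apply: (@le_trans _ _ (\sum_(i < N | I j i) (1 * lam N s + Num.max 0 (x k i ^+ 2 - lam N s)))).
    apply: ler_sum => i _; rewrite -lerBlDl le_max; apply/orP; right; lra.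
  rewrite big_split/= -mulr_suml.
  have h1 : (\sum_(i < N | I j i) 1) * lam N s <= 2 ^+ s * l.
    apply: le_trans (cardI j); rewrite ler_wpM2l//; last lra.
    by rewrite sumr_ge0.
  have h2 : \sum_(i < N | I j i) Num.max 0 (x k i ^+ 2 - lam N s) <= 2 ^+ s * l.
    apply: le_trans (xE k); rewrite big_mkcond/=; apply: ler_sum => i _.
    by case: ifP => // _; rewrite le_max lexx.
  apply: le_trans (lerD h1 h2) _; rewrite exprMn w2 -mulrDr ler_wpM2l ?exprn_ge0//.
  rewrite expr2; nra.
have diff : `|\sum_(i < N) \prod_(j < p) x j i - \sum_(i < N) tprod b k (x^~ i)| <=
    wt s * l * (4 * p%:R * Q).
  rewrite -sumrB; apply: le_trans (ler_norm_sum _ _ _) _.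
  apply: (@le_trans _ _ (\sum_(i < N) \sum_(j < p)
      if I j i then 2 * \prod_(j < p) `|x j i| else 0)).
    apply: ler_sum => i _.
    have t0 j : 0 <= if I j i then 2 * \prod_(j < p) `|x j i| else 0.
      by case: ifP => // _; rewrite mulr_ge0// prodr_ge0.
    have [/forallP h|/forallPn[j0]] := boolP [forall j, ~~ I j i].
      rewrite tprod_id ?subrr ?normr0 ?sumr_ge0// => j _.
      by have := h j; rewrite -leNgt.
    rewrite negbK => Ij0; rewrite [leRHS](bigD1 j0)//= Ij0.
    apply: (@le_trans _ _ (2 * \prod_(j < p) `|x j i|)); last by rewrite lerDl sumr_ge0.
    apply: le_trans (ler_normB _ _) _.
    by rewrite normr_prod mulr2n mulrDl mul1r lerD2l norm_tprod_le.
  rewrite exchange_big/=.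
  apply: (@le_trans _ _ (\sum_(j < p) 2 * (wt s * (2 * l) * Q))).
    apply: ler_sum => j _; rewrite -big_mkcond/= -mulr_sumr ler_wpM2l//.
    by apply: CS => //; rewrite !mulr_ge0// ltW.
  rewrite sumr_const card_ord -[_ *+ p]mulr_natl le_eqVlt; apply/orP; left; apply/eqP.
  by ring.
have h3 := E3 sN.
have h4 : `|N%:R * m - N%:R * mf| <= wt s * l * (c4 * n).
  rewrite -mulrBr normrM ger0_norm// distrC.
  apply: (@le_trans _ _ (N%:R * (c4 * expR (- lam N s)))).
    rewrite ler_wpM2l//; apply: le_trans mfm _; rewrite ler_wpM2l// ler_expR b2; lra.
  have := @expR_lam_le R N s N0; rewrite ler_pdivlMr// => h.
  apply: (@le_trans _ _ (c4 * 2 ^+ s)).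
    by rewrite mulrCA ler_wpM2l// mulrC.
  rewrite -w2 expr2 [leRHS](_ : _ = c4 * (wt s * (l * n))); last by ring.
  rewrite ler_wpM2l// ler_wpM2l ?(ltW w0)//; nra.
rewrite (_ : _ - _ = (\sum_(i < N) \prod_(j < p) x j i - \sum_(i < N) tprod b k (x^~ i)) +
  (\sum_(i < N) tprod b k (x^~ i) - N%:R * m) + (N%:R * m - N%:R * mf)); last by ring.
apply: le_trans (ler_normD _ _) _; apply: le_trans (lerD (ler_normD _ _) (lexx _)) _.
apply: le_trans (lerD (lerD diff h3) h4) _.
have : 0 <= wt s * l * (c5 * n) by rewrite !mulr_ge0// ltW.
rewrite -/n; lra.
Qed.

End product_bounds.

(** * Summation along the chains *)

Section telescoping.
Context {R : realType}.

Lemma prod_sub_telescope (p : nat) (u v : 'I_p -> R) :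
  \prod_(j < p) u j - \prod_(j < p) v j =
  \sum_(k < p) (u k - v k) * \prod_(j < p | j != k) (if (j < k)%N then u j else v j).
Proof.
pose H (m : nat) := \prod_(j < p) (if (j < m)%N then u j else v j).
have -> : \prod_(j < p) u j = H p by apply: eq_bigr => j _; rewrite ltn_ord.
have -> : \prod_(j < p) v j = H 0%N by apply: eq_bigr.
rewrite -(telescope_sumr H (leq0n p)) big_mkord; apply: eq_bigr => k _.
rewrite /H (bigD1 k)//= ltnSn [X in _ - X](bigD1 k)//= ltnn.
rewrite (eq_bigr (fun j : 'I_p => if (j < k)%N then u j else v j)) ?mulrBl//.
move=> j jk; rewrite ltnS leq_eqVlt (_ : (j == k :> nat) = false)//.
by apply: contraNF jk => /eqP h; apply/eqP/val_inj.
Qed.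

Lemma exists_wt_comparable (ga : R) : 1 <= ga ->
  exists m, ga <= wt m /\ wt m <= 4 * ga.
Proof.
move=> ga1.
have ex : exists m, ga <= wt m.
  exists (2 * (Num.truncn ga).+1)%N.
  apply: (@le_trans _ _ ((Num.truncn ga).+1%:R)); first exact/ltW/truncnS_gt.
  rewrite /wt mulnC exprM sqrtr_sqr ger0_norm ?exprn_ge0//.
  by rewrite -natrX ler_nat ltnW// ltn_expl.
have := ex_minnP ex; case=> m gam mmin; exists m; split => //.
case: m gam mmin => [|m] gam mmin; first by rewrite /wt expr0 sqrtr1; lra.
have [h|h] := leP ga (wt m); first by have := mmin m h; rewrite ltnn.
by apply: le_trans (wt_succ_le m) _; lra.
Qed.

End telescoping.

Section chaining.
Context {R : realType} {N p : nat}.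
Hypothesis N0 : (0 < N)%N.
Hypothesis p0 : (0 < p)%N.
Variables (S : nat) (a g : 'I_p -> nat -> 'I_N -> R) (dl : 'I_p -> nat -> R).
Variables (ga : 'I_p -> R) (l c3 c4 c5 : R) (m mf : nat -> 'I_p -> R).

(** The factors of the term with index [k] in the telescoping of a product: those
    before [k] are already at level [s.+1], those after it still at level [s]. *)
Definition hybrid (s : nat) (k j : 'I_p) (i : 'I_N) : R :=
  if (j < k)%N then a j s.+1 i else if j == k then g k s i else a j s i.

Hypothesis l1 : 1 <= l.
Hypothesis ga1 : forall k, 1 <= ga k.
Hypothesis c30 : 0 <= c3.
Hypothesis c40 : 0 <= c4.
Hypothesis c50 : 0 <= c5.
Hypothesis dl0 : forall k s, 0 <= dl k s.
Hypothesis a0 : forall k i, a k 0%N i = 0.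
Hypothesis inc : forall k s i, (s < S)%N -> a k s.+1 i - a k s i = dl k s * g k s i.
Hypothesis agood : forall k s, (s <= S)%N -> level_good (p := p) s l (a k s).
Hypothesis agood' : forall k s, (s < S)%N -> level_good (p := p) s l (a k s.+1).
Hypothesis ggood : forall k s, (s < S)%N -> level_good (p := p) s l (g k s).
Hypothesis dlga : forall k, \sum_(0 <= s < S) dl k s * wt s <= ga k.
Hypothesis tdev : forall s k, (s < S)%N -> 2 ^+ s <= N%:R :> R ->
  `|\sum_(i < N) tprod (thr N s) k (fun j => hybrid s k j i) - N%:R * m s k| <=
  c3 * Num.sqrt N%:R * wt s * l.
Hypothesis mean_diff : forall s k, (s < S)%N ->
  `|mf s k - m s k| <= c4 * expR (- (thr N s ^+ 2 / 2)).
Hypothesis mean_le : forall s k, (s < S)%N -> `|mf s k| <= c5.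

Definition chaining_cst : R := c3 + c4 + c5 + 4 * p%:R * (1 + cross_cst (p := p)).

Lemma prod_chain_telescope i : \prod_(k < p) a k S i =
  \sum_(0 <= s < S) \sum_(k < p) dl k s * \prod_(j < p) hybrid s k j i.
Proof.
have z : \prod_(k < p) a k 0%N i = 0.
  by rewrite (bigD1 (Ordinal p0))//= a0 mul0r.
rewrite -[LHS]subr0 -[X in _ - X]z.
rewrite -(telescope_sumr (fun s => \prod_(k < p) a k s i) (leq0n S)).
rewrite big_nat [RHS]big_nat; apply: eq_bigr => s /andP[_ sS].
rewrite prod_sub_telescope; apply: eq_bigr => k _.
rewrite inc// -mulrA; congr (_ * _); rewrite [RHS](bigD1 k)//= /hybrid ltnn eqxx.
by congr (_ * _); apply: eq_bigr => j /negbTE ->.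
Qed.

Lemma chaining_bound :
  `|\sum_(i < N) \prod_(k < p) a k S i -
    N%:R * \sum_(0 <= s < S) \sum_(k < p) dl k s * mf s k| <=
  chaining_cst * l ^+ p.+1 *
    (Num.sqrt N%:R * \sum_(k < p) ga k +
     p%:R * \prod_(k < p) (ga k + Num.sqrt (ln N%:R))).
Proof.
have l0 : 0 <= l by move: l1; lra.
have n0 := sqrtr_ge0 (N%:R : R).
have X0 : 0 <= cross_cst (p := p) :> R.
  by rewrite /cross_cst !mulr_ge0 ?addr_ge0 ?mulr_ge0 ?exprn_ge0.
have lp1 : 1 <= l ^+ p by rewrite exprn_ege1.
pose M k := ga k + Num.sqrt (ln N%:R).
have M0 k : 0 <= M k by rewrite addr_ge0 ?sqrtr_ge0//; have := ga1 k; lra.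
pose Pi k := \prod_(j < p | j != k) M j.
have Pi0 k : 0 <= Pi k by exact: prodr_ge0.
have ga0 k : 0 < ga k by have := ga1 k; lra.
have dec k s : (s <= S)%N -> exists z y, [/\ forall i, a k s i = z i + y i,
    \sum_(i < N) z i ^+ 2 <= 36 * ga k ^+ 2 * l,
    \sum_(i < N) `|y i| ^+ (2 * p) <= 4 ^+ p * (4 * p`!%:R * N%:R * l) &
    forall i, `|y i| <= 2 * Num.sqrt (ln N%:R)].
  have [m0 [gaw wga]] := exists_wt_comparable (ga k) (ga1 k).
  exact: (chain_decomposition N0 p0 S m0 (a k) (g k) (dl k) (ga k) l l1 (ga0 k)
    (dl0 k) (inc k) (agood k) (ggood k) (dlga k) gaw wga s).
have hgood s k j : (s < S)%N -> level_good (p := p) s l (hybrid s k j).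
  move=> sS; rewrite /hybrid; have [jk|kj] := boolP (j < k)%N; first exact: agood'.
  by have [_|jk] := eqVneq j k; [exact: ggood|apply: agood; exact: ltnW].
pose Q k := (1 + cross_cst (p := p)) * l ^+ p * (Num.sqrt N%:R + Pi k).
have Q0 k : 0 <= Q k.
  by rewrite !mulr_ge0 ?addr_ge0//; lra.
have cross s k : (s < S)%N ->
    \sum_(i < N) \prod_(j < p | j != k) hybrid s k j i ^+ 2 <= Q k ^+ 2.
  move=> sS; apply: le_trans (cross_product_le N0 p0 k (hybrid s k) ga l l1 ga0 _) _.
    move=> j jk; rewrite /hybrid (negbTE jk).
    by have [_|_] := boolP (j < k)%N; apply: dec => //; exact: ltnW.
  rewrite prodrXl -/(Pi k) /Q !exprMn.
  apply: ler_pM.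
  - by rewrite mulr_ge0//; lra.
  - by rewrite addr_ge0// ?sqr_ge0.
  - apply: ler_pM => //; first lra.
      by rewrite sqrrD expr1n; have := sqr_ge0 (cross_cst (p := p) : R); lra.
    by rewrite expr2 ler_peMr//; lra.
  - have := mulr_ge0 n0 (Pi0 k); rewrite sqrrD sqr_sqrtr//; lra.
have level s k : (s < S)%N ->
    `|\sum_(i < N) \prod_(j < p) hybrid s k j i - N%:R * mf s k| <=
    wt s * l * ((c3 + c4 + c5) * Num.sqrt N%:R + 4 * p%:R * Q k).
  move=> sS; apply: (level_bound N0 p0 s k (hybrid s k) l (Q k) c3 c4 c5 (m s k)) => //.
  - by move=> j; have [] := hgood s k j sS.
  - exact: cross.
  - exact: tdev.
  - exact: mean_diff.
  - exact: mean_le.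
under eq_bigr do rewrite prod_chain_telescope.
rewrite exchange_big/= mulr_sumr -sumrB.
apply: (@le_trans _ _ (\sum_(0 <= s < S) \sum_(k < p)
    dl k s * (wt s * l * ((c3 + c4 + c5) * Num.sqrt N%:R + 4 * p%:R * Q k)))).
  apply: le_trans (ler_norm_sum _ _ _) _.
  rewrite big_nat [leRHS]big_nat; apply: ler_sum => s /andP[_ sS].
  rewrite exchange_big/= mulr_sumr -sumrB.
  apply: le_trans (ler_norm_sum _ _ _) _; apply: ler_sum => k _.
  rewrite -mulr_sumr [N%:R * _]mulrCA -mulrBr normrM (ger0_norm (dl0 k s)).
  by rewrite ler_wpM2l// level.
rewrite exchange_big/=.
pose E k := l * ((c3 + c4 + c5) * Num.sqrt N%:R + 4 * p%:R * Q k).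
have c345 : 0 <= c3 + c4 + c5 by rewrite !addr_ge0.
have E0 k : 0 <= E k by apply: mulr_ge0 => //; apply: addr_ge0; apply: mulr_ge0.
apply: (@le_trans _ _ (\sum_(k < p) ga k * E k)).
  apply: ler_sum => k _; under eq_bigr do rewrite -[wt _ * l * _]mulrA mulrA.
  rewrite -mulr_suml; apply: ler_wpM2r; [exact: E0|exact: dlga].
have EC k : ga k * E k <= chaining_cst * l ^+ p.+1 *
    (Num.sqrt N%:R * ga k + \prod_(j < p) M j).
  have gP : ga k * Pi k <= \prod_(j < p) M j.
    by rewrite [leRHS](bigD1 k)//= ler_wpM2r// lerDl sqrtr_ge0.
  have c0 : 0 <= chaining_cst.
    by rewrite /chaining_cst addr_ge0// !mulr_ge0// addr_ge0.
  apply: (@le_trans _ _ (chaining_cst * l ^+ p.+1 * (Num.sqrt N%:R * ga k + ga k * Pi k))); last first.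
    by rewrite ler_wpM2l ?mulr_ge0 ?exprn_ge0// lerD2l.
  rewrite [leRHS](_ : _ = ga k * (l * (chaining_cst * (l ^+ p * (Num.sqrt N%:R + Pi k))))); last first.
    by rewrite exprS; ring.
  rewrite ler_wpM2l ?(ltW (ga0 k))// ler_wpM2l//.
  set B := l ^+ p * (Num.sqrt N%:R + Pi k).
  have nB : Num.sqrt N%:R <= B.
    have : 0 <= (l ^+ p - 1) * (Num.sqrt N%:R + Pi k) by rewrite mulr_ge0 ?subr_ge0 ?addr_ge0.
    by have := Pi0 k; rewrite /B; lra.
  rewrite /chaining_cst [leRHS]mulrDl lerD//; first by rewrite ler_wpM2l.
  by rewrite /Q -!mulrA.
apply: le_trans (ler_sum _ (fun k _ => EC k)) _.
by rewrite -mulr_sumr big_split/= -mulr_sumr sumr_const card_ord -[_ *+ p]mulr_natl.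
Qed.

End chaining.

Local Open Scope ereal_scope.

(** * Expectations under independence *)

Section independence.
Context {R : realType} {d0 : measure_display} {Omega : measurableType d0}.
Variable P : probability Omega R.
Import HBNNSimple.

(** Both sides are linear in psi, commute with increasing limits, and agree on
    indicators. *)
Lemma ge0_integral_indep {d1 : measure_display} {T1 : measurableType d1}
    (Z : Omega -> R) (Y : Omega -> T1) (c : \bar R) (psi : T1 -> R) :
  measurable_fun setT Z -> (forall w, (0 <= Z w)%R) -> measurable_fun setT Y ->
  c \is a fin_num ->
  (forall B, measurable B ->
     \int[P]_w (Z w * \1_B (Y w))%:E = c * \int[P]_w (\1_B (Y w))%:E) ->
  measurable_fun setT psi -> (forall y, (0 <= psi y)%R) ->
  \int[P]_w (Z w * psi (Y w))%:E = c * \int[P]_w (psi (Y w))%:E.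
Proof.
move=> mZ Z0 mY cfin HB mpsi psi0.
have mf : measurable_fun setT (EFin \o psi) by exact/measurable_EFinP.
pose f := nnsfun_approx measurableT mf.
have m1Y B : measurable B -> measurable_fun setT (fun w => \1_B (Y w) : R).
  by move=> mB; apply: (measurableT_comp _ mY); exact: measurable_indic.
have mfY n : measurable_fun setT (fun w => f n (Y w)).
  by apply: (measurableT_comp _ mY); exact: measurable_funP.
have fcvg w : (f n (Y w))%:E @[n --> \oo] --> (psi (Y w))%:E.
  by apply: (@cvg_nnsfun_approx _ _ _ _ measurableT _ mf) => // y _ /=;
    rewrite lee_fin.
have fnd w : nondecreasing_seq (fun n => f n (Y w)).
  by move=> m n mn; have /lefP := @nd_nnsfun_approx _ _ _ _ measurableT _ mf _ _ mn; exact.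
have simple n : \int[P]_w (Z w * f n (Y w))%:E = c * \int[P]_w (f n (Y w))%:E.
  have fE w : f n (Y w) =
      (\sum_(y \in range (f n)) (y * \1_(f n @^-1` [set y]) (Y w)))%R.
    exact: fimfunE.
  have t0 y w : (0 <= y * \1_(f n @^-1` [set y]) (Y w))%R.
    have [|yr] := boolP (y \in range (f n)); last first.
      by rewrite preimage10 ?indic0 ?mulr0//; move: yr; rewrite notin_setE.
    by rewrite inE => -[x _ <-]; rewrite mulr_ge0.
  have mt y : measurable_fun setT (fun w => y * \1_(f n @^-1` [set y]) (Y w))%R.
    by apply: measurable_funM => //; exact: m1Y.
  transitivity (\sum_(y \in range (f n))
      \int[P]_w (Z w * (y * \1_(f n @^-1` [set y]) (Y w)))%:E).
    rewrite -ge0_integral_fsum//.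
    - apply: eq_integral => w _.
      by rewrite fsumEFin// fE !fsbig_finite//= mulr_sumr.
    - by move=> y; apply/measurable_EFinP; exact: measurable_funM.
    - by move=> y w _; rewrite lee_fin mulr_ge0.
  transitivity (\sum_(y \in range (f n))
      c * \int[P]_w (y * (\1_(f n @^-1` [set y]) (Y w)))%:E).
    apply: eq_fsbigr => y; rewrite inE => -[x _ yx].
    have y0 : (0 <= y)%R by rewrite -yx.
    under eq_integral do rewrite mulrCA EFinM.
    under [in RHS]eq_integral do rewrite EFinM.
    rewrite ge0_integralZl_EFin//; last 2 first.
    - by move=> w _; rewrite lee_fin mulr_ge0.
    - by apply/measurable_EFinP; apply: measurable_funM => //; exact: m1Y.
    rewrite ge0_integralZl_EFin//; last first.
      by apply/measurable_EFinP; exact: m1Y.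
    by rewrite HB// muleCA.
  rewrite -ge0_mule_fsumr; last first.
    by move=> y; apply: integral_ge0 => w _; rewrite lee_fin.
  congr (_ * _); rewrite -ge0_integral_fsum//.
  - by apply: eq_integral => w _; rewrite fsumEFin// fE.
  - by move=> y; apply/measurable_EFinP.
  - by move=> y w _; rewrite lee_fin.
transitivity (limn (fun n => \int[P]_w (Z w * f n (Y w))%:E)).
  rewrite -monotone_convergence//.
  - apply: eq_integral => w _; apply/esym/cvg_lim => //.
    by rewrite EFinM; under eq_fun do rewrite EFinM; apply: cvgeZl.
  - by move=> n; apply/measurable_EFinP; exact: measurable_funM.
  - by move=> n w _; rewrite lee_fin mulr_ge0.
  - by move=> w _ m n mn; rewrite lee_fin ler_wpM2l// fnd.
under eq_fun do rewrite simple.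
have limE : \int[P]_w (psi (Y w))%:E = limn (fun n => \int[P]_w (f n (Y w))%:E).
  rewrite -monotone_convergence//.
  - by apply: eq_integral => w _; apply/esym/cvg_lim.
  - by move=> n; apply/measurable_EFinP.
  - by move=> n w _; rewrite lee_fin.
  - by move=> w _ m n mn; rewrite lee_fin fnd.
have nd : nondecreasing_seq (fun n => \int[P]_w (f n (Y w))%:E).
  move=> m n mn; apply: ge0_le_integral => //.
  - by move=> w _; rewrite lee_fin.
  - by apply/measurable_EFinP.
  - by apply/measurable_EFinP.
  - by move=> w _; rewrite lee_fin fnd.
rewrite limE limeMl// ; exact: ereal_nondecreasing_is_cvgn.
Qed.

(** The indicators of the product rule are replaced by the functions psi one index
    at a time; [ge0_integral_indep] performs one replacement. *)
Lemma ge0_integral_indep_prod {d1 : measure_display} {T1 : measurableType d1}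
    (N : nat) (Y : 'I_N -> Omega -> T1) (psi : 'I_N -> T1 -> R) :
  (forall i, measurable_fun setT (Y i)) ->
  (forall B : 'I_N -> set T1, (forall i, measurable (B i)) ->
     P [set w | forall i, B i (Y i w)] = \prod_(i < N) P [set w | B i (Y i w)]) ->
  (forall i, measurable_fun setT (psi i)) ->
  (forall i y, (0 <= psi i y)%R) ->
  (forall i, \int[P]_w (psi i (Y i w))%:E < +oo) ->
  \int[P]_w (\prod_(i < N) psi i (Y i w))%:E =
  \prod_(i < N) \int[P]_w (psi i (Y i w))%:E.
Proof.
move=> mY HB mpsi psi0 psioo.
(* The indices below [m] carry psi, the other ones an indicator. *)
pose Phi (m : nat) (B : 'I_N -> set T1) (i : 'I_N) : T1 -> R :=
  if (i < m)%N then psi i else \1_(B i).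
have Phi0 m B i y : (0 <= Phi m B i y)%R by rewrite /Phi; case: ifP.
have mPhi m B i : (forall i, measurable (B i)) -> measurable_fun setT (Phi m B i).
  by move=> mB; rewrite /Phi; case: ifP => // _; exact: measurable_indic.
have mPhiY m B i : (forall i, measurable (B i)) ->
    measurable_fun setT (fun w => Phi m B i (Y i w)).
  by move=> mB; apply: (measurableT_comp _ (mY i)); exact: mPhi.
have int1 B i : measurable (B i) ->
    \int[P]_w (\1_(B i) (Y i w))%:E = P [set w | B i (Y i w)].
  move=> mB; rewrite (_ : [set w | _] = Y i @^-1` B i)//.
  have mYB : measurable (Y i @^-1` B i) by rewrite -[X in measurable X]setTI; exact: mY.
  rewrite -[in RHS](setIT (Y i @^-1` B i)) -integral_indic//.
have main m : (m <= N)%N -> forall B : 'I_N -> set T1, (forall i, measurable (B i)) ->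
    \int[P]_w (\prod_(i < N) Phi m B i (Y i w))%:E =
    \prod_(i < N) \int[P]_w (Phi m B i (Y i w))%:E.
  elim: m => [_ B mB|m ih mN B mB].
    rewrite /Phi/=; under [in RHS]eq_bigr do rewrite int1//.
    rewrite -HB//.
    have mYB : measurable [set w | forall i, B i (Y i w)].
      rewrite (_ : [set w | _] = \bigcap_(i in setT) (Y i @^-1` B i)).
        by apply: fin_bigcap_measurable => // i _;
          rewrite -[X in measurable X]setTI; exact: mY.
      by apply/seteqP; split => [w /= h i _|w /= h i]; [exact: h|exact: (h i I)].
    rewrite -[in RHS](setIT [set w | _]) -integral_indic//.
    apply: eq_integral => w _; congr EFin; rewrite indicE.
    have [h|h] := pselect (forall i, B i (Y i w)).
      by rewrite mem_set// big1// => i _; rewrite indicE mem_set.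
    rewrite memNset//; have /existsNP[i Bi] := h.
    by rewrite (bigD1 i)//= indicE memNset// mul0r.
  pose i0 := Ordinal mN.
  have PhiE B' i : i != i0 -> (forall i, i != i0 -> B' i = B i) -> Phi m B' i = Phi m.+1 B i.
    move=> ii0 BB; rewrite /Phi BB// (_ : (i < m.+1) = (i < m))%N//.
    rewrite ltnS leq_eqVlt (_ : (i == m :> nat) = false)//.
    by apply: contraNF ii0 => /eqP im; apply/eqP/val_inj.
  have intfin i : i != i0 -> \int[P]_w (Phi m.+1 B i (Y i w))%:E \is a fin_num.
    move=> ii0; rewrite ge0_fin_numE; last first.
      by apply: integral_ge0 => w _; rewrite lee_fin.
    rewrite /Phi; case: ifP => // _; rewrite int1//.
    by rewrite ltey_eq fin_num_measure// -[X in measurable X]setTI; exact: mY.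
  rewrite (bigD1 i0)//=.
  rewrite [X in _ = X * _](_ : _ = \int[P]_w (psi i0 (Y i0 w))%:E); last first.
    by apply: eq_integral => w _; rewrite /Phi ltnSn.
  rewrite muleC -(@ge0_integral_indep _ _
    (fun w => \prod_(i < N | i != i0) Phi m.+1 B i (Y i w))%R) => //.
  - apply: eq_integral => w _; congr EFin; rewrite (bigD1 i0)//= mulrC; congr (_ * _)%R.
    by rewrite /Phi ltnSn.
  - under eq_fun do rewrite -big_filter.
    by apply: measurable_prod => i _; exact: mPhiY.
  - by move=> w; apply: prodr_ge0.
  - by apply: prode_fin_num.
  move=> A mA.
  pose B' i := if i == i0 then A else B i.
  have mB' i : measurable (B' i) by rewrite /B'; case: ifP.
  have B'E i : i != i0 -> B' i = B i by rewrite /B' => /negbTE ->.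
  have := ih (ltnW mN) B' mB'.
  rewrite [in X in _ = X -> _](bigD1 i0)//= [X in _ = X * _ -> _](_ : _ = \int[P]_w (\1_A (Y i0 w))%:E).
    under [X in _ = _ * X -> _]eq_bigr => i ii0 do
      (under eq_integral do rewrite (PhiE B')//).
    rewrite muleC => <-; apply: eq_integral => w _; congr EFin.
    rewrite [in RHS](bigD1 i0)//= mulrC; congr (_ * _)%R.
      by rewrite /Phi ltnn /B' eqxx.
    by apply: eq_bigr => i ii0; rewrite (PhiE B').
  by apply: eq_integral => w _; rewrite /Phi ltnn /B' eqxx.
have := main N (leqnn N) (fun=> setT) (fun=> measurableT).
rewrite /Phi; under eq_integral do under eq_bigr do rewrite ltn_ord.
by move=> ->; apply: eq_bigr => i _; rewrite ltn_ord.
Qed.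

End independence.

(** * Exponential moments of sums over the sample *)

Section iid.
Context {R : realType} {d0 : measure_display} {Omega : measurableType d0}.
Context (P : probability Omega R) {N p : nat} {d : 'I_p -> measure_display}.
Context {T : forall k, measurableType (d k)}.
Context (X : forall k, {RV P >-> T k}) (Xs : 'I_N -> forall k, {RV P >-> T k}).
Hypothesis iid : iid_tuples (fun o : option 'I_N => if o is Some i then Xs i else X).

(** The product of the spaces [T k] with the sigma-algebra of [iid_tuples], as a
    measurable type: the joint law of a tuple lives there. *)
Definition prodT := g_sigma_algebraType [set B | exists k (A : set (T k)),
  measurable A /\ B = (fun x : forall k, T k => x k) @^-1` A].

Definition tup (Y : forall k, {RV P >-> T k}) (w : Omega) : prodT := fun k => Y k w.

Lemma measurable_tup Y : measurable_fun setT (tup Y).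
Proof.
apply: (@measurability _ _ _ _ setT (tup Y) _ erefl) => _ [B [k [A [mA ->]] <-]].
rewrite setTI (_ : _ @^-1` _ = Y k @^-1` A)//.
by rewrite -[X in measurable X]setTI; exact: measurable_funP.
Qed.

Lemma measurable_coord k : measurable_fun setT (fun x : prodT => x k).
Proof.
move=> _ A mA; rewrite setTI; apply: sub_sigma_algebra.
by exists k, A.
Qed.

Lemma ge0_integral_tup i (psi : prodT -> \bar R) :
  measurable_fun setT psi -> (forall x, 0 <= psi x) ->
  \int[P]_w psi (tup (Xs i) w) = \int[P]_w psi (tup X w).
Proof.
move=> mpsi psi0.
have push Y : \int[P]_w psi (tup Y w) = \int[pushforward P (tup Y)]_y psi y.
  rewrite ge0_integral_pushforward//; exact: measurable_tup.
rewrite !push; apply: eq_measure_integral; first exact: measurable_tup.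
  exact: measurable_tup.
move=> ? ? A mA _; exact: (iid.1 (Some i) None A mA).
Qed.

Lemma chernoff (phi : prodT -> R) (a : R) : measurable_fun setT phi ->
  \int[P]_w (expR (phi (tup X w)))%:E <= (expR a)%:E ->
  \int[P]_w (expR (\sum_(i < N) phi (tup (Xs i) w)))%:E <= (expR (a *+ N))%:E.
Proof.
move=> mphi phia.
have me : measurable_fun setT (fun x => expR (phi x)) by exact: measurableT_comp.
under eq_integral do rewrite expR_sum.
have inte i : \int[P]_w (expR (phi (tup (Xs i) w)))%:E =
    \int[P]_w (expR (phi (tup X w)))%:E.
  apply: (ge0_integral_tup i (fun x => (expR (phi x))%:E)) => [|x].
    exact/measurable_EFinP.
  by rewrite lee_fin expR_ge0.
rewrite (@ge0_integral_indep_prod _ _ _ P _ _ N (fun i => tup (Xs i)) (fun _ x => expR (phi x)))//.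
- under eq_bigr do rewrite inte.
  have I0 : 0 <= \int[P]_w (expR (phi (tup X w)))%:E.
    by apply: integral_ge0 => w _; rewrite lee_fin expR_ge0.
  have Ifin : \int[P]_w (expR (phi (tup X w)))%:E \is a fin_num.
    by rewrite ge0_fin_numE// (le_lt_trans phia)// ltry.
  rewrite -(fineK Ifin) prodEFin lee_fin big_const_ord iter_mulr_1.
  rewrite -mulr_natl expRM_natl lerXn2r// ?nnegrE ?fine_ge0 ?expR_ge0//.
  by rewrite -lee_fin fineK.
- by move=> i; exact: measurable_tup.
- move=> B mB; pose C (o : option 'I_N) := if o is Some i then B i else setT.
  have mC o : prod_measurable (C o).
    by case: o => [i|] /=; [exact: mB|exact: (@measurableT _ prodT)].
  have := iid.2 C mC; rewrite (bigD1 None)//=.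
  rewrite [X in _ = X * _ -> _](_ : _ = 1) ?mul1e; last first.
    by rewrite -(@probability_setT _ _ _ P); congr (P _); apply/seteqP; split.
  rewrite (reindex_omap Some id)/=; last by case.
  under eq_bigl do rewrite eqxx.
  move=> <-; congr (P _); apply/seteqP; split => w /= h; last by move=> i; exact: (h (Some i)).
  by case=> [i|]; [exact: h|].
- by move=> i; rewrite inte (le_lt_trans phia)// ltry.
Qed.

(** The sum of the exponentials exp(sum_i phi(Xs i) - K 2^s) over all levels and all
    objects has expectation at most sum_s exp(- 2^s) <= 1, and it dominates each
    of its terms.  Its logarithm is thus a single random variable, with an
    exponential moment, that controls every sum at once. *)
Lemma exponential_union_bound (S : nat) (Y : nat -> finType)
    (phi : forall s, Y s -> prodT -> R) (a K : R) :
  (0 < N)%N ->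
  (forall s y, measurable_fun setT (phi s y)) ->
  (forall s y, (s < S)%N ->
     \int[P]_w (expR (phi s y (tup X w)))%:E <= (expR (2 * 2 ^+ s / N%:R))%:E) ->
  (forall s, (#|Y s|%:R <= expR (a * 2 ^+ s))%R) ->
  (a + 3 <= K)%R ->
  exists L : Omega -> R, [/\ measurable_fun setT L, (forall w, 0 <= L w)%R,
    \int[P]_w (expR (L w))%:E <= 2%:E &
    forall s y w, (s < S)%N ->
      (\sum_(i < N) phi s y (tup (Xs i) w) <= 2 ^+ s * (K + L w))%R].
Proof.
move=> N0 mphi Ephi cardY aK.
pose V s y w := (\sum_(i < N) phi s y (tup (Xs i) w))%R.
have mV s y : measurable_fun setT (V s y).
  by apply: measurable_sum => i; apply: measurableT_comp => //; exact: measurable_tup.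
pose W s y w := (expR (V s y w - K * 2 ^+ s))%R.
have mW s y : measurable_fun setT (W s y).
  by apply: measurableT_comp => //; exact: measurable_funB.
have W0 s y w : (0 <= W s y w)%R by exact: expR_ge0.
pose Tot w := (\sum_(s < S) \sum_(y : Y s) W s y w)%R.
have Tot0 w : (0 <= Tot w)%R by do 2 apply: sumr_ge0 => ? _.
have mTot : measurable_fun setT Tot.
  by apply: measurable_sum => s; apply: measurable_sum => y.
have EW s y : (s < S)%N -> \int[P]_w (W s y w)%:E <= (expR (2 * 2 ^+ s - K * 2 ^+ s))%:E.
  move=> sS; under eq_integral do rewrite /W expRD mulrC EFinM.
  rewrite ge0_integralZl_EFin ?expR_ge0//; last first.
    by apply/measurable_EFinP; exact: measurableT_comp.
  rewrite expRD [X in _ <= X%:E]mulrC EFinM; apply: lee_wpmul2l; first by rewrite lee_fin expR_ge0.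
  have := chernoff _ _ (mphi s y) (Ephi s y sS).
  by rewrite -[(_ *+ N)%R]mulr_natr mulfVK// pnatr_eq0 -lt0n.
have ETot : \int[P]_w (Tot w)%:E <= 1%:E.
  under eq_integral do rewrite -sumEFin.
  rewrite ge0_integral_sum//; last 2 first.
  - by move=> s; apply/measurable_EFinP; apply: measurable_sum => y.
  - by move=> s w _; rewrite lee_fin sumr_ge0.
  apply: (@le_trans _ _ (\sum_(s < S) (2^-1 ^+ s.+1)%:E)).
    apply: lee_sum => s _; under eq_integral do rewrite -sumEFin.
    rewrite ge0_integral_sum//; last 2 first.
    - by move=> y; apply/measurable_EFinP.
    - by move=> y w _; rewrite lee_fin.
    apply: (@le_trans _ _ (\sum_(y : Y s) (expR (2 * 2 ^+ s - K * 2 ^+ s))%:E)).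
      by apply: lee_sum => y _; exact: EW.
    rewrite sumEFin lee_fin sumr_const -[(_ *+ #|_|)%R]mulr_natl.
    apply: (@le_trans _ _ (expR (a * 2 ^+ s) * expR (2 * 2 ^+ s - K * 2 ^+ s))%R).
      by rewrite ler_wpM2r ?expR_ge0 //.
    rewrite -expRD.
    apply: (@le_trans _ _ (expR (- s.+1%:R))).
      rewrite ler_expR.
      have h : (s.+1%:R <= 2 ^+ s :> R)%R by rewrite -natrX ler_nat ltn_expl.
      have h0 : (0 <= 2 ^+ s :> R)%R by exact: exprn_ge0.
      nra.
    rewrite expRN exprVn lef_pV2 ?posrE ?exprn_gt0 ?expR_gt0//.
    rewrite -[s.+1%:R]mulr1 expRM_natl lerXn2r ?nnegrE ?expR_ge0//.
    by have := expR_ge1Dx (1:R); lra.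
  rewrite sumEFin lee_fin.
  have -> : (\sum_(s < S) 2^-1 ^+ s.+1 = 1 - 2^-1 ^+ S :> R)%R.
    elim: (S) => [|m ih]; first by rewrite big_ord0 expr0 subrr.
    by rewrite big_ord_recr/= ih exprS; field.
  by rewrite gerBl exprn_ge0.
(* The summand 1 makes the logarithm nonnegative. *)
exists (fun w => ln (1 + Tot w)); split.
- by apply: measurableT_comp => //; exact: measurable_funD.
- by move=> w; rewrite ln_ge0// lerDl.
- under eq_integral do rewrite lnK ?posrE ?ltr_pwDl// EFinD.
  rewrite ge0_integralD//; last 2 first.
  - by move=> w _; rewrite lee_fin.
  - exact/measurable_EFinP.
  have -> : \int[P]_(x in setT) 1%:E = 1%:E.
    by rewrite integral_cst// [X in _ * X]probability_setT mule1.
  rewrite (_ : 2%:E = 1%:E + 1%:E)//.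
  by rewrite leeD2l.
- move=> s y w sS; rewrite mulrDr [(_ * K)%R]mulrC -lerBlDl.
  apply: (@le_trans _ _ (ln (1 + Tot w))); last first.
    by rewrite ler_peMl// ?ln_ge0 ?lerDl// exprn_ege1// ler1n.
  rewrite -ler_expR lnK ?posrE ?ltr_pwDl//.
  apply: (@le_trans _ _ (Tot w)); last by rewrite lerDr.
  rewrite /Tot (bigD1 (Ordinal sS))//= (bigD1 y)//= -addrA lerDl addr_ge0//.
    by apply: sumr_ge0.
  by apply: sumr_ge0 => ? _; apply: sumr_ge0.
Qed.

End iid.

(** * Exponential moments at one level *)

Section subgaussian_mgf.
Context {R : realType} {d0 : measure_display} {Omega : measurableType d0}.
Variable P : probability Omega R.

Lemma integral_le_affine (f g : Omega -> R) (a b c : R) :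
  measurable_fun setT f -> measurable_fun setT g ->
  (forall w, 0 <= f w)%R -> (forall w, 0 <= g w)%R -> (0 <= a)%R -> (0 <= b)%R ->
  (forall w, f w <= a + b * g w)%R ->
  \int[P]_w (g w)%:E <= c%:E -> \int[P]_w (f w)%:E <= (a + b * c)%:E.
Proof.
move=> mf mg f0 g0 a0 b0 fg gc.
apply: (@le_trans _ _ (\int[P]_w (a + b * g w)%:E)).
  apply: ge0_le_integral => //.
  - by move=> w _; rewrite lee_fin.
  - exact/measurable_EFinP.
  - by apply/measurable_EFinP; apply: measurable_funD => //; exact: measurable_funM.
  - by move=> w _; rewrite lee_fin.
under eq_integral do rewrite EFinD EFinM.
rewrite ge0_integralD//; last 2 first.
- by move=> w _; rewrite mule_ge0 ?lee_fin.
- by apply/measurable_EFinP; exact: measurable_funM.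
rewrite integral_cst// [X in _ * X + _]probability_setT mule1 EFinD leeD2l//.
rewrite ge0_integralZl_EFin//; last exact/measurable_EFinP.
  by rewrite EFinM lee_wpmul2l// lee_fin.
by move=> w _; rewrite lee_fin.
Qed.

(** The excess above lambda satisfies exp((u)_+) <= 1 + exp(u), and
    E exp(U^2 - lambda) <= 2 exp(- lambda) <= 2 2^s / N. *)
Lemma exc_mgf (U : Omega -> R) (N s : nat) : (0 < N)%N ->
  measurable_fun setT U -> \int[P]_w (expR (U w ^+ 2))%:E <= 2%:E ->
  \int[P]_w (expR (Num.max 0 (U w ^+ 2 - lam N s)))%:E <=
  (expR (2 * 2 ^+ s / N%:R))%:E.
Proof.
move=> N0 mU EU.
have mU2 : measurable_fun setT (fun w => U w ^+ 2)%R by exact: measurable_funX.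
apply: (@le_trans _ _ (1 + expR (- lam N s) * 2)%:E).
  apply: (integral_le_affine _ (fun w => expR (U w ^+ 2))) => //.
  - apply: measurableT_comp => //; apply: measurable_maxr => //.
    exact: measurable_funB.
  - exact: measurableT_comp.
  - move=> w; apply: le_trans (expR_max0 _) _.
    by rewrite lerD2l addrC expRD.
rewrite lee_fin; apply: le_trans (expR_ge1Dx _); rewrite lerD2l mulrC -mulrA ler_wpM2l//.
exact: expR_lam_le.
Qed.

(** The truncated power is at most lambda^p <= p! exp(lambda) = p! N / 2^s, so
    that after scaling by 2^s / (2 N p!) it lies in [0, 1/2], where the exponential
    is at most affine. *)
Lemma min_lam_pow_mgf (U : Omega -> R) (N s p : nat) : (0 < N)%N -> (0 < p)%N ->
  measurable_fun setT U -> \int[P]_w (expR (U w ^+ 2))%:E <= 2%:E ->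
  \int[P]_w (expR (2 ^+ s / (2 * N%:R * p`!%:R) * Num.min (U w ^+ 2) (lam N s) ^+ p))%:E <=
  (expR (2 * 2 ^+ s / N%:R))%:E.
Proof.
move=> N0 p0 mU EU.
have N0' : (0 < N%:R :> R)%R by rewrite ltr0n.
have s0 : (0 < 2 ^+ s :> R)%R by rewrite exprn_gt0.
have f0 : (0 < p`!%:R :> R)%R by rewrite ltr0n fact_gt0.
have mU2 : measurable_fun setT (fun w => U w ^+ 2)%R by exact: measurable_funX.
set t : R := (2 ^+ s / (2 * N%:R * p`!%:R))%R.
have t0 : (0 <= t)%R by rewrite divr_ge0// ?mulr_ge0// ltW.
have m0 w : (0 <= Num.min (U w ^+ 2) (lam N s))%R by rewrite le_min sqr_ge0 lam_ge0.
have tle w : (t * Num.min (U w ^+ 2) (lam N s) ^+ p <= 2^-1)%R.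
  apply: (@le_trans _ _ (t * lam N s ^+ p)%R).
    by rewrite ler_wpM2l// lerXn2r ?nnegrE ?lam_ge0// ge_min lexx orbT.
  have [h|h] := leP (2 ^+ s)%R (N%:R : R); last first.
    by rewrite lam_high ?(ltW h)// expr0n gtn_eqF// mulr0.
  apply: (@le_trans _ _ (t * (p`!%:R * expR (lam N s)))%R).
    by rewrite ler_wpM2l// exprn_le_fact_expR// lam_ge0.
  have -> : expR (lam N s) = (N%:R / 2 ^+ s :> R)%R.
    by rewrite -[lam _ _]opprK expRN expR_lam_low// invf_div.
  have -> : (t * (p`!%:R * (N%:R / 2 ^+ s)) = 2^-1)%R.
    by rewrite /t; field; rewrite !gt_eqF.
  exact: lexx.
apply: (@le_trans _ _ (1 + (2 * t * p`!%:R) * 2)%:E).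
  apply: (integral_le_affine _ (fun w => expR (U w ^+ 2))) => //.
  - apply: measurableT_comp => //; apply: measurable_funM => //.
    by apply: measurable_funX; exact: measurable_minr.
  - exact: measurableT_comp.
  - by rewrite !mulr_ge0// ltW.
  - move=> w; apply: (le_trans (expR_le1D2x _ _ (tle w))).
      by rewrite mulr_ge0 ?exprn_ge0.
    rewrite lerD2l [leRHS](_ : _ = 2 * (t * (p`!%:R * expR (U w ^+ 2))))%R; last by ring.
    rewrite ler_wpM2l// ler_wpM2l//.
    apply: le_trans (exprn_le_fact_expR _ _ (m0 w)) _.
    by rewrite ler_wpM2l ?(ltW f0)// ler_expR ge_min lexx.
rewrite lee_fin; apply: le_trans (expR_ge1Dx _); rewrite lerD2l.
have -> : (2 * t * p`!%:R * 2 = 2 * 2 ^+ s / N%:R)%R.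
  by rewrite /t; field; rewrite !gt_eqF.
exact: lexx.
Qed.

Context {p : nat}.
Hypothesis p2 : (2 <= p)%N.
Variable U : 'I_p -> Omega -> R.
Hypothesis mU : forall k, measurable_fun setT (U k).
Hypothesis EU : forall k, \int[P]_w (expR (U k w ^+ 2))%:E <= 2%:E.

Local Notation C := (@prod_moment_cst R p).
Let Sig w : R := (\sum_(j < p) expR (U j w ^+ 2))%R.

Local Lemma Sig_ge0 w : (0 <= Sig w)%R.
Proof. by rewrite sumr_ge0// => j _; exact: expR_ge0. Qed.

Local Lemma measurable_Sig : measurable_fun setT Sig.
Proof.
by apply: measurable_sum => j; apply: measurableT_comp => //; exact: measurable_funX.
Qed.

Local Lemma integral_Sig : \int[P]_w (Sig w)%:E <= (2 * p%:R)%:E.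
Proof.
under eq_integral do rewrite -sumEFin.
rewrite ge0_integral_sum//; last first.
  by move=> j; apply/measurable_EFinP; apply: measurableT_comp => //; exact: measurable_funX.
apply: (@le_trans _ _ (\sum_(j < p) 2%:E)); first by apply: lee_sum => j _; exact: EU.
by rewrite sumEFin lee_fin sumr_const card_ord -[(_ *+ p)%R]mulr_natr.
Qed.

Local Lemma integrable_Sig : P.-integrable setT (EFin \o Sig).
Proof.
apply/integrableP; split; first by apply/measurable_EFinP; exact: measurable_Sig.
under eq_integral do rewrite /= ger0_norm ?Sig_ge0//.
exact: le_lt_trans integral_Sig (ltry _).
Qed.

Local Lemma Rintegral_Sig : (\int[P]_w Sig w <= 2 * p%:R)%R.
Proof.
rewrite -lee_fin /Rintegral fineK; first exact: integral_Sig.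
exact: (integrable_fin_num measurableT integrable_Sig).
Qed.

(** All the products below are dominated by the sum of the exp(U_j^2), whose
    expectation is at most 2p. *)
Lemma integrable_dominated (f : Omega -> R) (c : R) : measurable_fun setT f -> (0 <= c)%R ->
  (forall w, `|f w| <= c * Sig w)%R -> P.-integrable setT (EFin \o f).
Proof.
move=> mf c0 fS.
apply: (@le_integrable _ _ _ P setT measurableT _ (EFin \o (fun w => c * Sig w)%R)).
- exact/measurable_EFinP.
- by move=> w _; rewrite lee_fin [leRHS]ger0_norm// mulr_ge0// Sig_ge0.
- rewrite (_ : EFin \o _ = (fun w => c%:E * (Sig w)%:E)); last first.
    by apply/funext => w.
  by apply: integrableZl => //; exact: integrable_Sig.
Qed.

Lemma Rintegral_dominated (f : Omega -> R) (c : R) : measurable_fun setT f -> (0 <= c)%R ->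
  (forall w, `|f w| <= c * Sig w)%R -> (`|\int[P]_w f w| <= c * (2 * p%:R))%R.
Proof.
move=> mf c0 fS; have If := integrable_dominated _ _ mf c0 fS.
apply: le_trans (le_normr_Rintegral measurableT If) _.
apply: (@le_trans _ _ (\int[P]_w (c * Sig w))%R).
  apply: le_Rintegral => //.
  - by apply: (integrable_dominated (fun w => `|f w|%R) c) => //;
      [exact: measurableT_comp|move=> w; rewrite normr_id].
  - apply: (integrable_dominated _ c) => //; last first.
      by move=> w; rewrite ger0_norm// mulr_ge0// Sig_ge0.
    by apply: measurable_funM => //; exact: measurable_Sig.
rewrite RintegralZl//; last exact: integrable_Sig.
by rewrite ler_wpM2l// Rintegral_Sig.
Qed.

Lemma measurable_prodU : measurable_fun setT (fun w => \prod_(j < p) U j w)%R.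
Proof. by apply: measurable_prod => j _. Qed.

Lemma measurable_tprod b k : measurable_fun setT (fun w => tprod b k (U^~ w)).
Proof.
apply: measurable_funM => //; under eq_fun do rewrite -big_filter.
apply: measurable_prod => j _; apply: measurable_minr => //.
exact: measurable_maxr.
Qed.

Lemma norm_prodU_le w : (`|\prod_(j < p) U j w| <= C * Sig w)%R.
Proof.
have k : 'I_p by case: p p2 => // n _; exact: ord0.
rewrite normr_prod; apply: le_trans (prod_norm_expR_le (U^~ w) k p2).
by rewrite ler_peMr ?prodr_ge0// -[leLHS]expR0 ler_expR divr_ge0// sqr_ge0.
Qed.

Lemma Rintegral_prodU_le : (`|\int[P]_w (\prod_(j < p) U j w)| <= C * (2 * p%:R))%R.
Proof. exact: Rintegral_dominated measurable_prodU prod_moment_cst_ge0 norm_prodU_le. Qed.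

Lemma norm_tprodU_le b k w : (0 <= b)%R -> (`|tprod b k (U^~ w)| <= C * Sig w)%R.
Proof.
move=> b0; apply: le_trans (norm_tprod_le b k (U^~ w) b0) _.
by rewrite -normr_prod norm_prodU_le.
Qed.

Lemma Rintegral_tprod_diff b k : (0 <= b)%R ->
  (`|\int[P]_w (\prod_(j < p) U j w) - \int[P]_w tprod b k (U^~ w)| <=
   4 * p%:R ^+ 2 * C * expR (- (b ^+ 2 / 2)))%R.
Proof.
move=> b0; rewrite -RintegralB//; last 2 first.
- exact: integrable_dominated measurable_prodU prod_moment_cst_ge0 norm_prodU_le.
- apply: (integrable_dominated _ _ (measurable_tprod b k) prod_moment_cst_ge0) => w.
  exact: norm_tprodU_le.
rewrite (_ : 4 * _ * _ * _ = (2 * p%:R * C * expR (- (b ^+ 2 / 2))) * (2 * p%:R))%R; last by ring.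
apply: Rintegral_dominated => //.
- apply: measurable_funB; [exact: measurable_prodU|exact: measurable_tprod].
- by rewrite !mulr_ge0// ?expR_ge0// prod_moment_cst_ge0.
- by move=> w; exact: tprod_diff_le.
Qed.

(** Its square dominates both the variance proxy p C, where C is [prod_moment_cst],
    and the bound 2^p p! on (2^s / N) (thr^2)^(p - 1); these are the two
    requirements on the scale in [tprod_mgf]. *)
Definition tprod_cst : R := (1 + p%:R * C + 2 ^+ p * p`!%:R)%R.

(** The truncation height is such that the scaled product is at most |U_k| in
    absolute value: the tilt in [expR_quad] is then absorbed by the subgaussian
    factor U_k, and the second-order term is of order 2^s / N. *)
Lemma tprod_mgf (N s : nat) (k : 'I_p) (e : R) : (0 < N)%N -> (2 ^+ s <= N%:R :> R)%R ->
  `|e|%R = 1%R ->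
  \int[P]_w (expR (e * (Num.sqrt (2 ^+ s / N%:R) / tprod_cst) *
    (tprod (thr N s) k (U^~ w) - \int[P]_v tprod (thr N s) k (U^~ v))))%:E <=
  (expR (2 * 2 ^+ s / N%:R))%:E.
Proof.
move=> N0 sN e1.
set b := thr N s; set r : R := (2 ^+ s / N%:R)%R.
have b0 : (0 <= b)%R by exact: thr_ge0.
have N0' : (0 < N%:R :> R)%R by rewrite ltr0n.
have r0 : (0 < r)%R by rewrite divr_gt0// exprn_gt0.
have pC0 : (0 <= p%:R * C)%R by rewrite mulr_ge0// prod_moment_cst_ge0.
have pf0 : (0 <= 2 ^+ p * p`!%:R :> R)%R by rewrite mulr_ge0// exprn_ge0.
have t1 : (1 <= tprod_cst)%R by rewrite /tprod_cst; lra.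
set t := (Num.sqrt r / tprod_cst)%R.
have t0 : (0 <= t)%R by rewrite divr_ge0 ?sqrtr_ge0//; lra.
have tsq : (t ^+ 2 * tprod_cst ^+ 2 = r)%R.
  by rewrite -exprMn /t mulfVK ?sqr_sqrtr//; [exact: ltW|rewrite gt_eqF//; lra].
have tC : (t ^+ 2 * tprod_cst <= r)%R.
  by rewrite -tsq ler_wpM2l ?sqr_ge0// expr2 ler_peMr//; lra.
have tb : (t * b ^+ p.-1 <= 1)%R.
  have tb0 : (0 <= t * b ^+ p.-1)%R by rewrite (mulr_ge0 t0)// exprn_ge0.
  rewrite -(@ler_pXn2r _ 2)// ?nnegrE// expr1n exprMn -exprM mulnC exprM sqr_thr.
  (* With r = exp(- lambda), the product r X is a power of lambda against its exponential. *)
  set X := ((2 * lam N s + 1) ^+ p.-1)%R.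
  have XD : (r * X <= 2 ^+ p * p`!%:R)%R.
    rewrite [r](_ : _ = expR (- lam N s)); last by rewrite expR_lam_low.
    rewrite mulrC -ler_pdivlMr ?expR_gt0//.
    rewrite -expRN opprK /X (_ : 2 * lam N s + 1 = 2 * (lam N s + 2^-1))%R; last by field.
    have l0 : (0 <= lam N s :> R)%R by exact: lam_ge0.
    have e2 : (expR 2^-1 <= 2 :> R)%R.
      by apply: le_trans (expR_le1D2x 2^-1 _ _) _; lra.
    rewrite exprMn; apply: (@le_trans _ _ (2 ^+ p.-1 * (p.-1`!%:R * expR (lam N s + 2^-1)))%R).
      by rewrite ler_wpM2l ?exprn_ge0// exprn_le_fact_expR//; lra.
    rewrite expRD (_ : _ * _ = (2 ^+ p.-1 * expR 2^-1) * (p.-1`!%:R * expR (lam N s)))%R; last by ring.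
    rewrite -[leRHS]mulrA ler_pM ?mulr_ge0 ?expR_ge0 ?exprn_ge0//.
      by rewrite -[in leRHS](prednK (ltnW p2)) exprS mulrC ler_wpM2r ?exprn_ge0.
    by rewrite ler_wpM2r ?expR_ge0// ler_nat leq_fact// leq_pred.
  have X0 : (0 <= X)%R by rewrite exprn_ge0// addr_ge0// mulr_ge0// lam_ge0.
  have c2 : (0 < tprod_cst ^+ 2)%R by rewrite exprn_gt0//; lra.
  rewrite -(ler_pM2l c2) mulr1 mulrA [(_ * t ^+ 2)%R]mulrC tsq.
  by apply: le_trans XD _; rewrite expr2 /tprod_cst; nra.
set h := fun w => tprod b k (U^~ w).
have mh : measurable_fun setT h by exact: measurable_tprod.
have Ih : P.-integrable setT (EFin \o h).
  by apply: (integrable_dominated _ _ mh prod_moment_cst_ge0) => w; exact: norm_tprodU_le.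
set m := (\int[P]_v h v)%R.
have th w : (t * `|h w| <= `|U k w|)%R.
  apply: (@le_trans _ _ (t * (`|U k w| * b ^+ p.-1))%R).
    by rewrite ler_wpM2l// norm_tprod_le_exp.
  by rewrite mulrCA ler_piMr ?normr_ge0.
have quad w : (expR (e * t * h w) <= 1 + e * t * h w + t ^+ 2 * C * Sig w)%R.
  apply: le_trans (expR_quad _) _; rewrite lerD2l.
  rewrite (_ : (e * t * h w) ^+ 2 = t ^+ 2 * h w ^+ 2)%R; last first.
    by rewrite !exprMn -[(e ^+ 2)%R]real_normK ?num_real// e1 expr1n mul1r.
  rewrite -[leLHS]mulrA -[leRHS]mulrA ler_wpM2l ?sqr_ge0//.
  apply: le_trans (prod_sqr_expR_le (U^~ w) k p2).
  apply: ler_pM; rewrite ?sqr_ge0 ?expR_ge0//.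
    rewrite prodrXl -[leLHS]real_normK ?num_real// -[leRHS]real_normK ?num_real//.
    rewrite lerXn2r ?nnegrE// [leRHS]normr_prod; exact: norm_tprod_le.
  by rewrite ler_expR -mulrA normrM e1 mul1r normrM (ger0_norm t0).
pose rhs w := (expR (- (e * t * m)) * (1 + e * t * h w + t ^+ 2 * C * Sig w))%R.
have I1 : P.-integrable setT (EFin \o cst (1%R : R)).
  exact: finite_measure_integrable_cst.
have IZ (a : R) (f : Omega -> R) : P.-integrable setT (EFin \o f) ->
    P.-integrable setT (EFin \o (fun w => a * f w)%R).
  move=> If; rewrite (_ : EFin \o _ = (fun w => a%:E * (f w)%:E)); last first.
    by apply/funext => w.
  exact: integrableZl.
have ID (f g : Omega -> R) : P.-integrable setT (EFin \o f) ->
    P.-integrable setT (EFin \o g) -> P.-integrable setT (EFin \o (fun w => f w + g w)%R).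
  move=> If Ig; rewrite (_ : EFin \o _ = (fun w => (f w)%:E + (g w)%:E)); last first.
    by apply/funext => w.
  exact: integrableD.
have I2 : P.-integrable setT (EFin \o (fun w => e * t * h w)%R) by exact: IZ.
have I3 : P.-integrable setT (EFin \o (fun w => t ^+ 2 * C * Sig w)%R).
  by apply: IZ; exact: integrable_Sig.
have I12 : P.-integrable setT (EFin \o (fun w => 1 + e * t * h w)%R).
  exact: (ID (cst (1%R : R)) _ I1 I2).
have I123 := ID _ _ I12 I3.
have Irhs : P.-integrable setT (EFin \o rhs) by exact: (IZ _ _ I123).
apply: (@le_trans _ _ (\int[P]_w (rhs w)%:E)).
  apply: ge0_le_integral => //.
  - apply/measurable_EFinP; apply: measurableT_comp => //.
    by apply: measurable_funM => //; exact: measurable_funB.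
  - by case/integrableP: Irhs.
  - move=> w _; rewrite lee_fin /rhs.
    rewrite (_ : e * t * _ = - (e * t * m) + e * t * h w)%R; last first.
      by rewrite mulrBr addrC.
    by rewrite expRD ler_wpM2l ?expR_ge0.
rewrite -[leLHS]fineK; last exact: (integrable_fin_num measurableT Irhs).
rewrite lee_fin -/(Rintegral P setT rhs).
rewrite /rhs RintegralZl// RintegralD// RintegralD// RintegralZl// RintegralZl//; last first.
  exact: integrable_Sig.
rewrite Rintegral_cst// [X in fine X]probability_setT mul1r -/m.
apply: (@le_trans _ _ (expR (- (e * t * m)) * expR (e * t * m + t ^+ 2 * C * (2 * p%:R)))%R).
  rewrite ler_wpM2l ?expR_ge0//; apply: le_trans (expR_ge1Dx _).
  have tC0 : (0 <= t ^+ 2 * C)%R by rewrite mulr_ge0 ?sqr_ge0// prod_moment_cst_ge0.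
  by rewrite -[leLHS]addrA lerD2l lerD2l; apply: (ler_wpM2l tC0); exact: Rintegral_Sig.
rewrite -expRD addKr ler_expR.
have : (t ^+ 2 * (p%:R * C) <= r)%R.
  by apply: le_trans tC; rewrite ler_wpM2l ?sqr_ge0// /tprod_cst; lra.
by rewrite -[(2 * 2 ^+ s / N%:R)%R]mulrA -/r; lra.
Qed.

End subgaussian_mgf.

(** * Simultaneous control of all levels *)

Section level_control.
Context {R : realType} {d0 : measure_display} {Omega : measurableType d0}.
Context (P : probability Omega R) {N p : nat} {d : 'I_p -> measure_display}.
Context {T : forall k, measurableType (d k)}.
Context (X : forall k, {RV P >-> T k}) (Xs : 'I_N -> forall k, {RV P >-> T k}).
Hypothesis iid : iid_tuples (fun o : option 'I_N => if o is Some i then Xs i else X).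
Hypothesis N0 : (0 < N)%N.
Hypothesis p2 : (2 <= p)%N.
Context (V : nat -> finType) (G : forall s (k : 'I_p), V s -> T k -> R) (a : R).
Hypothesis a0 : (0 <= a)%R.
Hypothesis cardV : forall s, (#|V s|%:R <= expR (a * 2 ^+ s))%R.
Hypothesis mG : forall s k v, measurable_fun setT (G s k v).
Hypothesis EG : forall s k v, \int[P]_w (expR (G s k v (X k w) ^+ 2))%:E <= 2%:E.

(** Large enough to pay for the objects of a level, about 4 p #|V s|^p in number,
    and for the exponential moments exp(2 2^s). *)
Definition union_cst : R := (4 * p%:R + a * p%:R + 3)%R.

Definition tprod_mean (s : nat) (k : 'I_p) (v : {ffun 'I_p -> V s}) : R :=
  (\int[P]_w tprod (thr N s) k (fun j => G s j (v j) (X j w)))%R.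

Let index s : finType := ('I_p * V s + 'I_p * V s + bool * 'I_p * {ffun 'I_p -> V s})%type.

Let phi s (y : index s) (x : @prodT _ _ T) : R :=
  match y with
  | inl (inl (k, v)) => Num.max 0%R (G s k v (x k) ^+ 2 - lam N s)%R
  | inl (inr (k, v)) =>
      (2 ^+ s / (2 * N%:R * p`!%:R) * Num.min (G s k v (x k) ^+ 2) (lam N s) ^+ p)%R
  | inr (e, k, v) =>
      if (2 ^+ s <= N%:R :> R)%R then
        ((-1) ^+ e * (Num.sqrt (2 ^+ s / N%:R) / @tprod_cst R p) *
          (tprod (thr N s) k (fun j => G s j (v j) (x j)) - tprod_mean s k v))%R
      else 0%R
  end.

(** The union bound over all objects of all levels, for the three kinds of
    exponents; both signs of the third one are included. *)
Lemma exists_level_control (S : nat) :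
  exists L : Omega -> R, [/\ measurable_fun setT L, (forall w, 0 <= L w)%R,
    \int[P]_w (expR (L w))%:E <= 2%:E &
    forall s w, (s < S)%N -> let l := (union_cst + L w)%R in
    [/\ (forall k v, \sum_(i < N) Num.max 0 (G s k v (Xs i k w) ^+ 2 - lam N s) <=
           2 ^+ s * l)%R,
        (forall k v, \sum_(i < N) Num.min (G s k v (Xs i k w) ^+ 2) (lam N s) ^+ p <=
           2 * p`!%:R * N%:R * l)%R &
        (2 ^+ s <= N%:R :> R)%R -> forall k (v : {ffun 'I_p -> V s}),
          (`|\sum_(i < N) tprod (thr N s) k (fun j => G s j (v j) (Xs i j w))
             - N%:R * tprod_mean s k v| <=
           tprod_cst (p := p) * Num.sqrt N%:R * Num.sqrt (2 ^+ s) * l)%R]].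
Proof.
have mGc s k v : measurable_fun setT (fun x : @prodT _ _ T => G s k v (x k)).
  by apply: (measurableT_comp (mG s k v)); exact: measurable_coord.
have mG2 s k v : measurable_fun setT (fun x : @prodT _ _ T => G s k v (x k) ^+ 2)%R.
  exact: measurable_funX.
have mGX s k v : measurable_fun setT (fun w => G s k v (X k w)).
  by apply: (measurableT_comp (mG s k v)); exact: measurable_funP.
have mphi s y : measurable_fun setT (phi s y).
  case: y => [[[k v]|[k v]]|[[e k] v]]; rewrite /phi/=.
  - by apply: measurable_maxr => //; exact: measurable_funB.
  - apply: measurable_funM => //; apply: measurable_funX.
    exact: measurable_minr.
  - have [sN|sN] := boolP (2 ^+ s <= N%:R :> R)%R; last exact: measurable_cst.
    apply: measurable_funM => //; apply: measurable_funB => //.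
    by apply: (measurable_tprod (fun j (x : @prodT _ _ T) => G s j (v j) (x j))).
have Ephi s y : (s < S)%N -> \int[P]_w (expR (phi s y (tup P X w)))%:E <=
    (expR (2 * 2 ^+ s / N%:R))%:E.
  move=> _; case: y => [[[k v]|[k v]]|[[e k] v]]; rewrite /phi/=.
  - exact: (exc_mgf P (fun w => G s k v (X k w))).
  - by apply: (min_lam_pow_mgf P (fun w => G s k v (X k w))) => //; exact: ltnW.
  - have [sN|sN] := boolP (2 ^+ s <= N%:R :> R)%R; last first.
      rewrite expR0 integral_cst// [X in _ * X]probability_setT mule1 lee_fin.
      by rewrite -[leLHS]expR0 ler_expR divr_ge0 ?mulr_ge0 ?exprn_ge0.
    apply: (@tprod_mgf _ _ _ P p p2 (fun j w => G s j (v j) (X j w))) => //.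
    by rewrite normrX normrN1 expr1n.
have card_index s : (#|index s|%:R <= expR ((4 * p%:R + a * p%:R) * 2 ^+ s))%R.
  rewrite card_sum card_sum !card_prod card_bool card_ord card_ffun card_ord.
  set x : R := expR (a * 2 ^+ s).
  have x1 : (1 <= x)%R by rewrite -[leLHS]expR0 ler_expR mulr_ge0 ?exprn_ge0.
  have vx : (#|V s|%:R <= x)%R by exact: cardV.
  have xp : (x <= x ^+ p)%R by rewrite -[leLHS]expr1 ler_weXn2l// ltnW.
  have vp : (#|V s|%:R ^+ p <= x ^+ p)%R by rewrite lerXn2r ?nnegrE//; lra.
  rewrite !natrD !natrM natrX.
  apply: (@le_trans _ _ (4 * p%:R * x ^+ p)%R).
    have p0 : (0 <= p%:R :> R)%R by [].
    have := ler_wpM2l p0 (le_trans vx xp); have := ler_wpM2l p0 vp; lra.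
  rewrite [in leRHS]mulrDl expRD /x -expRM_natr.
  rewrite ler_pM ?mulr_ge0 ?expR_ge0//; last by rewrite mulrAC.
  have s1 : (1 <= 2 ^+ s :> R)%R by rewrite exprn_ege1// ler1n.
  apply: le_trans (le_trans (expR_ge1Dx (4 * p%:R)) _); first lra.
  by rewrite ler_expR ler_peMr// mulr_ge0.
have [L [mL L0 EL HL]] := @exponential_union_bound _ _ _ P N p d T X Xs iid S index phi
  (4 * p%:R + a * p%:R)%R union_cst N0 mphi Ephi card_index (lexx _).
exists L; split => // s w sS l.
have N0' : (0 < N%:R :> R)%R by rewrite ltr0n.
have s0 : (0 < 2 ^+ s :> R)%R by rewrite exprn_gt0.
split.
- by move=> k v; exact: (HL s (inl (inl (k, v))) w sS).
- move=> k v; have := HL s (inl (inr (k, v))) w sS; rewrite /phi/= -mulr_sumr.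
  have f0 : (0 < p`!%:R :> R)%R by rewrite ltr0n fact_gt0.
  have t0 : (0 < 2 ^+ s / (2 * N%:R * p`!%:R) :> R)%R by rewrite divr_gt0// !mulr_gt0.
  rewrite -ler_pdivlMl// => h; apply: le_trans h _.
  rewrite [leLHS](_ : _ = 2 * p`!%:R * N%:R * (union_cst + L w))%R//.
  by field; rewrite !gt_eqF.
- move=> sN k v.
  set Z := (\sum_(i < N) _)%R.
  have main (e : bool) : ((-1) ^+ e * (Num.sqrt (2 ^+ s / N%:R) / @tprod_cst R p) *
      (Z - N%:R * tprod_mean s k v) <= 2 ^+ s * l)%R.
    have := HL s (inr (e, k, v)) w sS; rewrite /phi/= sN.
    by rewrite -mulr_sumr sumrB sumr_const card_ord mulr_natl.
  have c0 : (0 < @tprod_cst R p)%R.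
    by rewrite /tprod_cst -addrA ltr_pwDl// addr_ge0 ?mulr_ge0 ?exprn_ge0 ?expR_ge0.
  have q0 : (0 < Num.sqrt (2 ^+ s / N%:R) :> R)%R by rewrite sqrtr_gt0 divr_gt0.
  have t0 : (0 < Num.sqrt (2 ^+ s / N%:R) / @tprod_cst R p)%R by rewrite divr_gt0.
  rewrite [leRHS](_ : _ = (2 ^+ s * l) / (Num.sqrt (2 ^+ s / N%:R) / @tprod_cst R p))%R; last first.
    have sq1 : (Num.sqrt (2 ^+ s) ^+ 2 = 2 ^+ s :> R)%R by rewrite sqr_sqrtr// ltW.
    have sq2 : (Num.sqrt N%:R ^+ 2 = N%:R :> R)%R by rewrite sqr_sqrtr.
    rewrite -{2}sq1 sqrtrM ?(ltW s0)// sqrtrV//; field.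
    by rewrite !gt_eqF// sqrtr_gt0.
  rewrite ler_pdivlMr// -[X in (_ * X <= _)%R](ger0_norm (ltW t0)) -normrM ler_norml.
  apply/andP; split.
    have := main true; rewrite expr1 mulN1r mulNr => h.
    by rewrite lerNl mulrC.
  by have := main false; rewrite expr0 mul1r mulrC.
Qed.
End level_control.

(** * Scales of subgaussian functions *)

Lemma expR_tangent {R : realType} (a y : R) : (expR a * (1 + (y - a)) <= expR y)%R.
Proof.
rewrite -[in leRHS](subrK a y) [in leRHS]addrC expRD ler_wpM2l ?expR_ge0//.
exact: expR_ge1Dx.
Qed.

Section subgaussian.
Context {R : realType} {d : measure_display} {T : measurableType d}.
Variable mu : probability T R.
Implicit Types (f g : T -> R) (a b c : R).

Definition subgaussian f c : Prop :=
  (0 < c)%R /\ \int[mu]_x (expR (`|f x| ^+ 2 / c ^+ 2))%:E <= 2%:E.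

Lemma psi2_norm_ge0 f : 0 <= psi2_norm mu f.
Proof.
by apply: le_ereal_inf_tmp => _ [c [c0 _] <-]; rewrite lee_fin ltW.
Qed.

Lemma psi2_norm_le f c : subgaussian f c -> psi2_norm mu f <= c%:E.
Proof. by move=> h; apply: ereal_inf_lbound; exists c. Qed.

Lemma measurable_exp_sqr f c : measurable_fun setT f ->
  measurable_fun setT (fun x => expR (`|f x| ^+ 2 / c ^+ 2)).
Proof.
move=> mf; apply: measurableT_comp => //; apply: measurable_funM => //.
by apply: measurable_funX; exact: measurableT_comp.
Qed.

Lemma subgaussian_le f a b : measurable_fun setT f -> (a <= b)%R ->
  subgaussian f a -> subgaussian f b.
Proof.
move=> mf ab [a0 fa]; have b0 := lt_le_trans a0 ab; split => //.
apply: le_trans fa; apply: ge0_le_integral => //.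
- by apply/measurable_EFinP; exact: measurable_exp_sqr.
- by apply/measurable_EFinP; exact: measurable_exp_sqr.
- move=> x _; rewrite lee_fin ler_expR ler_wpM2l ?sqr_ge0//.
  by rewrite lef_pV2 ?posrE ?exprn_gt0// lerXn2r ?nnegrE// ltW.
Qed.

Lemma subgaussian_gt f c : measurable_fun setT f -> psi2_norm mu f < c%:E ->
  subgaussian f c.
Proof.
move=> mf /ereal_inf_lt[_ [b [b0 fb] <-]]; rewrite lte_fin => bc.
by apply: (@subgaussian_le f b) => //; exact: ltW.
Qed.

(** The triangle inequality of the psi_2-norm: the exponential and the square are
    convex. *)
Lemma subgaussianB f g a b : measurable_fun setT f -> measurable_fun setT g ->
  subgaussian f a -> subgaussian g b -> subgaussian (fun x => f x - g x)%R (a + b).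
Proof.
move=> mf mg [a0 fa] [b0 gb]; have ab0 : (0 < a + b)%R by rewrite addr_gt0.
split => //.
pose u x := (`|f x| ^+ 2 / a ^+ 2)%R; pose v x := (`|g x| ^+ 2 / b ^+ 2)%R.
pose t : R := (a / (a + b))%R.
have t0 : (0 <= t)%R by rewrite divr_ge0// ltW.
have t1 : (1 - t = b / (a + b))%R by rewrite /t; field; rewrite gt_eqF.
have t10 : (0 <= 1 - t)%R by rewrite t1 divr_ge0// ltW.
have pw x : (expR (`|f x - g x| ^+ 2 / (a + b) ^+ 2) <= t * expR (u x) + (1 - t) * expR (v x))%R.
  apply: (@le_trans _ _ (expR (t * u x + (1 - t) * v x))%R).
    rewrite ler_expR; apply: (@le_trans _ _ ((`|f x| + `|g x|) ^+ 2 / (a + b) ^+ 2)%R).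
      rewrite ler_wpM2r ?invr_ge0 ?sqr_ge0// lerXn2r ?nnegrE ?addr_ge0//.
      exact: ler_normB.
    rewrite t1 /t /u /v; move: (normr_ge0 (f x)) (normr_ge0 (g x)).
    move: `|f x|%R `|g x|%R => y z y0 z0.
    rewrite -subr_ge0 [X in (0 <= X)%R](_ : _ =
      (y * b - z * a) ^+ 2 / (a * b * (a + b) ^+ 2))%R.
      by rewrite divr_ge0 ?sqr_ge0// !mulr_ge0 ?sqr_ge0// ltW.
    by field; rewrite !gt_eqF.
  set w := (t * u x + (1 - t) * v x)%R.
  have h1 := expR_tangent w (u x); have h2 := expR_tangent w (v x).
  apply: le_trans (lerD (ler_wpM2l t0 h1) (ler_wpM2l t10 h2)).
  by rewrite le_eqVlt; apply/orP; left; apply/eqP; rewrite /w; ring.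
apply: (@le_trans _ _ (\int[mu]_x (t * expR (u x) + (1 - t) * expR (v x))%:E)).
  apply: ge0_le_integral => //.
  - by apply/measurable_EFinP; apply: measurable_exp_sqr; exact: measurable_funB.
  - apply/measurable_EFinP; apply: measurable_funD; apply: measurable_funM => //;
      exact: measurable_exp_sqr.
  - by move=> x _; rewrite lee_fin.
under eq_integral do rewrite EFinD !EFinM.
rewrite ge0_integralD//; last 4 first.
- by move=> x _; rewrite mule_ge0 ?lee_fin ?expR_ge0.
- by apply/measurable_EFinP; apply: measurable_funM => //; exact: measurable_exp_sqr.
- by move=> x _; rewrite mule_ge0 ?lee_fin ?expR_ge0.
- by apply/measurable_EFinP; apply: measurable_funM => //; exact: measurable_exp_sqr.
rewrite ge0_integralZl_EFin//; last by apply/measurable_EFinP; exact: measurable_exp_sqr.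
rewrite ge0_integralZl_EFin//; last by apply/measurable_EFinP; exact: measurable_exp_sqr.
apply: (@le_trans _ _ (t%:E * 2%:E + (1 - t)%:E * 2%:E)).
  by apply: leeD; apply: lee_wpmul2l => //; rewrite lee_fin.
by rewrite -!EFinM -EFinD lee_fin; lra.
Qed.

Lemma subgaussian0 c : (0 < c)%R -> subgaussian (fun=> 0%R) c.
Proof.
move=> c0; split => //.
under eq_integral do rewrite normr0 expr0n/= mul0r expR0.
rewrite integral_cst// [X in _ * X]probability_setT mule1 lee_fin; lra.
Qed.

Lemma subgaussian_scale f c : subgaussian f c ->
  \int[mu]_x (expR ((f x / c) ^+ 2))%:E <= 2%:E.
Proof.
move=> [c0 fc]; under eq_integral do
  rewrite exprMn -[(f _ ^+ 2)%R]real_normK ?num_real// exprVn.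
exact: fc.
Qed.

Lemma psi2_norm_fin f c : subgaussian f c -> psi2_norm mu f \is a fin_num.
Proof.
move=> /psi2_norm_le fc; rewrite ge0_fin_numE ?psi2_norm_ge0//.
exact: le_lt_trans fc (ltry _).
Qed.

(** The infimum that defines the psi_2-norm is possibly not attained, and it may
    be 0; with [e] added, it becomes an admissible scale. *)
Lemma subgaussian_fine f c e : measurable_fun setT f -> subgaussian f c -> (0 < e)%R ->
  subgaussian f (fine (psi2_norm mu f) + e).
Proof.
move=> mf fc e0; apply: subgaussian_gt => //.
by rewrite EFinD fineK ?(psi2_norm_fin _ _ fc)// lteDl ?(psi2_norm_fin _ _ fc)// lte_fin.
Qed.

Lemma fine_psi2_norm_le f c : subgaussian f c -> (fine (psi2_norm mu f) <= c)%R.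
Proof.
by move=> fc; rewrite -lee_fin fineK ?(psi2_norm_fin _ _ fc)// psi2_norm_le.
Qed.

End subgaussian.

(** * Chains from admissible sequences *)

Section chain.
Context {R : realType} {d : measure_display} {T : measurableType d}.
Context (mu : probability T R) (F : set (T -> R)) (D gr : R).
Hypothesis mF : forall f, F f -> measurable_fun setT f.
Hypothesis symF : F (fun=> 0%R) \/ (forall f, F f -> F (fun x => (- f x)%R)).
Hypothesis D0 : (0 < D)%R.
Hypothesis diamF : psi2_diam mu F = D%:E.
Hypothesis gammaF : gamma_psi2 mu F = gr%:E.

Lemma powR_wt s : (2 `^ (s%:R / 2) = wt s :> R)%R.
Proof. by rewrite powRrM powR_mulrn// powR12_sqrt ?exprn_ge0. Qed.

Lemma psi2_norm_class f : F f -> psi2_norm mu f <= D%:E.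
Proof. by move=> Ff; rewrite -diamF; apply: ereal_sup_ubound; exists f. Qed.

Lemma subgaussian_class f : F f -> subgaussian mu f (2 * D).
Proof.
move=> Ff; apply: subgaussian_gt; first exact: mF.
by apply: le_lt_trans (psi2_norm_class _ Ff) _; rewrite lte_fin; move: D0; lra.
Qed.

Local Notation near_gamma := (gr + D / 4)%R.
Local Notation dist := (psi2_dist mu).

Lemma exists_near_optimal_admissible : exists A, admissible dist F A /\
  forall f, F f ->
    \sum_(0 <= s <oo) (2 `^ (s%:R / 2))%:E * set_dist dist f (A s) <= near_gamma%:E.
Proof.
have : gamma_psi2 mu F < near_gamma%:E by rewrite gammaF lte_fin; move: D0; lra.
move=> /ereal_inf_lt[_ [A admA <-] supA]; exists A; split => // f Ff.
by apply: le_trans (ltW supA); apply: ereal_sup_ubound; exists f.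
Qed.

Lemma set_dist_ge0 f (A : set (T -> R)) : 0 <= set_dist dist f A.
Proof. by apply: le_ereal_inf_tmp => _ [g _ <-]; exact: psi2_norm_ge0. Qed.

Lemma chain_sum_le A f (S : nat) :
  \sum_(0 <= s <oo) (2 `^ (s%:R / 2))%:E * set_dist dist f (A s) <= near_gamma%:E ->
  \sum_(0 <= s < S) (wt s)%:E * set_dist dist f (A s) <= near_gamma%:E.
Proof.
apply: le_trans; under eq_bigr do rewrite -powR_wt.
apply: nneseries_lim_ge => s _ _.
by rewrite mule_ge0 ?lee_fin ?powR_ge0// set_dist_ge0.
Qed.

(** The first set of an admissible sequence is a single point f0, so that all members
    of the class are within near_gamma of f0.  Comparing f with 0, or with - f when
    the class is symmetric, bounds the norm of f itself. *)
Lemma diam_le_gamma : (D <= 4 * gr)%R.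
Proof.
have [A [[AF _ [f0 A0] _ _] HA]] := exists_near_optimal_admissible.
have Ff0 : F f0 by apply: (AF 0%N); rewrite A0.
have dist0 f : F f -> dist f f0 <= near_gamma%:E.
  move=> Ff; have := chain_sum_le _ _ 1 (HA f Ff).
  rewrite big_nat1 A0 /set_dist image_set1 ereal_inf1 /wt expr0 sqrtr1 mul1e.
  exact.
have sub0 f e : F f -> (0 < e)%R -> subgaussian mu (fun x => f x - f0 x)%R (near_gamma + e).
  move=> Ff e0; apply: subgaussian_gt.
    by apply: measurable_funB; exact: mF.
  by apply: le_lt_trans (dist0 f Ff) _; rewrite lte_fin ltrDl.
suff : (D <= 2 * near_gamma)%R by lra.
apply/ler_addgt0Pr => e e0.
rewrite -lee_fin -diamF; apply: ge_ereal_sup => _ [f Ff <-].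
have e2 : (0 < e / 2)%R by rewrite divr_gt0.
have s1 := sub0 f _ Ff e2.
have -> : (2 * near_gamma + e = (near_gamma + e / 2) + (near_gamma + e / 2))%R by field.
apply: psi2_norm_le; case: symF => [F0|FN].
  rewrite (_ : f = fun x => (f x - f0 x) - (0 - f0 x))%R; last first.
    by apply/funext => x; rewrite sub0r opprK subrK.
  by apply: subgaussianB => //; [apply: measurable_funB; exact: mF|
    apply: (measurable_funB (mF _ F0)); exact: mF|exact: (sub0 (fun=> 0%R))].
have s2 := sub0 _ _ (FN f Ff) e2.
have [c0 h] : subgaussian mu (fun x => (f x - f0 x) - (- f x - f0 x))%R ((near_gamma + e / 2) + (near_gamma + e / 2)).
  by apply: subgaussianB => //; [apply: measurable_funB; exact: mF|
    apply: (measurable_funB (mF _ (FN f Ff))); exact: mF].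
have vpos : (0 < near_gamma + e / 2)%R by case: s1.
apply: (@subgaussian_le _ _ _ _ _ (near_gamma + e / 2)); [exact: mF|lra|].
split => //; apply: le_trans h; apply: ge0_le_integral => //.
- by apply/measurable_EFinP; apply: measurable_exp_sqr; exact: mF.
- apply/measurable_EFinP; apply: measurable_exp_sqr.
  by apply: measurable_funB; apply: measurable_funB; (exact: mF || exact: (mF _ (FN f Ff))).
- move=> x _; rewrite lee_fin ler_expR.
  rewrite (_ : f x - f0 x - _ = 2 * f x)%R; last by ring.
  rewrite normrM (@ger0_norm _ 2%R)//; move: (near_gamma + e / 2)%R vpos => b b0.
  rewrite [leRHS](_ : _ = `|f x| ^+ 2 / b ^+ 2)%R//.
  have bb : (0 < b + b)%R by rewrite addr_gt0.
  by field; rewrite !gt_eqF.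
Qed.

Lemma sum_wt_quarter (S : nat) : (\sum_(0 <= s < S) wt s * 4^-1 ^+ s <= 2 :> R)%R.
Proof.
apply: (@le_trans _ _ (\sum_(0 <= s < S) 2^-1 ^+ s)%R).
  apply: ler_sum => s _; have w1 : (wt s <= 2 ^+ s :> R)%R.
    rewrite -[leRHS](@sqr_wt R s) expr2 ler_peMr ?(ltW (wt_gt0 s))//.
    by rewrite /wt -[leLHS]sqrtr1 ler_sqrt// exprn_ege1// ler1n.
  apply: (@le_trans _ _ (2 ^+ s * 4^-1 ^+ s)%R); first by rewrite ler_wpM2r// exprn_ge0.
  by rewrite -exprMn (_ : 2 * 4^-1 = 2^-1)%R//; field.
rewrite (_ : \sum_(0 <= s < S) 2^-1 ^+ s = 2 - 2 * 2^-1 ^+ S :> R)%R.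
  by rewrite gerBl mulr_ge0// exprn_ge0.
elim: S => [|m ih]; first by rewrite big_nil expr0; ring.
by rewrite big_nat_recr//= ih exprS; field.
Qed.

(** The chain of the [j]-th function, divided by [2 * D], from 0 to the function
    itself.  A point depends only on its code, and there are at most 2^(2^s) codes
    at level [s]; the length [dl] of a link depends only on its two end points.
    Hence the links can be counted by pairs of codes. *)
Definition is_chain (n : nat) (t : 'I_n -> T -> R) (S : nat)
    (c : nat -> 'I_n -> T -> R) (code : nat -> 'I_n -> nat) (dl : nat -> 'I_n -> R) : Prop :=
  [/\ (forall j, c 0%N j = (fun=> 0%R)) /\
      (forall s j x, (S <= s)%N -> c s j x = t j x / (2 * D))%R,
      (forall s j, (code s j < 2 ^ (2 ^ s))%N) /\
      (forall s j j', code s j = code s j' -> c s j = c s j'),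
      (forall s j, measurable_fun setT (c s j)) /\
      (forall s j, \int[mu]_x (expR (c s j x ^+ 2))%:E <= 2%:E),
      [/\ (forall s j, 0 < dl s j)%R,
        (forall s j, \int[mu]_x (expR (((c s.+1 j x - c s j x) / dl s j) ^+ 2))%:E <= 2%:E) &
        (forall s j j', c s j = c s j' -> c s.+1 j = c s.+1 j' -> dl s j = dl s j')] &
      forall j, (\sum_(0 <= s < S) dl s j * wt s <= 25 * (gr / D))%R].

(** The point at level [s.+1] is an almost nearest point in the set of index [s] of an
    almost optimal admissible sequence.  From level [S] on the chain stays at the
    function itself, whose index in the finite family is an admissible code. *)
Lemma exists_chain (n : nat) (t : 'I_n -> T -> R) (S : nat) :
  (forall j, F (t j)) -> (n <= 2 ^ (2 ^ S))%N -> (0 < S)%N ->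
  exists c code dl, is_chain n t S c code dl.
Proof.
move=> Ft nS S0.
have [A [[AF Amono [f0 A0] cardA _] HA]] := exists_near_optimal_admissible.
have Af0 s : A s f0 by elim: s => [|s ih]; [rewrite A0|exact: Amono].
have dfin s j : set_dist dist (t j) (A s) \is a fin_num.
  rewrite ge0_fin_numE ?set_dist_ge0//.
  apply: (@le_lt_trans _ _ (dist (t j) f0)).
    by apply: ereal_inf_lbound; exists f0.
  have := psi2_norm_fin _ _ _ (subgaussianB _ _ _ _ _ (mF _ (Ft j)) (mF _ (AF 0%N f0 (Af0 _)))
    (subgaussian_class _ (Ft j)) (subgaussian_class _ (AF _ _ (Af0 0%N)))).
  by rewrite ge0_fin_numE// psi2_norm_ge0.
(* The slack D 4^(-s) is summable against the weights 2^(s/2), and positive, so that a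
   point within distance r exists. *)
pose r s j : R := (fine (set_dist dist (t j) (A s)) + D * 4^-1 ^+ s)%R.
have q0 s : (0 < 4^-1 ^+ s :> R)%R by rewrite exprn_gt0// invr_gt0.
have /choice[ap apP] : forall sj : nat * 'I_n, exists g, A sj.1 g /\
    dist (t sj.2) g < (r sj.1 sj.2)%:E.
  move=> [s j] /=.
  have : set_dist dist (t j) (A s) < (r s j)%:E.
    by rewrite EFinD fineK// lteDl// lte_fin mulr_gt0.
  by move=> /ereal_inf_lt[_ [g Ag <-] gr']; exists g.
have Api s j : A s (ap (s, j)) by have [] := apP (s, j).
have Fpi s j : F (ap (s, j)) by exact: (AF _ _ (Api s j)).
have subpi s j : subgaussian mu (fun x => t j x - ap (s, j) x)%R (r s j).
  apply: subgaussian_gt; last by have [] := apP (s, j).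
  by apply: measurable_funB; exact: mF.
pose c0 s j : T -> R := if s is s'.+1 then if (S <= s)%N then t j else ap (s', j) else fun=> 0%R.
have c0F s j : (0 < s)%N -> F (c0 s j) by case: s => //= s _; case: ifP.
have mc0 s j : measurable_fun setT (c0 s j).
  by case: s => [|s]; [exact: measurable_cst|apply: mF; exact: c0F].
have subc0 s j : subgaussian mu (c0 s j) (2 * D).
  case: s => [|s]; first by apply: subgaussian0; rewrite mulr_gt0.
  by apply: subgaussian_class; exact: c0F.
pose inc s j x : R := (c0 s.+1 j x - c0 s j x)%R.
have minc s j : measurable_fun setT (inc s j) by exact: measurable_funB.
have subinc s j : subgaussian mu (inc s j) (2 * D + 2 * D) by exact: subgaussianB.
(* The length must be determined by the end points, hence the norm of their difference
   and not the bound r + r that is used to estimate it. *)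
pose dl0 s j : R := (fine (psi2_norm mu (inc s j)) + D * 4^-1 ^+ s)%R.
have subdl s j : subgaussian mu (inc s j) (dl0 s j).
  by apply: subgaussian_fine => //; rewrite mulr_gt0.
have dl00 s j : (0 < dl0 s j)%R by have [] := subdl s j.
have /choice[e eP] : forall s, exists e : (T -> R) -> nat, (0 < s)%N ->
    (forall f, A s f -> (e f < 2 ^ (2 ^ s))%N) /\ {in A s &, injective e}.
  move=> s; have [s0|] := ltnP 0 s; last by exists (fun=> 0%N).
  have /pcard_leP[h] := cardA s s0; exists h => _; split.
    by move=> f Af; exact: (@funS _ _ _ _ h).
  exact: (@inj _ _ _ h).
pose code s (j : 'I_n) : nat := if s is s'.+1 then
  if (S <= s)%N then j : nat else if s' is 0%N then 0%N else e s' (ap (s', j)) else 0%N.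
have pow2 m k : (m <= k)%N -> (2 ^ (2 ^ m) <= 2 ^ (2 ^ k))%N.
  by move=> mk; rewrite !leq_exp2l.
have c0code s j j' : code s j = code s j' -> c0 s j = c0 s j'.
  case: s => //= s; case: ifP => [_ /val_inj ->//|_].
  case: s => [_|s].
    have h i : ap (0%N, i) = f0 by have := Api 0%N i; rewrite A0.
    by rewrite !h.
  by have [_ einj] := eP s.+1 isT; move=> /einj; apply; rewrite inE.
have codelt s j : (code s j < 2 ^ (2 ^ s))%N.
  case: s => //= s; case: ifP => [Ss|_].
    by apply: leq_trans (ltn_ord j) _; apply: leq_trans nS (pow2 _ _ Ss).
  case: s => [|s]; first by rewrite expn_gt0.
  have [elt _] := eP s.+1 isT; apply: leq_trans (elt _ (Api s.+1 j)) _.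
  exact: pow2.
have twoD : (0 < 2 * D)%R by rewrite mulr_gt0.
exists (fun s j x => c0 s j x / (2 * D))%R, code, (fun s j => dl0 s j / (2 * D))%R.
split.
- split; first by move=> j; apply/funext => x /=; rewrite mul0r.
  by case=> [|s] j x Ss; [move: S0; rewrite (leqn0 S) in Ss; rewrite (eqP Ss)|rewrite /= Ss].
- by split => // s j j' /c0code ->.
- split=> s j; first by apply: measurable_funM.
  exact: subgaussian_scale.
- split=> [s j|s j|s j j' h1 h2].
  + by rewrite divr_gt0.
  + under eq_integral => x _ do rewrite -mulrBl invf_div mulrA divfK ?gt_eqF//.
    exact: (subgaussian_scale _ _ _ (subdl s j)).
  + have eqc f g : (fun x : T => f x / (2 * D))%R = (fun x => g x / (2 * D))%R -> f = g.
      move=> fg; apply/funext => x; have := congr1 (@^~ x) fg => /=.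
      by move=> /(congr1 (fun y => y * (2 * D))%R); rewrite !divfK// gt_eqF.
    by rewrite /dl0 /inc (eqc _ _ h1) (eqc _ _ h2).
move=> j.
have r0 s : (0 <= r s j)%R.
  by rewrite addr_ge0 ?fine_ge0 ?set_dist_ge0// ltW// mulr_gt0.
have sumr (m : nat) : (\sum_(0 <= s < m) wt s * r s j <= near_gamma + 2 * D)%R.
  under eq_bigr do rewrite mulrDr mulrCA.
  rewrite big_split/= -mulr_sumr [(2 * D)%R]mulrC lerD//; last first.
    by rewrite ler_wpM2l ?(ltW D0)// sum_wt_quarter.
  rewrite -lee_fin; have := chain_sum_le _ _ m (HA _ (Ft j)); rewrite -sumEFin.
  by under [in X in _ -> X]eq_bigr do rewrite EFinM fineK//.
have dls s : (s < S)%N -> (dl0 s j <= (if s is s'.+1 then r s' j else 2 * D) + (if s is _.+1 then r s j else D) + D * 4^-1 ^+ s)%R.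
  move=> sS; rewrite /dl0; case: s sS => [|s] sS.
    rewrite lerD2r; apply: (@le_trans _ _ (2 * D)%R); last by lra.
    apply: fine_psi2_norm_le; rewrite /inc (_ : (fun x => _) = c0 1%N j); first exact: subc0.
    by apply/funext => x /=; rewrite subr0.
  rewrite lerD2r /inc /=; rewrite (leqNgt S s.+1) sS/=.
  have [Ss|sS'] := leqP S s.+2.
    apply: (@le_trans _ _ (r s j)); last by rewrite lerDl.
    exact: fine_psi2_norm_le.
  apply: fine_psi2_norm_le.
  rewrite (_ : (fun x => _) = fun x => (t j x - ap (s, j) x) - (t j x - ap (s.+1, j) x))%R.
    by apply: subgaussianB => //; apply: measurable_funB; exact: mF.
  by apply/funext => x; ring.
have wt0 : (wt 0 = 1 :> R)%R by rewrite /wt expr0 sqrtr1.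
have wr0 s : (0 <= wt s * r s j)%R by rewrite mulr_ge0// ltW ?wt_gt0.
have bound : (\sum_(0 <= s < S) dl0 s j * wt s <= 3 * near_gamma + 11 * D)%R.
  apply: (@le_trans _ _ (\sum_(0 <= s < S)
      ((if s is s'.+1 then r s' j else 2 * D) * wt s +
       (if s is _.+1 then r s j else D) * wt s + D * (wt s * 4^-1 ^+ s)))%R).
    rewrite big_nat [leRHS]big_nat; apply: ler_sum => s /andP[_ sS].
    rewrite [(wt s * _)%R]mulrC mulrA -!mulrDl ler_wpM2r ?(ltW (wt_gt0 _))//.
    exact: dls.
  rewrite !big_split/= -mulr_sumr -{1 2}(prednK S0) !big_nat_recl//= wt0 !mulr1.
  have h1 : (\sum_(0 <= s < S.-1) r s j * wt s.+1 <= 2 * (near_gamma + 2 * D))%R.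
    apply: (@le_trans _ _ (2 * \sum_(0 <= s < S.-1) wt s * r s j)%R).
      rewrite mulr_sumr; apply: ler_sum => s _.
      by rewrite mulrC mulrA ler_wpM2r// wt_succ_le.
    by rewrite ler_wpM2l.
  have h2 : (\sum_(0 <= s < S.-1) r s.+1 j * wt s.+1 <= near_gamma + 2 * D)%R.
    apply: le_trans (sumr S); rewrite -{2}(prednK S0) big_nat_recl//.
    by under eq_bigr do rewrite mulrC; rewrite lerDr.
  have h3 := ler_wpM2l (ltW D0) (sum_wt_quarter S).
  by move: h1 h2 h3; lra.
under eq_bigr do rewrite mulrAC.
rewrite -mulr_suml ler_pdivrMr// [leRHS](_ : _ = 50 * gr)%R; last by field; rewrite gt_eqF.
by apply: le_trans bound _; have := diam_le_gamma; lra.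
Qed.

End chain.

(** * The deviation of a finite family *)

Section deviation.
Context {R : realType} {d0 : measure_display} {Omega : measurableType d0}.
Context (P : probability Omega R) {N p : nat} {d : 'I_p -> measure_display}.
Context {T : forall k, measurableType (d k)} (mu : forall k, probability (T k) R).
Context (X : forall k, {RV P >-> T k}) (Xs : 'I_N -> forall k, {RV P >-> T k}).
Context (F : forall k, set (T k -> R)) (D gr : 'I_p -> R).
Hypothesis iid : iid_tuples (fun o : option 'I_N => if o is Some i then Xs i else X).
Hypothesis lawX : forall k (A : set (T k)), measurable A -> distribution P (X k) A = mu k A.
Hypothesis N0 : (0 < N)%N.
Hypothesis p2 : (2 <= p)%N.
Hypothesis mF : forall k f, F k f -> measurable_fun setT f.
Hypothesis symF : forall k, F k (fun=> 0%R) \/ (forall f, F k f -> F k (fun x => (- f x)%R)).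
Hypothesis D0 : forall k, (0 < D k)%R.
Hypothesis diamF : forall k, psi2_diam (mu k) (F k) = (D k)%:E.
Hypothesis gammaF : forall k, gamma_psi2 (mu k) (F k) = (gr k)%:E.

Lemma ge0_integral_law k (f : T k -> \bar R) : measurable_fun setT f ->
  (forall x, 0 <= f x) -> \int[P]_w f (X k w) = \int[mu k]_x f x.
Proof.
move=> mf f0; rewrite -(ge0_integral_distribution (X k) mf f0).
by apply: eq_measure_integral => A mA _; exact: lawX.
Qed.

Lemma Rintegral_weighted_sum (I : Type) (r : seq I) (al : I -> R) (h : I -> Omega -> R) :
  (forall i, P.-integrable setT (EFin \o h i)) ->
  P.-integrable setT (EFin \o (fun w => \sum_(i <- r) al i * h i w)%R) /\
  (\int[P]_w (\sum_(i <- r) al i * h i w) = \sum_(i <- r) al i * \int[P]_w h i w)%R.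
Proof.
move=> Ih; elim: r => [|i r [ih1 ih2]].
  split; last by rewrite big_nil; under eq_Rintegral do rewrite big_nil; rewrite Rintegral_cst// mul0r.
  rewrite (_ : EFin \o _ = EFin \o cst 0%R); first exact: finite_measure_integrable_cst.
  by apply/funext => w /=; rewrite big_nil.
have Iz : P.-integrable setT (EFin \o (fun w => al i * h i w)%R).
  rewrite (_ : EFin \o _ = (fun w => (al i)%:E * (h i w)%:E)); last exact/funext.
  by apply: integrableZl => //; exact: Ih.
split.
  rewrite (_ : EFin \o _ = (EFin \o (fun w => al i * h i w)%R) \+
    (EFin \o (fun w => \sum_(j <- r) al j * h j w)%R)).
    exact: (integrableD measurableT).
  by apply/funext => w /=; rewrite big_cons EFinD.
under eq_Rintegral do rewrite big_cons.
by rewrite RintegralD// RintegralZl// ih2 big_cons.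
Qed.

(** An object of level [s]: the codes of the two end points of a link, and a mark
    that selects the link ([None]) or one of its end points. *)
Definition code_type (s : nat) : finType :=
  (option bool * 'I_(2 ^ (2 ^ s)) * 'I_(2 ^ (2 ^ s.+1)))%type.

Lemma card_code_type s : (#|code_type s|%:R <= expR (5 * 2 ^+ s) :> R)%R.
Proof.
rewrite !card_prod card_option card_bool !card_ord.
have e2 : (2 <= expR 1 :> R)%R by apply: le_trans (expR_ge1Dx 1); lra.
have pow m : ((2 ^ m)%N%:R <= expR m%:R :> R)%R.
  rewrite natrX -[in leRHS](mulr1 m%:R) expRM_natl lerXn2r ?nnegrE ?expR_ge0//.
rewrite !natrM; apply: (@le_trans _ _ (expR 2 * expR (2 ^ s)%N%:R * expR (2 ^ s.+1)%N%:R)%R).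
  rewrite !ler_pM ?mulr_ge0//.
  rewrite (_ : 2 = 1 + 1 :> R)%R//; rewrite expRD; nra.
rewrite -!expRD ler_expR expnS natrM natrX.
have s1 : (1 <= 2 ^+ s :> R)%R by rewrite exprn_ege1// ler1n.
lra.
Qed.

Definition deviation_cst : R :=
  (chaining_cst (p := p) (tprod_cst (p := p)) (4 * p%:R ^+ 2 * prod_moment_cst (p := p))
     (prod_moment_cst (p := p) * (2 * p%:R)) * 2 ^+ p * (25 + p%:R * 25 ^+ p))%R.

(** The objects of all chains are controlled at once by [exists_level_control];
    for each sample the bound then follows from [chaining_bound]. *)
Lemma deviation_bound (n : nat) (t : 'I_n -> forall k, T k -> R) :
  (forall j k, F k (t j k)) ->
  exists L : Omega -> R, [/\ measurable_fun setT L, (forall w, 0 <= L w)%R,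
    \int[P]_w (expR (L w))%:E <= 2%:E &
    forall j w, product_deviation X Xs (t j) w <=
      (deviation_cst * (union_cst (p := p) 5 + L w) ^+ p.+1 * \prod_(k < p) D k *
       ((\sum_(k < p) gr k / D k) / Num.sqrt N%:R +
        (\prod_(k < p) (gr k / D k + Num.sqrt (ln N%:R))) / N%:R))%:E].
Proof.
move=> Ft.
have p0 : (0 < p)%N by exact: ltnW.
(* Any S with n <= 2^(2^S) would do: the n functions must fit in the codes of level S. *)
pose S := n.+1.
have nS : (n <= 2 ^ (2 ^ S))%N.
  apply: leq_trans (ltnW (ltn_expl n (isT : 1 < 2)%N)) _; rewrite leq_exp2l//.
  by apply: leq_trans (ltnW (ltn_expl n (isT : 1 < 2)%N)) _; rewrite leq_exp2l.
have H k := exists_chain (mu k) (F k) (D k) (gr k) (@mF k) (symF k) (D0 k) (diamF k)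
  (gammaF k) n (fun j => t j k) S (fun j => Ft j k) nS (ltn0Sn n).
pose c k := sval (cid (H k)).
have H1 k : exists code dl, is_chain (mu k) (D k) (gr k) n (fun j => t j k) S (c k) code dl.
  exact: (svalP (cid (H k))).
pose code k := sval (cid (H1 k)).
have H2 k : exists dl, is_chain (mu k) (D k) (gr k) n (fun j => t j k) S (c k) (code k) dl.
  exact: (svalP (cid (H1 k))).
pose dl k := sval (cid (H2 k)).
have H3 k : is_chain (mu k) (D k) (gr k) n (fun j => t j k) S (c k) (code k) (dl k).
  exact: (svalP (cid (H2 k))).
have {c code dl H H1 H2 H3} [c [code [dl chn]]] : exists c code dl, forall k,
    is_chain (mu k) (D k) (gr k) n (fun j => t j k) S (c k) (code k) (dl k).
  by exists c, code, dl.
have c0 k j x : c k 0%N j x = 0%R by have [[h _] _ _ _ _] := chn k; rewrite h.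
have cS k s j x : (S <= s)%N -> c k s j x = (t j k x / (2 * D k))%R.
  by have [[_ h] _ _ _ _] := chn k; exact: h.
have codelt k s j : (code k s j < 2 ^ (2 ^ s))%N by have [_ [h _] _ _ _] := chn k.
have codec k s j j' : code k s j = code k s j' -> c k s j = c k s j'.
  by have [_ [_ h] _ _ _] := chn k; exact: h.
have mc k s j : measurable_fun setT (c k s j) by have [_ _ [h _] _ _] := chn k; exact: h.
have Ec k s j : \int[mu k]_x (expR (c k s j x ^+ 2))%:E <= 2%:E.
  by have [_ _ [_ h] _ _] := chn k; exact: h.
have dl0 k s j : (0 < dl k s j)%R by have [_ _ _ [h _ _] _] := chn k; exact: h.
have Edl k s j : \int[mu k]_x (expR (((c k s.+1 j x - c k s j x) / dl k s j) ^+ 2))%:E <= 2%:E.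
  by have [_ _ _ [_ h _] _] := chn k; exact: h.
have dlc k s j j' : c k s j = c k s j' -> c k s.+1 j = c k s.+1 j' -> dl k s j = dl k s j'.
  by have [_ _ _ [_ _ h] _] := chn k; exact: h.
have dlsum k j : (\sum_(0 <= s < S) dl k s j * wt s <= 25 * (gr k / D k))%R.
  by have [_ _ _ _ h] := chn k; exact: h.
pose obj s k (tau : option bool) (j : 'I_n) : T k -> R :=
  match tau with
  | None => fun x => ((c k s.+1 j x - c k s j x) / dl k s j)%R
  | Some false => c k s j
  | Some true => c k s.+1 j
  end.
have mobj s k tau j : measurable_fun setT (obj s k tau j).
  case: tau => [[]|]; [exact: mc|exact: mc|].
  by apply: measurable_funM => //; exact: measurable_funB.
have Eobj s k tau j : \int[mu k]_x (expR (obj s k tau j x ^+ 2))%:E <= 2%:E.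
  by case: tau => [[]|]; [exact: Ec|exact: Ec|exact: Edl].
pose G s k (v : code_type s) : T k -> R :=
  if [pick j | (code k s j == v.1.2 :> nat) && (code k s.+1 j == v.2 :> nat)] is Some j
  then obj s k v.1.1 j else fun=> 0%R.
pose cd k s j : 'I_(2 ^ (2 ^ s)) := Ordinal (codelt k s j).
have GE s k tau j : G s k (tau, cd k s j, cd k s.+1 j) = obj s k tau j.
  rewrite /G /=; case: pickP => [j' /andP[/eqP h1 /eqP h2]|/(_ j)]; last by rewrite !eqxx.
  have e1 := codec _ _ _ _ h1; have e2 := codec _ _ _ _ h2.
  by rewrite /obj (dlc _ _ _ _ e1 e2) e1 e2.
have mG s k v : measurable_fun setT (G s k v).
  by rewrite /G; case: pickP => [j _|_]; [exact: mobj|exact: measurable_cst].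
have EXobj s k tau j : \int[P]_w (expR (obj s k tau j (X k w) ^+ 2))%:E <= 2%:E.
  apply: le_trans (Eobj s k tau j).
  rewrite (ge0_integral_law k (fun x => (expR (obj s k tau j x ^+ 2))%:E))//.
    by apply/measurable_EFinP; apply: measurableT_comp => //; exact: measurable_funX.
have EG s k v : \int[P]_w (expR (G s k v (X k w) ^+ 2))%:E <= 2%:E.
  rewrite /G; case: pickP => [j _|_]; first exact: EXobj.
  under eq_integral do rewrite expr0n/= expR0.
  by rewrite integral_cst// [X in _ * X]probability_setT mule1 lee_fin; lra.
have [L [mL L0 EL HL]] := exists_level_control P X Xs iid N0 p2 code_type G 5%R
  (ler0n _ 5) card_code_type mG EG S.+1.
exists L; split => // j w.
set l := (union_cst 5 + L w)%R.
have p1 : (2 <= p%:R :> R)%R by rewrite ler_nat.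
have l1 : (1 <= l)%R by rewrite /l /union_cst; have := L0 w; lra.
pose ga k : R := (25 * (gr k / D k))%R.
have ga1 k : (1 <= ga k)%R.
  have h := diam_le_gamma (mu k) (F k) (D k) (gr k) (@mF k) (symF k) (D0 k) (diamF k) (gammaF k).
  rewrite /ga mulrA ler_pdivlMr// mul1r; have := D0 k; lra.
pose av k s i : R := c k s j (Xs i k w).
pose gv k s i : R := obj s k None j (Xs i k w).
have good s k tau : (s < S.+1)%N ->
    level_good (N := N) (p := p) s l (fun i => obj s k tau j (Xs i k w)).
  move=> sS; have [h1 h2 _] := HL s w sS.
  have := h1 k (tau, cd k s j, cd k s.+1 j); have := h2 k (tau, cd k s j, cd k s.+1 j).
  by rewrite GE.
(* The marks of the factors of [hybrid]. *)
pose tauk (k j' : 'I_p) : option bool :=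
  if (j' < k)%N then Some true else if j' == k then None else Some false.
pose vk s k : {ffun 'I_p -> code_type s} :=
  [ffun j' => (tauk k j', cd j' s j, cd j' s.+1 j)].
have hybE s k j' i : hybrid av gv s k j' i = obj s j' (tauk k j') j (Xs i j' w).
  rewrite /hybrid /tauk; case: ifP => // _; case: eqP => // ->; exact: erefl.
pose U s k j' w' : R := obj s j' (tauk k j') j (X j' w').
have mU s k j' : measurable_fun setT (U s k j').
  by apply: (measurableT_comp (mobj _ _ _ _)); exact: measurable_funP.
have EU s k j' : \int[P]_w' (expR (U s k j' w' ^+ 2))%:E <= 2%:E by exact: EXobj.
pose m s k := (\int[P]_w' tprod (thr N s) k (fun j' => U s k j' w'))%R.
pose mf s k := (\int[P]_w' \prod_(j' < p) U s k j' w')%R.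
have C0 : (0 <= prod_moment_cst (p := p) :> R)%R by exact: prod_moment_cst_ge0.
have c30 : (0 <= tprod_cst (p := p) :> R)%R.
  by rewrite /tprod_cst !addr_ge0 ?mulr_ge0 ?exprn_ge0.
have c40 : (0 <= 4 * p%:R ^+ 2 * prod_moment_cst (p := p) :> R)%R.
  by rewrite !mulr_ge0 ?exprn_ge0.
have c50 : (0 <= prod_moment_cst (p := p) * (2 * p%:R) :> R)%R.
  by rewrite !mulr_ge0.
have a0' k i : av k 0%N i = 0%R by exact: c0.
have inc' k s i : (s < S)%N -> (av k s.+1 i - av k s i = dl k s j * gv k s i)%R.
  by move=> _; rewrite /gv /obj mulrC divfK// gt_eqF.
have CB := @chaining_bound R N p N0 p0 S av gv (fun k s => dl k s j) ga l
  _ _ _ m mf l1 ga1 c30 c40 c50 (fun k s => ltW (dl0 k s j)) a0' inc'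
  (fun k s sS => good s k (Some false) sS)
  (fun k s sS => good s k (Some true) (ltnW sS))
  (fun k s sS => good s k None (ltnW sS)) (fun k => dlsum k j).
have {}CB := CB _ (fun s k _ => Rintegral_tprod_diff P p2 (U s k) (mU s k) (EU s k) _ k (thr_ge0 N s))
  (fun s k _ => Rintegral_prodU_le P p2 (U s k) (mU s k) (EU s k)).
have tdev s k : (s < S)%N -> (2 ^+ s <= N%:R :> R)%R ->
  (`|\sum_(i < N) tprod (thr N s) k (fun j' => hybrid av gv s k j' i) - N%:R * m s k| <=
   tprod_cst (p := p) * Num.sqrt N%:R * wt s * l)%R.
  move=> sS sN; have [_ _ /(_ sN k (vk s k))] := HL s w (ltnW sS).
  have GvE j' : G s j' (vk s k j') = obj s j' (tauk k j') j by rewrite /vk ffunE GE.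
  rewrite /tprod_mean; under eq_bigr do under eq_fun do rewrite GvE -hybE.
  by under eq_Rintegral do under eq_fun do rewrite GvE.
have {}CB := CB tdev.
pose M := (\int[P]_w' \prod_(k < p) c k S j (X k w'))%R.
have IU s k : P.-integrable setT (EFin \o (fun w' => \prod_(j' < p) U s k j' w')%R).
  apply: (integrable_dominated P (U s k) (mU s k) (EU s k) _ _ (measurable_prodU _ (mU s k)) C0).
  exact: norm_prodU_le.
have telX w' : (\prod_(k < p) c k S j (X k w') =
    \sum_(0 <= s < S) 1 * \sum_(k < p) dl k s j * \prod_(j' < p) U s k j' w')%R.
  have h := @prod_chain_telescope R 1 p p0 S (fun k s _ => c k s j (X k w'))
    (fun k s _ => obj s k None j (X k w')) (fun k s => dl k s j)
    (fun k _ => c0 k j _) _ ord0.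
  rewrite h; last by move=> k s _ _; rewrite /obj mulrC divfK// gt_eqF.
  apply: eq_bigr => s _; rewrite mul1r; apply: eq_bigr => k _; congr (_ * _)%R.
  apply: eq_bigr => j' _; rewrite /hybrid /U /tauk; case: ifP => // _.
  by case: eqP => // ->.
have Isum s := Rintegral_weighted_sum _ (index_enum 'I_p) (fun k => dl k s j) _ (IU s).
have [IM ME] := Rintegral_weighted_sum _ (index_iota 0 S) (fun=> 1%R) _ (fun s => (Isum s).1).
have MdefE : M = (\sum_(0 <= s < S) \sum_(k < p) dl k s j * mf s k)%R.
  rewrite /M; under eq_Rintegral do rewrite telX.
  by rewrite ME; apply: eq_bigr => s _; rewrite mul1r (Isum s).2.
have IcS : P.-integrable setT (EFin \o (fun w' => \prod_(k < p) c k S j (X k w'))%R).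
  by under eq_fun do rewrite telX.
rewrite -MdefE in CB.
pose K : R := (\prod_(k < p) (2 * D k))%R.
have K0 : (0 < K)%R by apply: prodr_gt0 => k _; rewrite mulr_gt0.
have tE (Y : forall k, T k) : (\prod_(k < p) t j k (Y k) = K * \prod_(k < p) c k S j (Y k))%R.
  rewrite -big_split/=; apply: eq_bigr => k _.
  by rewrite cS// mulrC divfK// gt_eqF// mulr_gt0.
have EE : 'E_P[fun w' => (\prod_(k < p) t j k (X k w'))%R] = (K * M)%:E.
  rewrite unlock; under eq_integral do rewrite tE EFinM.
  rewrite integralZl//; rewrite EFinM; congr (_ * _).
  by rewrite /M /Rintegral fineK//; exact: (integrable_fin_num measurableT IcS).
rewrite /product_deviation EE -EFinB abse_EFin lee_fin.
under eq_bigr do rewrite tE.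
have n0 : (0 < N%:R :> R)%R by rewrite ltr0n.
set Z := (\sum_(i < N) \prod_(k < p) av k S i)%R in CB.
rewrite -mulr_sumr -/Z [X in `|X|%R](_ : _ = (K / N%:R) * (Z - N%:R * M))%R; last first.
  by field; rewrite gt_eqF.
have KN0 : (0 < K / N%:R)%R by rewrite divr_gt0.
rewrite normrM (ger0_norm (ltW KN0)).
apply: le_trans (ler_wpM2l (ltW KN0) CB) _.
rewrite /deviation_cst; set A := chaining_cst _ _ _.
have A0 : (0 <= A)%R.
  rewrite /A /chaining_cst addr_ge0 ?addr_ge0// !mulr_ge0// addr_ge0//.
  by rewrite /cross_cst !mulr_ge0 ?addr_ge0 ?mulr_ge0 ?exprn_ge0.
have g0 k : (0 <= gr k / D k)%R by have := ga1 k; rewrite /ga; lra.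
have s0 : (0 <= Num.sqrt (ln N%:R) :> R)%R by exact: sqrtr_ge0.
have KE : (K = 2 ^+ p * \prod_(k < p) D k)%R.
  by rewrite /K big_split/= big_const_ord iter_mulr_1.
have sumE : (\sum_(k < p) ga k = 25 * \sum_(k < p) gr k / D k)%R by rewrite mulr_sumr.
have prodE : (\prod_(k < p) (ga k + Num.sqrt (ln N%:R)) <=
    25 ^+ p * \prod_(k < p) (gr k / D k + Num.sqrt (ln N%:R)))%R.
  rewrite -[p in (25 ^+ p)%R]card_ord -prodr_const -big_split/=; apply: ler_prod => k _.
  by rewrite addr_ge0//=; [rewrite /ga; lra|have := ga1 k; lra].
rewrite sumE KE; set Dp := (\prod_(k < p) D k)%R; set sg := (\sum_(k < p) _)%R.
set pg := (\prod_(k < p) (gr k / D k + _))%R in prodE *.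
have Dp0 : (0 < Dp)%R by exact: prodr_gt0.
have sg0 : (0 <= sg)%R by exact: sumr_ge0.
have pg0 : (0 <= pg)%R by apply: prodr_ge0 => k _; rewrite addr_ge0.
set r := Num.sqrt N%:R.
have r0 : (0 < r)%R by rewrite sqrtr_gt0.
have rr : (N%:R = r ^+ 2)%R by rewrite sqr_sqrtr.
apply: (@le_trans _ _ (2 ^+ p * Dp / N%:R * (A * l ^+ p.+1 *
    (r * (25 * sg) + p%:R * (25 ^+ p * pg))))%R).
  rewrite ler_wpM2l ?divr_ge0 ?mulr_ge0 ?exprn_ge0 ?(ltW Dp0)//.
  rewrite ler_wpM2l ?mulr_ge0 ?exprn_ge0//; first by move: l1; lra.
  by rewrite lerD2l ler_wpM2l.
rewrite [leLHS](_ : _ = (A * 2 ^+ p * l ^+ p.+1 * Dp) *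
    (25 * (sg / r) + p%:R * 25 ^+ p * (pg / N%:R)))%R; last first.
  by rewrite rr; field; rewrite gt_eqF.
rewrite [leRHS](_ : _ = (A * 2 ^+ p * l ^+ p.+1 * Dp) *
    ((25 + p%:R * 25 ^+ p) * (sg / r + pg / N%:R)))%R; last by ring.
rewrite ler_wpM2l ?mulr_ge0 ?exprn_ge0 ?(ltW Dp0)//; first by move: l1; lra.
have x0 : (0 <= sg / r)%R by rewrite divr_ge0// ltW.
have y0 : (0 <= pg / N%:R)%R by rewrite divr_ge0.
have c0' : (0 <= p%:R * 25 ^+ p :> R)%R by rewrite mulr_ge0// exprn_ge0.
have := mulr_ge0 c0' x0; have := mulr_ge0 c0' y0; lra.
Qed.

End deviation.

(** * Moments of the maximal deviation *)

Lemma measurable_product_deviation {R : realType} {d0 : measure_display}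
    {Omega : measurableType d0} (P : probability Omega R) (N p : nat)
    {d : 'I_p -> measure_display} {T : forall k, measurableType (d k)}
    (X : forall k, {RV P >-> T k}) (Xs : 'I_N -> forall k, {RV P >-> T k})
    (f : forall k, T k -> R) :
  (forall k, measurable_fun setT (f k)) ->
  measurable_fun setT (product_deviation X Xs f).
Proof.
move=> mf; apply: measurableT_comp => //; apply: emeasurable_funB => //.
apply/measurable_EFinP; apply: measurable_funM => //.
apply: measurable_sum => i; apply: measurable_prod => k _.
by apply: (measurableT_comp (mf k)); exact: measurable_funP.
Qed.

Lemma measurable_bigmaxe {R : realType} {d0 : measure_display}
    {Omega : measurableType d0} n (f : 'I_n -> Omega -> \bar R) :
  (forall j, measurable_fun setT (f j)) ->
  measurable_fun setT (fun w => \big[maxe/0]_(j < n) f j w).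
Proof.
elim: n f => [|n ih] f mf.
  by under eq_fun do rewrite big_ord0; exact: measurable_cst.
under eq_fun do rewrite big_ord_recl.
by apply: measurable_maxe => //; apply: ih.
Qed.

Section moments.
Context {R : realType} {d0 : measure_display} {Omega : measurableType d0}.
Context (P : probability Omega R).

Definition moment_cst (K : R) (m : nat) : R := (m`!%:R * expR K * 2)%R.

(** As the majorant depends on no index, the maximum costs nothing; its q-th power
    is at most a power of K + L with a natural exponent, and y^m <= m! e^y. *)
Lemma integral_max_moment (n : nat) (Z : 'I_n -> Omega -> \bar R) (L : Omega -> R)
    (A K q : R) (a m : nat) :
  (forall j, measurable_fun setT (Z j)) -> (forall j w, 0 <= Z j w) ->
  measurable_fun setT L -> (forall w, 0 <= L w)%R ->
  \int[P]_w (expR (L w))%:E <= 2%:E ->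
  (0 <= A)%R -> (1 <= K)%R -> (0 < q)%R -> (a%:R * q <= m%:R)%R ->
  (forall j w, Z j w <= (A * (K + L w) ^+ a)%:E) ->
  \int[P]_w \big[maxe/0]_(j < n) (Z j w `^ q) <= (A `^ q * moment_cst K m)%:E.
Proof.
move=> mZ Z0 mL L0 EL A0 K1 q0 aqm ZA.
have KL1 w : (1 <= K + L w)%R by have := L0 w; lra.
have C0 : (0 <= A `^ q * (m`!%:R * expR K))%R.
  by rewrite !mulr_ge0 ?powR_ge0 ?expR_ge0.
have pw w : \big[maxe/0]_(j < n) (Z j w `^ q) <=
    (A `^ q * (m`!%:R * expR K) * expR (L w))%:E.
  apply: bigmax_le => [|j _]; first by rewrite lee_fin mulr_ge0 ?expR_ge0.
  apply: (@le_trans _ _ ((A * (K + L w) ^+ a)%:E `^ q)).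
    apply: gt0_ler_poweR; rewrite ?in_itv/= ?leey ?andbT ?(ltW q0)//.
    by rewrite lee_fin mulr_ge0// exprn_ge0//; have := KL1 w; lra.
  rewrite poweR_EFin lee_fin powRM ?exprn_ge0//; last by have := KL1 w; lra.
  rewrite -[leRHS]mulrA ler_wpM2l ?powR_ge0//.
  rewrite -powR_mulrn; last by have := KL1 w; lra.
  rewrite -powRrM; apply: (@le_trans _ _ ((K + L w) `^ m%:R)%R).
    exact: ler_powR.
  rewrite powR_mulrn; last by have := KL1 w; lra.
  rewrite -mulrA -expRD; apply: exprn_le_fact_expR; have := KL1 w; lra.
apply: (@le_trans _ _ (\int[P]_w (A `^ q * (m`!%:R * expR K) * expR (L w))%:E)).
  apply: ge0_le_integral => //.
  - by move=> w _; exact: bigmax_ge_id.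
  - apply: measurable_bigmaxe => j.
    exact: (measurableT_comp (measurable_poweR q) (mZ j)).
  - apply/measurable_EFinP; apply: measurable_funM => //.
    exact: measurableT_comp.
under eq_integral do rewrite EFinM.
rewrite ge0_integralZl_EFin//; last first.
  by apply/measurable_EFinP; exact: measurableT_comp.
rewrite /moment_cst [leRHS](_ : _ = (A `^ q * (m`!%:R * expR K))%:E * 2%:E); last first.
  by rewrite -EFinM; congr EFin; ring.
by rewrite lee_wpmul2l// lee_fin.
Qed.

End moments.

(** * Classes of zero diameter *)

Section vanishing.
Context {R : realType} {d0 : measure_display} {Omega : measurableType d0}.
Context (P : probability Omega R) {N p : nat} {d : 'I_p -> measure_display}.
Context {T : forall k, measurableType (d k)} (mu : forall k, probability (T k) R).
Context (X : forall k, {RV P >-> T k}) (Xs : 'I_N -> forall k, {RV P >-> T k}).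
Hypothesis iid : iid_tuples (fun o : option 'I_N => if o is Some i then Xs i else X).
Hypothesis lawX : forall k (A : set (T k)), measurable A -> distribution P (X k) A = mu k A.

(** Every c > 0 is an admissible scale, and f^2 <= c^2 exp(f^2 / c^2). *)
Lemma psi2_norm0_integral {d1 : measure_display} {T1 : measurableType d1}
    (nu : probability T1 R) (f : T1 -> R) : measurable_fun setT f ->
  psi2_norm nu f = 0 -> \int[nu]_x (f x ^+ 2)%:E = 0.
Proof.
move=> mf f0.
have I0 : 0 <= \int[nu]_x (f x ^+ 2)%:E.
  by apply: integral_ge0 => x _; rewrite lee_fin sqr_ge0.
have small c : (0 < c)%R -> \int[nu]_x (f x ^+ 2)%:E <= (2 * c ^+ 2)%:E.
  move=> c0; have [_ h] : subgaussian nu f c.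
    by apply: subgaussian_gt => //; rewrite f0 lte_fin.
  rewrite [leRHS](_ : _ = (0 + c ^+ 2 * 2)%:E); last by congr EFin; ring.
  apply: (integral_le_affine nu (fun x => (f x ^+ 2)%R) _ 0%R (c ^+ 2)%R 2 _
     (measurable_exp_sqr f c mf)) => //.
  - exact: measurable_funX.
  - by move=> x; exact: sqr_ge0.
  - exact: sqr_ge0.
  - move=> x; rewrite add0r -ler_pdivrMl ?exprn_gt0// [leLHS]mulrC.
    rewrite real_normK ?num_real//.
    by have := expR_ge1Dx (f x ^+ 2 / c ^+ 2); lra.
(* The scale c = sqrt(e / 2) makes the bound 2 c^2 equal to e. *)
apply/eqP; rewrite eq_le I0 andbT; apply/lee_addgt0Pr => e e0; rewrite add0e.
apply: le_trans (small (Num.sqrt (e / 2)) _) _; first by rewrite sqrtr_gt0 divr_gt0.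
rewrite sqr_sqrtr ?divr_ge0 ?(ltW e0)// lee_fin; lra.
Qed.

Lemma product_deviation_ae0 (k : 'I_p) (f : forall k, T k -> R) :
  (forall k, measurable_fun setT (f k)) -> psi2_norm (mu k) (f k) = 0 ->
  {ae P, forall w, product_deviation X Xs f w = 0}.
Proof.
move=> mf fk0.
have mfc (Y : T k -> R) (V : {RV P >-> T k}) : measurable_fun setT Y ->
    measurable_fun setT (fun w => Y (V w)).
  by move=> mY; apply: (measurableT_comp mY); exact: measurable_funP.
have msq : measurable_fun setT (fun x => (f k x ^+ 2)%:E).
  by apply/measurable_EFinP; exact: measurable_funX.
have sq0 : forall x, 0 <= (f k x ^+ 2)%:E by move=> x; rewrite lee_fin sqr_ge0.
have EX : \int[P]_w (f k (X k w) ^+ 2)%:E = 0.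
  rewrite (ge0_integral_law P mu X lawX k (fun x => (f k x ^+ 2)%:E))//.
  exact: psi2_norm0_integral.
have EXs i : \int[P]_w (f k (Xs i k w) ^+ 2)%:E = 0.
  have := ge0_integral_tup P X Xs iid i (fun x => (f k (x k) ^+ 2)%:E).
  rewrite /tup => -> //; apply: (measurableT_comp msq); exact: measurable_coord.
have ae0 (V : {RV P >-> T k}) : \int[P]_w (f k (V w) ^+ 2)%:E = 0 ->
    {ae P, forall w, f k (V w) = 0%R}.
  move=> E0; have mV : measurable_fun setT (fun w => (f k (V w) ^+ 2)%:E).
    by apply/measurable_EFinP; apply: measurable_funX; exact: mfc.
  have : \int[P]_w `|(f k (V w) ^+ 2)%:E| = 0.
    by under eq_integral do rewrite gee0_abs//.
  move=> /(ae_eq_integral_abs P measurableT mV); apply: filterS => w /(_ I) /=.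
  by move=> /eqP; rewrite eqe sqrf_eq0 => /eqP.
have prod0 (V : forall k, {RV P >-> T k}) w : f k (V k w) = 0%R ->
    (\prod_(j < p) f j (V j w) = 0)%R.
  by move=> h; rewrite (bigD1 k)//= h mul0r.
have Eprod : 'E_P[fun w => (\prod_(j < p) f j (X j w))%R] = 0.
  rewrite unlock; rewrite -[RHS](@integral0 _ _ _ P setT); apply: ae_eq_integral => //.
    apply/measurable_EFinP; apply: measurable_prod => j _.
    by apply: (measurableT_comp (mf j)); exact: measurable_funP.
  by have := ae0 _ EX; apply: filterS => w h _; rewrite prod0.
have : {ae P, forall w, forall i : 'I_N, f k (Xs i k w) = 0%R}.
  by apply: filter_forall => i; exact: ae0.
apply: filterS => w h; rewrite /product_deviation Eprod big1; last first.
  by move=> i _; rewrite (prod0 (Xs i)).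
by rewrite mul0r sube0 abse0.
Qed.

End vanishing.

(** * The rate in the extended reals *)

Section signs.
Context {R : realType} {d : measure_display} {T : measurableType d}.
Context (mu : probability T R) (F : set (T -> R)).
Hypothesis F0 : F !=set0.

Lemma psi2_diam_ge0 : 0 <= psi2_diam mu F.
Proof.
have [f Ff] := F0; apply: le_trans (psi2_norm_ge0 mu f) _.
by apply: ereal_sup_ubound; exists f.
Qed.

Lemma gamma_psi2_ge0 : 0 <= gamma_psi2 mu F.
Proof.
have [f Ff] := F0; apply: le_ereal_inf_tmp => _ [A _ <-].
apply: (@le_trans _ _ (\sum_(0 <= s <oo) (2 `^ (s%:R / 2))%:E * set_dist (psi2_dist mu) f (A s))).
  apply: nneseries_ge0 => s _ _.
  by rewrite mule_ge0 ?lee_fin ?powR_ge0// set_dist_ge0.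
by apply: ereal_sup_ubound; exists f.
Qed.

Lemma gamma_bar_ge0 : 0 <= gamma_bar mu F.
Proof.
rewrite /gamma_bar; case: ifP => // _.
by rewrite mule_ge0 ?inve_ge0 ?gamma_psi2_ge0 ?psi2_diam_ge0.
Qed.

Lemma gamma_bar_pinfty : psi2_diam mu F != 0 ->
  psi2_diam mu F = +oo \/ gamma_psi2 mu F = +oo -> gamma_bar mu F = +oo.
Proof.
move=> D0; rewrite /gamma_bar; have [//|Doo] := eqVneq (psi2_diam mu F) +oo.
case=> [h|->]; first by rewrite h eqxx in Doo.
have Dfin : psi2_diam mu F \is a fin_num by rewrite ge0_fin_numE ?psi2_diam_ge0// ltey.
have h : fine (psi2_diam mu F) != 0%R by rewrite fine_eq0.
rewrite -(fineK Dfin) inver (negbTE h).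
by rewrite gt0_mulye// lte_fin invr_gt0 lt_neqAle eq_sym h fine_ge0// psi2_diam_ge0.
Qed.

End signs.

Section rate.
Context {R : realType} {N p : nat} {d : 'I_p -> measure_display}.
Context {T : forall k, measurableType (d k)} (mu : forall k, probability (T k) R).
Context (F : forall k, set (T k -> R)).
Hypothesis N0 : (0 < N)%N.
Hypothesis F0 : forall k, F k !=set0.

Lemma rateE_pinfty k : gamma_bar (mu k) (F k) = +oo -> rateE N mu F = +oo.
Proof.
move=> gk; have s0 : 0 <= (Num.sqrt (ln N%:R))%:E :> \bar R by rewrite lee_fin sqrtr_ge0.
have g0 j := gamma_bar_ge0 (mu j) (F j) (F0 j).
rewrite /rateE (bigD1 k)//= gk addye; last first.
  by rewrite gt_eqF// (lt_le_trans ltNy0)// sume_ge0.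
rewrite gt0_mulye; last first.
  by rewrite inver gt_eqF ?sqrtr_gt0 ?ltr0n// lte_fin invr_gt0 sqrtr_gt0 ltr0n.
rewrite addye// gt_eqF// (lt_le_trans ltNy0)// mule_ge0 ?inve_ge0 ?lee_fin//.
by apply: prode_ge0 => j _; rewrite adde_ge0.
Qed.

Lemma rateE_fin (D gr : 'I_p -> R) : (forall k, 0 < D k)%R ->
  (forall k, psi2_diam (mu k) (F k) = (D k)%:E) ->
  (forall k, gamma_psi2 (mu k) (F k) = (gr k)%:E) ->
  rateE N mu F = ((\sum_(k < p) gr k / D k) / Num.sqrt N%:R +
    (\prod_(k < p) (gr k / D k + Num.sqrt (ln N%:R))) / N%:R)%:E.
Proof.
move=> D0 HD Hg.
have gE k : gamma_bar (mu k) (F k) = (gr k / D k)%:E.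
  by rewrite /gamma_bar HD Hg /= inver gt_eqF.
rewrite /rateE; under eq_bigr do rewrite gE.
under [X in _ + X / _]eq_bigr do rewrite gE -EFinD.
by rewrite sumEFin prodEFin !inver !gt_eqF ?sqrtr_gt0 ?ltr0n.
Qed.

End rate.

Theorem theorem2p2 (R : realType) (p : nat) (q : R) (hp : (2 <= p)%N)
    (hq : (1 <= q)%R) :
  exists c : R, (0 < c)%R /\
    forall (N : nat) (hN : (0 < N)%N)
      (d : 'I_p -> measure_display) (T : forall k, measurableType (d k))
      (mu : forall k, probability (T k) R)
      (d0 : measure_display) (Omega : measurableType d0) (P : probability Omega R)
      (X : forall k, {RV P >-> T k}) (Xs : 'I_N -> forall k, {RV P >-> T k})
      (F : forall k, set (T k -> R)),
      iid_tuples (fun o : option 'I_N => if o is Some i then Xs i else X) ->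
      (forall k (A : set (T k)), measurable A -> distribution P (X k) A = mu k A) ->
      (forall k f, F k f -> measurable_fun setT f) ->
      (forall k, F k !=set0) ->
      (forall k, F k (fun=> 0%R) \/
                 (forall f, F k f -> F k (fun x => (- f x)%R))) ->
      (Esup P [set f : forall k, T k -> R | forall k, F k (f k)]
         (fun f w => product_deviation X Xs f w `^ q)) `^ q^-1
      <= c%:E * ((\prod_(k < p) psi2_diam (mu k) (F k)) * rateE N mu F).
Proof.
have q0 : (0 < q)%R by lra.
have qi0 : (0 < q^-1)%R by rewrite invr_gt0.
have qi1 : (q^-1 <= 1)%R by rewrite invf_le1.
pose m := (Num.truncn (p.+1%:R * q)).+1.
have hm : (p.+1%:R * q <= m%:R)%R by exact/ltW/truncnS_gt.
pose K : R := union_cst (p := p) 5.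
have K1 : (1 <= K)%R.
  have : (0 <= p%:R :> R)%R by []; rewrite /K /union_cst; lra.
have Cm1 : (1 <= moment_cst K m)%R.
  have f1 : (1 <= m`!%:R :> R)%R by rewrite ler1n fact_gt0.
  have e1 : (1 <= expR K)%R by rewrite -[leLHS]expR0 ler_expR; lra.
  by have := mulr_ege1 f1 e1; rewrite /moment_cst; lra.
have V0 : (0 <= deviation_cst (p := p) :> R)%R.
  rewrite /deviation_cst /chaining_cst /tprod_cst /cross_cst /prod_moment_cst.
  by do 40 (rewrite ?addr_ge0 ?mulr_ge0 ?exprn_ge0 ?expR_ge0//).
exists ((1 + deviation_cst (p := p)) * moment_cst K m)%R; split.
  by rewrite mulr_gt0//; lra.
move=> N hN d T mu d0 Omega P X Xs F iid lawX mF F0 symF.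
set E := Esup _ _ _.
have E0 : 0 <= E.
  apply: ereal_sup_ubound; exists 0%N, (fun j : 'I_0 => fun k => (fun=> 0%R)).
  split; first by case.
  by under eq_integral do rewrite big_ord0; rewrite integral0.
have mpd (f : forall k, T k -> R) : (forall k, F k (f k)) ->
    measurable_fun setT (product_deviation X Xs f).
  by move=> Ff; apply: measurable_product_deviation => k; exact: mF.
have [[k dk0]|ndiam0] := pselect (exists k, psi2_diam (mu k) (F k) = 0).
  have -> : E = 0.
    apply/eqP; rewrite eq_le E0 andbT; apply: ge_ereal_sup => _ [n [t [Ft ->]]].
    have n0 j : psi2_norm (mu k) (t j k) = 0.
      apply/eqP; rewrite eq_le psi2_norm_ge0 andbT -dk0.
      by apply: ereal_sup_ubound; exists (t j k) => //; exact: Ft.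
    rewrite (@ge0_ae_eq_integral _ _ _ P setT _ (cst 0)) ?integral0//.
    - apply: measurable_bigmaxe => j.
      by apply: (measurableT_comp (measurable_poweR q)); apply: mpd; exact: Ft.
    - by move=> w _; exact: bigmax_ge_id.
    have : {ae P, forall w, forall j : 'I_n, product_deviation X Xs (t j) w = 0}.
      apply: filter_forall => j; apply: (product_deviation_ae0 P mu X Xs iid lawX k) => //.
      by move=> k'; apply: mF; exact: Ft.
    apply: filterS => w h _ /=; apply/eqP; rewrite eq_le bigmax_ge_id andbT.
    by apply: bigmax_le => // j _; rewrite h poweR0r// gt_eqF.
  rewrite poweR0r ?gt_eqF// (bigD1 k)//= dk0 !mul0e mule0//.
have D0 k : 0 < psi2_diam (mu k) (F k).
  rewrite lt_neqAle psi2_diam_ge0// andbT eq_sym; apply/eqP => h.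
  by apply: ndiam0; exists k.
have c0 : 0 < ((1 + deviation_cst (p := p)) * moment_cst K m)%:E.
  by rewrite lte_fin mulr_gt0//; lra.
have [[k Hk]|fin] := pselect (exists k, psi2_diam (mu k) (F k) = +oo \/
    gamma_psi2 (mu k) (F k) = +oo).
  rewrite (rateE_pinfty mu F hN F0 k); last first.
    by apply: gamma_bar_pinfty => //; rewrite gt_eqF.
  have prod0 : 0 < \prod_(j < p) psi2_diam (mu j) (F j).
    by apply: (big_ind (fun x => 0 < x)) => // x y; exact: mule_gt0.
  by rewrite (gt0_muley prod0) gt0_muley// leey.
have Dfin k : psi2_diam (mu k) (F k) \is a fin_num.
  rewrite ge0_fin_numE ?psi2_diam_ge0// ltey; apply/eqP => h.
  by apply: fin; exists k; left.
have gfin k : gamma_psi2 (mu k) (F k) \is a fin_num.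
  rewrite ge0_fin_numE ?gamma_psi2_ge0// ltey; apply/eqP => h.
  by apply: fin; exists k; right.
pose D k := fine (psi2_diam (mu k) (F k)).
pose gr k := fine (gamma_psi2 (mu k) (F k)).
have HD k : psi2_diam (mu k) (F k) = (D k)%:E by rewrite fineK.
have Hg k : gamma_psi2 (mu k) (F k) = (gr k)%:E by rewrite fineK.
have Dp k : (0 < D k)%R by rewrite -lte_fin -HD.
have gp k : (0 <= gr k)%R by rewrite fine_ge0// gamma_psi2_ge0.
rewrite (rateE_fin mu F hN D gr)//; under [X in _ * (X * _)]eq_bigr do rewrite HD.
rewrite prodEFin -!EFinM.
set r := ((\sum_(k < p) _) / _ + _)%R; set Dpr := (\prod_(k < p) D k)%R.
have r0 : (0 <= r)%R.
  rewrite /r addr_ge0// divr_ge0 ?sqrtr_ge0 ?sumr_ge0 ?prodr_ge0// => k _.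
    by rewrite divr_ge0// ltW.
  by rewrite addr_ge0 ?sqrtr_ge0// divr_ge0// ltW.
have Dpr0 : (0 <= Dpr)%R by apply: prodr_ge0 => k _; exact: ltW.
pose A : R := (deviation_cst (p := p) * (Dpr * r))%R.
have A0 : (0 <= A)%R by apply: mulr_ge0 => //; exact: mulr_ge0.
have EA : E <= (A `^ q * moment_cst K m)%:E.
  apply: ge_ereal_sup => _ [n [t [Ft ->]]].
  have [L [mL L0 EL HL]] := deviation_bound P mu X Xs F D gr iid lawX hN hp mF symF
    Dp HD Hg n t Ft.
  apply: (integral_max_moment P n _ L A K q p.+1 m) => //.
  - by move=> j; apply: mpd; exact: Ft.
  - by move=> j w; exact: abse_ge0.
  - move=> j w; apply: le_trans (HL j w) _; rewrite lee_fin /A -/r -/Dpr -/K.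
    by rewrite le_eqVlt; apply/orP; left; apply/eqP; ring.
apply: (@le_trans _ _ ((A `^ q * moment_cst K m)%:E `^ q^-1)).
  by apply: gt0_ler_poweR; rewrite ?in_itv/= ?leey ?andbT ?(ltW qi0)//;
    rewrite (le_trans E0 EA).
have Cm0 : (0 <= moment_cst K m)%R by lra.
rewrite poweR_EFin lee_fin powRM ?powR_ge0// -powRrM divff ?gt_eqF// powRr1//.
apply: (@le_trans _ _ (A * moment_cst K m)%R).
  rewrite ler_wpM2l//; apply: (@le_trans _ _ (moment_cst K m `^ 1)%R).
    exact: ler_powR.
  by rewrite powRr1.
rewrite [leRHS](_ : _ = (1 + deviation_cst (p := p)) * (Dpr * r) * moment_cst K m)%R; last by ring.
by rewrite ler_wpM2r// /A ler_wpM2r ?(mulr_ge0 Dpr0 r0)//; lra.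
Qed.
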